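(* Let $\bar f$, $\bar G$, $\bar R$, $\bar S$, $\bar M$ and $\bar G^{(1)}$ be as in the context. Then the complex $\Omega^\bullet(\bar M,d\bar G^{(1)}\wedge)$ is acyclic except in top dimension $n$, and $H^n(\Omega^\bullet(\bar M,d\bar G^{(1)}\wedge))=\bar M/\sum_{l=1}^n x_l\frac{\partial\bar G^{(1)}}{\partial x_l}\bar M$ is a free $\bar S$-module of rank $\dim_{\mathbb F_q}\big(\bar R/\sum_{i=1}^nx_i\frac{\partial\bar f}{\partial x_i}\bar R\big)=n!\,\mathrm{vol}(\Delta(\bar f))$. Moreover, if $\bar B$ is a set of monomials such that the $\mathbb F_q$-span $\bar V$ of $\bar B$ in $\bar R$ satisfies $\bar R=\bar V\oplus\sum_{i=1}^nx_i\frac{\partial\bar f}{\partial x_i}\bar R$, then \[ \bar M=\bar W\oplus\sum_{i=1}^nx_i\frac{\partial\bar G^{(1)}}{\partial x_i}\bar M, \] where $\bar W$ is the free $\bar S$-submodule of $\bar M$ generated by the monomials in $\bar B$.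
   Context: Let $\bar f\in\mathbb F_q[x_1^{\pm1},\dots,x_n^{\pm1}]$ with support $\Sigma$; $\Delta(\bar f)$ is the convex hull of $\Sigma\cup\{0\}$ in $\mathbb R^n$, assumed of dimension $n$; $\mathrm{Cone}(\bar f)$ the union of rays from $0$ through $\Delta(\bar f)$, $M(\bar f)=\mathbb Z^n\cap\mathrm{Cone}(\bar f)$; $w(\mu)$ the least $c\ge0$ with $\mu\in c\Delta(\bar f)$. $\bar f$ is nondegenerate: for each closed face $\sigma$ of $\Delta(\bar f)$ not containing $0$, with $\bar f^\sigma$ the sum of the terms of $\bar f$ with exponents in $\sigma$, the $x_i\partial\bar f^\sigma/\partial x_i$ have no common zero in $(\overline{\mathbb F}_q^* )^n$. $\bar R$ is the graded ring associated to $\mathbb F_q[M(\bar f)]$ filtered by $w$: it has basis $\{x^\mu\}_{\mu\in M(\bar f)}$ and $x^\mu x^\nu=x^{\mu+\nu}$ if $\mu,\nu$ are cofacial (the rays from $0$ to $\mu$ and to $\nu$ meet a common closed face of $\Delta(\bar f)$), and $0$ otherwise. $\bar G(x,t)=\bar f(x)+\bar P(x,t)\in\mathbb F_q[x^{\pm},t_1^{\pm1},\dots,t_s^{\pm1}]$, where every $x$-exponent $\mu$ of $\bar P$ lies in $\mathrm{Cone}(\bar f)$ with $w(\mu)<1$, and all monomials of $\bar f$ have weight $w=1$. $\Gamma$ is the convex hull in $\mathbb R^s$ of $\{0\}\cup\{\frac1{1-w(\mu)}\gamma:(\gamma,\mu)\in\mathrm{Supp}(\bar P)\}$ (support = exponent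 pairs of $t^\gamma x^\mu$ with nonzero coefficient), $M(\Gamma)=\mathbb Z^s\cap\mathrm{Cone}(\Gamma)$, $w_\Gamma(\gamma)$ the least $c\ge0$ with $\gamma\in c\Gamma$, and $W(\gamma,\mu)=w_\Gamma(\gamma)+w(\mu)$ on $M(\Gamma)\times M(\bar f)$. $\bar S$ is the graded ring of $\mathbb F_q[M(\Gamma)]$ filtered by $w_\Gamma$, and $\bar M$ the graded ring of $\mathbb F_q[M(\Gamma)\times M(\bar f)]$ filtered by $W$; $\bar M$ is an $\bar S$-algebra with $(t^\gamma x^\mu)(t^\beta x^\nu)=t^{\gamma+\beta}x^{\mu+\nu}$ if $\gamma,\beta$ are cofacial with respect to a closed face of $\Gamma$ and $\mu,\nu$ are cofacial with respect to a closed face of $\Delta(\bar f)$, and $0$ otherwise. $\bar G^{(1)}$ is the element of $\bar M$ consisting of the terms of $\bar G$ of $W$-weight exactly $1$. $\Omega^i(\bar M,d\bar G^{(1)}\wedge)=\bigoplus_{1\le k_1<\dots<k_i\le n}\bar M\,\frac{dx_{k_1}}{x_{k_1}}\wedge\dots\wedge\frac{dx_{k_i}}{x_{k_i}}$ with boundary $\omega\mapsto\big(\sum_{l=1}^n x_l\frac{\partial\bar G^{(1)}}{\partial x_l}\frac{dx_l}{x_l}\big)\wedge\omega$ (here $x_l\partial/\partial x_l$ acts on $t^\gamma x^\mu$ by multiplication by $\mu_l$). *)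

(* Defs.v *)
From HB Require Import structures.
From mathcomp Require Import all_boot all_order all_algebra.
From mathcomp Require Import mxpoly finmap monalg.
From mathcomp Require Import ring.
From mathcomp Require Import all_classical all_reals.
From mathcomp Require Import ereal topology normedtype sequences.

Set Implicit Arguments.
Unset Strict Implicit.
Unset Printing Implicit Defensive.

Import Order.TTheory GRing.Theory Num.Theory.
Local Open Scope classical_set_scope.
Local Open Scope ring_scope.

(* A commutative monoid with zero, given by its nonzero elements: the product
   [zmul x y] is [None] when it is zero. *)
HB.mixin Record isMonoid0 K of Choice K := {
  zone : K;
  zmul : K -> K -> option K;
  zmulC : forall x y, zmul x y = zmul y x;
  zmulA : forall x y z, obind (zmul x) (zmul y z) = obind (zmul^~ z) (zmul x y);
  zmul1 : forall x, zmul zone x = Some x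
}.

#[short(type="monoid0Type")]
HB.structure Definition Monoid0 := { K of Choice K & isMonoid0 K }.

Section ProdMonoid0.
Variables K1 K2 : monoid0Type.
Implicit Types x y z : K1 * K2.

Definition pair_zmul x y : option (K1 * K2) :=
  if zmul x.1 y.1 is Some u then
    if zmul x.2 y.2 is Some v then Some (u, v) else None
  else None.

Lemma pair_zmulC x y : pair_zmul x y = pair_zmul y x.
Proof. by rewrite /pair_zmul (zmulC x.1) (zmulC x.2). Qed.

Lemma pair_zmulA x y z :
  obind (pair_zmul x) (pair_zmul y z) = obind (pair_zmul^~ z) (pair_zmul x y).
Proof.
rewrite /pair_zmul; have := zmulA x.1 y.1 z.1; have := zmulA x.2 y.2 z.2.
case: (zmul y.1 z.1) => [a|] /=; case: (zmul y.2 z.2) => [b|] /=;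
case: (zmul x.1 y.1) => [c|] /=; case: (zmul x.2 y.2) => [d|] //=;
by do ?[move=> ->|move=> <-]; do ?case: (zmul _ _).
Qed.

Lemma pair_zmul1 x : pair_zmul (zone, zone) x = Some x.
Proof. by case: x => a b; rewrite /pair_zmul /= !zmul1. Qed.

HB.instance Definition _ := isMonoid0.Build (K1 * K2)%type
  pair_zmulC pair_zmulA pair_zmul1.

End ProdMonoid0.

(* The algebra with F-basis K, where [zmul x y = None] means x * y = 0. *)
Definition calg (F : fieldType) (K : monoid0Type) := {malg F[K]}.

Section ContractedAlgebra.
Variables (F : fieldType) (K : monoid0Type).
Implicit Types (g : calg F K) (k : K) (c : F).

HB.instance Definition _ := GRing.Lmodule.on (calg F K).

Definition cmon c (ok : option K) : calg F K :=
  if ok is Some k then << c *g k >> else 0.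

Definition calg1 : calg F K := << zone >>.

Definition cmul g1 g2 : calg F K :=
  \sum_(k1 <- msupp g1) \sum_(k2 <- msupp g2)
     cmon (g1@_k1 * g2@_k2) (zmul k1 k2).

Lemma cmon0 ok : cmon 0 ok = 0.
Proof. by case: ok => //= k; rewrite monalgU0. Qed.

Lemma cmonD c1 c2 ok : cmon (c1 + c2) ok = cmon c1 ok + cmon c2 ok.
Proof. by case: ok => [k|] /=; rewrite ?monalgUD ?addr0. Qed.

Lemma cmulEw (d1 d2 : {fset K}) g1 g2 :
  (msupp g1 `<=` d1)%fset -> (msupp g2 `<=` d2)%fset ->
  cmul g1 g2 = \sum_(k1 <- d1) \sum_(k2 <- d2)
     cmon (g1@_k1 * g2@_k2) (zmul k1 k2).
Proof.
move=> le_d1 le_d2; rewrite /cmul (big_fset_incl _ le_d1) /=.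
  apply/eq_bigr=> k1 _; apply/big_fset_incl => // k _ /mcoeff_outdom ->.
  by rewrite mulr0 cmon0.
move=> k _ /mcoeff_outdom g1k.
by rewrite big1 // => k' _; rewrite g1k mul0r cmon0.
Qed.

Lemma cmulC : commutative cmul.
Proof.
move=> g1 g2; rewrite /cmul exchange_big; apply: eq_bigr => k1 _.
by apply: eq_bigr => k2 _; rewrite mulrC zmulC.
Qed.

Lemma cmulDl : left_distributive cmul +%R.
Proof.
move=> g1 g2 g.
rewrite (cmulEw (msuppD_le g1 g2) (fsubset_refl _)).
rewrite (cmulEw (fsubsetUl (msupp g1) (msupp g2)) (fsubset_refl _)).
rewrite (cmulEw (fsubsetUr (msupp g1) (msupp g2)) (fsubset_refl _)).
rewrite -big_split /=; apply/eq_bigr=> k1 _.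
rewrite -big_split /=; apply/eq_bigr=> k2 _.
by rewrite mcoeffD mulrDl cmonD.
Qed.

Lemma cmulDr : right_distributive cmul +%R.
Proof. by move=> g g1 g2; rewrite cmulC cmulDl !(cmulC _ g). Qed.

Lemma cmul0g : left_zero 0 cmul.
Proof. by move=> g; rewrite /cmul msupp0 big_seq_fset0. Qed.

Lemma cmulg0 : right_zero 0 cmul.
Proof. by move=> g; rewrite cmulC cmul0g. Qed.

Lemma cmulUU c1 c2 k1 k2 :
  cmul << c1 *g k1 >> << c2 *g k2 >> = cmon (c1 * c2) (zmul k1 k2).
Proof. by rewrite (cmulEw msuppU_le msuppU_le) !big_seq_fset1 !mcoeffUU. Qed.

Lemma cmul_suml (I : Type) (r : seq I) (E : I -> calg F K) g :
  cmul (\sum_(i <- r) E i) g = \sum_(i <- r) cmul (E i) g.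
Proof.
exact: (big_morph (cmul^~ g) (fun _ _ => cmulDl _ _ _) (cmul0g _)).
Qed.

Lemma cmul_sumr (I : Type) (r : seq I) (E : I -> calg F K) g :
  cmul g (\sum_(i <- r) E i) = \sum_(i <- r) cmul g (E i).
Proof.
exact: (big_morph (cmul g) (fun _ _ => cmulDr _ _ _) (cmulg0 _)).
Qed.

Lemma cmul1g : left_id calg1 cmul.
Proof.
move=> g; rewrite [in LHS](monalgE g) cmul_sumr [RHS]monalgE.
by apply: eq_bigr => k _; rewrite cmulUU mul1r zmul1.
Qed.

Lemma cmulA : associative cmul.
Proof.
move=> g1 g2 g3; rewrite (monalgE g1) (monalgE g2) (monalgE g3).
pose u (g : calg F K) k : calg F K := << g@_k *g k >>.
rewrite !(cmul_suml _ (u g1)) (cmul_suml _ (fun k => cmul (u g1 k) _)).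
apply: eq_bigr => k1 _; rewrite (cmul_suml _ (u g2)) (cmul_sumr _ (u g2)).
rewrite cmul_sumr (cmul_suml _ (fun k => cmul _ (u g2 k))).
apply: eq_bigr => k2 _; rewrite !(cmul_sumr _ (u g3)) cmul_sumr.
apply: eq_bigr => k3 _; rewrite /u.
rewrite !cmulUU; have := zmulA k1 k2 k3.
case: (zmul k2 k3) => [a|] /=; case: (zmul k1 k2) => [b|] /= eq_ab.
- by rewrite !cmulUU mulrA eq_ab.
- by rewrite cmulUU cmul0g eq_ab.
- by rewrite cmulUU cmulg0 -eq_ab.
- by rewrite cmul0g cmulg0.
Qed.

Lemma calg1_neq0 : calg1 != 0.
Proof. by rewrite monalgU_eq0 oner_eq0. Qed.

HB.instance Definition _ := GRing.Zmodule_isComNzRing.Build (calg F K)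
  cmulA cmulC cmul1g cmulDl calg1_neq0.

End ContractedAlgebra.

(* The contracted algebra of a product, as an algebra over that of the first
   factor; an alias, since [calg] is already an F-module. *)
Definition biAlg (F : fieldType) (K1 K2 : monoid0Type) := calg F (K1 * K2)%type.

Section BiAlgebra.
Variables (F : fieldType) (K1 K2 : monoid0Type).
Implicit Types (a b : calg F K1) (m : biAlg F K1 K2).

HB.instance Definition _ := GRing.ComNzRing.on (biAlg F K1 K2).

Definition bi_emb a : biAlg F K1 K2 :=
  \sum_(k <- msupp a) << a@_k *g (k, zone) >>.

Lemma bi_embEw (d : {fset K1}) a : (msupp a `<=` d)%fset ->
  bi_emb a = \sum_(k <- d) << a@_k *g (k, zone) >>.
Proof.
move=> le_d; rewrite /bi_emb (big_fset_incl _ le_d) // => k _ /mcoeff_outdom ->.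
by rewrite monalgU0.
Qed.

Lemma bi_embD a b : bi_emb (a + b) = bi_emb a + bi_emb b.
Proof.
rewrite (bi_embEw (msuppD_le a b)) (bi_embEw (fsubsetUl (msupp a) (msupp b))).
rewrite (bi_embEw (fsubsetUr (msupp a) (msupp b))) -big_split /=.
by apply: eq_bigr => k _; rewrite mcoeffD monalgUD.
Qed.

Lemma bi_emb0 : bi_emb 0 = 0.
Proof. by rewrite /bi_emb msupp0 big_seq_fset0. Qed.

Lemma bi_emb_sum (I : Type) (r : seq I) (E : I -> calg F K1) :
  bi_emb (\sum_(i <- r) E i) = \sum_(i <- r) bi_emb (E i).
Proof. exact: (big_morph bi_emb bi_embD bi_emb0). Qed.

Lemma bi_embU c k : bi_emb << c *g k >> = << c *g (k, zone) >>.
Proof. by rewrite (bi_embEw msuppU_le) big_seq_fset1 mcoeffUU. Qed.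

Lemma bi_emb1 : bi_emb 1 = 1.
Proof. exact: bi_embU. Qed.

Lemma bi_embM a b : bi_emb (a * b) = bi_emb a * bi_emb b.
Proof.
pose u (g : calg F K1) k : calg F K1 := << g@_k *g k >>.
have uE g : g = \sum_(k <- msupp g) u g k by exact: monalgE.
rewrite [in LHS](uE a) [in LHS](uE b) [in RHS](uE a) [in RHS](uE b).
rewrite mulr_suml !bi_emb_sum mulr_suml; apply: eq_bigr => k1 _.
rewrite mulr_sumr bi_emb_sum mulr_sumr; apply: eq_bigr => k2 _; rewrite /u.
rewrite !bi_embU; transitivity (cmul << a@_k1 *g (k1, zone : K2) >>
                                     << b@_k2 *g (k2, zone) >>) => //.
rewrite cmulUU [zmul in RHS]/zmul /= /pair_zmul /= zmul1.
transitivity (bi_emb (cmul << a@_k1 *g k1 >> << b@_k2 *g k2 >>)) => //.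
by rewrite cmulUU; case: (zmul _ _) => [k|] /=; rewrite ?bi_embU ?bi_emb0.
Qed.

Definition bi_scale a m : biAlg F K1 K2 := bi_emb a * m.

Lemma bi_scaleA a b m : bi_scale a (bi_scale b m) = bi_scale (a * b) m.
Proof. by rewrite /bi_scale bi_embM mulrA. Qed.

Lemma bi_scale1 : left_id 1 bi_scale.
Proof. by move=> m; rewrite /bi_scale bi_emb1 mul1r. Qed.

Lemma bi_scaleDr : right_distributive bi_scale +%R.
Proof. by move=> a m1 m2; rewrite /bi_scale mulrDr. Qed.

Lemma bi_scaleDl m : {morph bi_scale^~ m : a b / a + b}.
Proof. by move=> a b; rewrite /bi_scale bi_embD mulrDl. Qed.

HB.instance Definition _ := GRing.Zmodule_isLmodule.Build (calg F K1)
  (biAlg F K1 K2) bi_scaleA bi_scale1 bi_scaleDr bi_scaleDl.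

Lemma bi_scaleAl a (m1 m2 : biAlg F K1 K2) : a *: (m1 * m2) = (a *: m1) * m2.
Proof. exact: mulrA. Qed.

HB.instance Definition _ := GRing.Lmodule_isLalgebra.Build (calg F K1)
  (biAlg F K1 K2) bi_scaleAl.

HB.instance Definition _ := GRing.Lalgebra_isComAlgebra.Build (calg F K1)
  (biAlg F K1 K2).

End BiAlgebra.

Section Geometry.
Variables (R : realType) (n : nat).
Implicit Types (A D sigma : set 'rV[R]_n) (u v x : 'rV[R]_n).

Definition conv_hull A : set 'rV[R]_n :=
  [set x | exists (m : nat) (p : 'I_m -> 'rV[R]_n) (c : 'I_m -> R),
     [/\ forall i, A (p i), forall i, 0 <= c i, \sum_i c i = 1
       & x = \sum_i c i *: p i]].

Definition hull0 A := conv_hull (0 |` A).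

Definition aff_indep_in D (d : nat) :=
  exists (x : 'rV[R]_n) (B : 'M[R]_(d, n)),
    [/\ D x, forall i, D (x + row i B) & row_free B].

Definition has_dim D (d : nat) := aff_indep_in D d /\ ~ aff_indep_in D d.+1.

Definition cone D : set 'rV[R]_n :=
  [set v | exists (c : R) x, [/\ 0 <= c, D x & v = c *: x]].

(* The infimum is a minimum when [D] is compact and [v] is in [cone D]; it is 0
   by convention when [v] is not in [cone D]. *)
Definition weight D v : R :=
  inf [set c | 0 <= c /\ exists2 x, D x & v = c *: x].

Definition dot u v : R := \sum_(i < n) u 0 i * v 0 i.

Definition closed_face D sigma :=
  sigma !=set0 /\
  exists (l : 'rV[R]_n) (m : R), (forall x, D x -> dot l x <= m) /\
    sigma = [set x | D x /\ dot l x = m].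

(* Only faces that avoid the origin count: every ray meets a face through the
   origin, and x^mu x^nu is to be nonzero exactly when the weights of mu and nu
   add up.  The origin is cofacial with every point. *)
Definition cofacial D u v :=
  [\/ u = 0, v = 0 |
      exists sigma, [/\ closed_face D sigma, ~ sigma 0, cone sigma u
                      & cone sigma v]].

Definition volume_box (b : option ('rV[R]_n * 'rV[R]_n)) : R :=
  if b is Some ab then \prod_(i < n) Num.max 0 (ab.2 0 i - ab.1 0 i) else 0.

Definition set_box (b : option ('rV[R]_n * 'rV[R]_n)) : set 'rV[R]_n :=
  if b is Some ab then [set x | forall i, ab.1 0 i <= x 0 i <= ab.2 0 i]
  else set0.

(* n-dimensional Lebesgue (outer) measure.  [None] is the empty box, needed in
   dimension 0, where every box is a point of volume 1. *)
Definition volume D : \bar R :=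
  ereal_inf [set (\sum_(0 <= k <oo) (volume_box (B k))%:E)%E
            | B in [set B : nat -> option ('rV[R]_n * 'rV[R]_n)
                   | D `<=` \bigcup_k set_box (B k)]].

Lemma dotD l u v : dot l (u + v) = dot l u + dot l v.
Proof.
by rewrite /dot -big_split; apply: eq_bigr => i _; rewrite mxE mulrDr.
Qed.

Lemma dotZ l c v : dot l (c *: v) = c * dot l v.
Proof.
by rewrite /dot mulr_sumr; apply: eq_bigr => i _; rewrite mxE mulrCA.
Qed.

Lemma dot0 l : dot l 0 = 0.
Proof. by rewrite /dot big1 // => i _; rewrite mxE mulr0. Qed.

Lemma conv_hull_convex A x y (c : R) : 0 <= c -> c <= 1 ->
  conv_hull A x -> conv_hull A y -> conv_hull A (c *: x + (1 - c) *: y).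
Proof.
move=> c0 c1 [m1 [p1 [c1' [Ap1 p1ge0 sum1 ->]]]].
move=> [m2 [p2 [c2' [Ap2 p2ge0 sum2 ->]]]].
exists (m1 + m2)%N.
exists (fun i => match fintype.split i with inl j => p1 j | inr j => p2 j end).
exists (fun i => match fintype.split i with
                 | inl j => c * c1' j | inr j => (1 - c) * c2' j end).
have c1ge0 : 0 <= 1 - c by rewrite subr_ge0.
have unl (j : 'I_m1) : fintype.split (lshift m2 j) = inl j := unsplitK (inl j).
have unr (j : 'I_m2) : fintype.split (rshift m1 j) = inr j := unsplitK (inr j).
split=> [i|i||]; first by case: (fintype.split i).
- by case: (fintype.split i) => j; rewrite mulr_ge0.
- rewrite big_split_ord /=.
  under eq_bigr do rewrite unl; under [X in _ + X]eq_bigr do rewrite unr.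
  by rewrite -!mulr_sumr sum1 sum2 !mulr1 subrKC.
- rewrite big_split_ord /= !scaler_sumr; congr (_ + _); apply: eq_bigr => j _.
    by rewrite unl scalerA.
  by rewrite unr scalerA.
Qed.

Lemma hull0_0 A : hull0 A 0.
Proof.
exists 1%N, (fun=> 0), (fun=> 1); split=> [i|i||] //; first by left.
  by rewrite big_ord1.
by rewrite big_ord1 scaler0.
Qed.

Lemma cone_face_add A sigma u v : closed_face (hull0 A) sigma ->
  cone sigma u -> cone sigma v -> cone sigma (u + v).
Proof.
move=> [_ [l [m [_ ->]]]] [c [x [c0 [Dx lx] ->]]] [d [y [d0 [Dy ly] ->]]].
have [cd0|cdn0] := eqVneq (c + d) 0.
  have c_0 : c = 0 by apply/eqP; rewrite eq_le c0 -cd0 lerDl d0.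
  have d_0 : d = 0 by move: cd0; rewrite c_0 add0r.
  by exists 0, x; split=> //; rewrite c_0 d_0 !scale0r addr0.
have cd_gt0 : 0 < c + d by rewrite lt_neqAle eq_sym cdn0 addr_ge0.
pose e := c / (c + d); have e1 : 1 - e = d / (c + d).
  by apply/eqP; rewrite /e subr_eq -mulrDl addrC divff // eq_sym.
exists (c + d), (e *: x + (1 - e) *: y); split; first exact: ltW.
  split; last by rewrite dotD !dotZ lx ly -mulrDl subrKC mul1r.
  apply: conv_hull_convex => //; first by rewrite divr_ge0 // ltW.
  by rewrite -subr_ge0 e1 divr_ge0 // ltW.
by rewrite e1 /e scalerDr !scalerA (mulrCA _ c) (mulrCA _ d) !divff // !mulr1.
Qed.

Lemma cone_face_sub D sigma u : closed_face D sigma -> cone sigma u -> cone D u.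
Proof. by move=> [_ [l [m [_ ->]]]] [c [x [c0 [Dx _] ->]]]; exists c, x. Qed.

Lemma cone_cofacialD A u v : cone (hull0 A) u -> cone (hull0 A) v ->
  cofacial (hull0 A) u v -> cone (hull0 A) (u + v).
Proof.
move=> Du Dv [->|->|[sigma [Fs _ su sv]]]; rewrite ?add0r ?addr0 //.
exact: cone_face_sub Fs (cone_face_add Fs su sv).
Qed.

Lemma cofacialC D u v : cofacial D u v -> cofacial D v u.
Proof.
move=> [->|->|[sigma [Fs s0 su sv]]]; [exact: Or32|exact: Or31|].
by apply: Or33; exists sigma.
Qed.

Lemma cone_face_split A sigma tau u v :
  closed_face (hull0 A) sigma -> closed_face (hull0 A) tau ->
  ~ sigma 0 -> ~ tau 0 -> cone sigma u -> cone sigma v -> cone tau (u + v) ->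
  cone tau u /\ cone tau v.
Proof.
move=> [_ [l [m [lm ->]]]] [_ [k [h [kh ->]]]] s0 t0.
move=> [c [x [c0 [Dx lx] ->]]] [d [y [d0 [Dy ly] ->]]] [e [z [e0 [Dz kz] cde]]].
have m_gt0 : 0 < m.
  rewrite lt_neqAle; have := lm 0 (hull0_0 A); rewrite dot0 => ->.
  rewrite andbT; apply/eqP => m0; apply: s0; split; first exact: hull0_0.
  by rewrite dot0.
have h_gt0 : 0 < h.
  rewrite lt_neqAle; have := kh 0 (hull0_0 A); rewrite dot0 => ->.
  rewrite andbT; apply/eqP => h0; apply: t0; split; first exact: hull0_0.
  by rewrite dot0.
have cd_le_e : c + d <= e.
  rewrite -(ler_pM2r m_gt0) mulrDl -[in c * _]lx -[in d * _]ly.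
  rewrite -!dotZ -dotD cde dotZ.
  by rewrite ler_wpM2l // lm.
have ek : e * h = c * dot k x + d * dot k y by rewrite -!dotZ -dotD cde dotZ kz.
have kx : c * dot k x <= c * h by rewrite ler_wpM2l // kh.
have ky : d * dot k y <= d * h by rewrite ler_wpM2l // kh.
have cdeh : (c + d) * h <= e * h by rewrite ler_pM2r.
have kxE : c * dot k x = c * h.
  apply/eqP; rewrite eq_le kx /= -(lerD2r (d * h)) -mulrDl.
  by apply: le_trans cdeh _; rewrite ek lerD2l.
have kyE : d * dot k y = d * h.
  apply/eqP; rewrite eq_le ky /= -(lerD2l (c * h)) -mulrDl.
  by apply: le_trans cdeh _; rewrite ek lerD2r.
have aux (r : R) w : 0 <= r -> hull0 A w -> r * dot k w = r * h ->
    cone [set x | hull0 A x /\ dot k x = h] (r *: w).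
  move=> r0 Dw rE; have [r_0|rn0] := eqVneq r 0.
    by exists 0, z; split=> //; rewrite r_0 !scale0r.
  by exists r, w; split=> //; split=> //; apply: (mulfI rn0).
by split; apply: aux.
Qed.

Lemma cone_face_add0 A sigma u v : closed_face (hull0 A) sigma -> ~ sigma 0 ->
  cone sigma u -> cone sigma v -> u + v = 0 -> u = 0 /\ v = 0.
Proof.
move=> [_ [l [m [lm ->]]]] s0 [c [x [c0 [Dx lx] ->]]] [d [y [d0 [Dy ly] ->]]].
move=> /(congr1 (dot l)); rewrite dotD !dotZ dot0 lx ly -mulrDl => /eqP.
rewrite mulf_eq0 => /orP[|/eqP m0]; last first.
  by case: s0; split; [exact: hull0_0|rewrite dot0 m0].
by rewrite paddr_eq0 // => /andP[/eqP-> /eqP->]; rewrite !scale0r.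
Qed.

Lemma cofacialA A u v w : cofacial (hull0 A) u v ->
  cofacial (hull0 A) (u + v) w ->
  cofacial (hull0 A) v w /\ cofacial (hull0 A) u (v + w).
Proof.
move=> [->|->|[sigma [Fs s0 su sv]]].
- by rewrite add0r => vw; split=> //; apply: Or31.
- by rewrite addr0 add0r => uw; split=> //; apply: Or31.
move=> [uv0|->|[tau [Ft t0 tuv tw]]].
- have [u0 v0] := cone_face_add0 Fs s0 su sv uv0.
  by split; [rewrite v0|rewrite u0]; apply: Or31.
- by split; [exact: Or32|rewrite addr0; apply: Or33; exists sigma].
have [tu tv] := cone_face_split Fs Ft s0 t0 su sv tuv.
split; apply: Or33; exists tau; split=> //; exact: cone_face_add Ft _ _.
Qed.

End Geometry.

Section ConePoints.
Variables (R : realType) (n : nat) (A : set 'rV[R]_n).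

Definition toR (mu : 'rV[int]_n) : 'rV[R]_n := map_mx intr mu.

Definition in_cone0 (mu : 'rV[int]_n) : bool := `[< cone (hull0 A) (toR mu) >].

Record conept := ConePt { conept_val :> 'rV[int]_n; _ : in_cone0 conept_val }.

HB.instance Definition _ := [isSub for conept_val].
HB.instance Definition _ := [Choice of conept by <:].

Lemma toRD mu nu : toR (mu + nu) = toR mu + toR nu.
Proof. exact: map_mxD. Qed.

Lemma toR0 : toR 0 = 0.
Proof. exact: map_mx0. Qed.

Lemma conept0_subproof : in_cone0 0.
Proof.
apply/asboolP; rewrite toR0; exists 0, 0.
by split=> //; [exact: hull0_0|rewrite scale0r].
Qed.

Definition conept0 : conept := ConePt conept0_subproof.

Definition conept_mul (mu nu : conept) : option conept :=
  if `[< cofacial (hull0 A) (toR mu) (toR nu) >] then insub (val mu + val nu)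
  else None.

Lemma conept_mulP (mu nu : conept) :
  cofacial (hull0 A) (toR mu) (toR nu) ->
  exists2 ka : conept, conept_mul mu nu = Some ka & val ka = val mu + val nu.
Proof.
move=> cof; rewrite /conept_mul asboolT //.
have cmn : in_cone0 (val mu + val nu).
  apply/asboolP; rewrite toRD; apply: cone_cofacialD cof.
  - by case: (mu) => ? /= /asboolP.
  - by case: (nu) => ? /= /asboolP.
by rewrite insubT; eexists.
Qed.

Lemma conept_mulN (mu nu : conept) :
  ~ cofacial (hull0 A) (toR mu) (toR nu) -> conept_mul mu nu = None.
Proof. by move=> cof; rewrite /conept_mul asboolF. Qed.

Lemma conept_mulC mu nu : conept_mul mu nu = conept_mul nu mu.
Proof.
rewrite /conept_mul [in LHS]addrC; congr (if _ then _ else _).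
by apply: asbool_equiv_eq; split; apply: cofacialC.
Qed.

Lemma conept_mul1 mu : conept_mul conept0 mu = Some mu.
Proof.
have [|ka -> kaE] := @conept_mulP conept0 mu; first by apply: Or31; exact: toR0.
by congr Some; apply: val_inj; rewrite kaE add0r.
Qed.

Lemma toR_val (ka mu nu : conept) :
  val ka = val mu + val nu -> toR ka = toR mu + toR nu.
Proof. by rewrite -toRD => <-. Qed.

Lemma conept_mulA mu nu la :
  obind (conept_mul mu) (conept_mul nu la) =
  obind (conept_mul^~ la) (conept_mul mu nu).
Proof.
have [[c1 c2]|no1] := pselect (cofacial (hull0 A) (toR mu) (toR nu) /\
    cofacial (hull0 A) (toR mu + toR nu) (toR la)).
  have [d1 d2] := cofacialA c1 c2.
  have [a -> aE] := conept_mulP c1; have [b -> bE] := conept_mulP d1.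
  have [|x /= -> xE] := @conept_mulP mu b; first by rewrite (toR_val bE).
  have [|y /= -> yE] := @conept_mulP a la; first by rewrite (toR_val aE).
  congr Some; apply: val_inj => /=; move: xE yE aE bE => /= -> -> -> ->.
  by rewrite addrA.
have no2 : ~ (cofacial (hull0 A) (toR nu) (toR la) /\
    cofacial (hull0 A) (toR mu) (toR nu + toR la)).
  move=> [/cofacialC c1 /cofacialC c2]; apply: no1.
  rewrite addrC in c2; have [d1 d2] := cofacialA c1 c2.
  by split; apply: cofacialC => //; rewrite addrC.
transitivity (None : option conept).
  have [c1|/conept_mulN->//] := pselect (cofacial (hull0 A) (toR nu) (toR la)).
  have [a -> aE /=] := conept_mulP c1; apply: conept_mulN => c2; apply: no2.
  by split=> //; move: c2; rewrite (toR_val aE).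
have [c1|/conept_mulN->//] := pselect (cofacial (hull0 A) (toR mu) (toR nu)).
have [a -> aE /=] := conept_mulP c1; symmetry; apply: conept_mulN => c2.
by apply: no1; split=> //; move: c2; rewrite (toR_val aE).
Qed.

HB.instance Definition _ := isMonoid0.Build conept
  conept_mulC conept_mulA conept_mul1.

End ConePoints.

Arguments toR R {n} mu.

Section Modules.
Variables (S : pzRingType) (U V : lmodType S).
Implicit Types X Z B : set V.

Definition lin_span X : set V :=
  [set v | exists (m : nat) (x : 'I_m -> V) (c : 'I_m -> S),
     (forall i, X (x i)) /\ v = \sum_i c i *: x i].

Definition lin_free X :=
  forall (m : nat) (x : 'I_m -> V) (c : 'I_m -> S),
    injective x -> (forall i, X (x i)) -> \sum_i c i *: x i = 0 ->
    forall i, c i = 0.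

Definition direct_sum X Z :=
  (forall v, exists x z, [/\ X x, Z z & v = x + z]) /\
  (forall v, X v -> Z v -> v = 0).

(* For submodules B <= Z of V: the module Z / B has a basis of r elements. *)
Definition free_subquotient Z B (r : nat) :=
  exists b : 'I_r -> V, (forall i, Z (b i)) /\
    forall v, Z v -> exists! c : 'I_r -> S, B (v - \sum_i c i *: b i).

(* phi induces an isomorphism from Z / B onto U / N. *)
Definition subquotient_iso (phi : V -> U) Z B (N : set U) :=
  [/\ linear phi, forall v, Z v -> (B v <-> N (phi v))
    & forall u, exists2 v, Z v & N (u - phi v)].

End Modules.

Section Koszul.
Variables (M : comPzRingType) (n : nat) (g : 'I_n -> M).

Definition subset_of_card (i : nat) := {I : {set 'I_n} | #|I| == i}.

(* [w I] is the coefficient of dx_{k_1}/x_{k_1} /\ ... /\ dx_{k_i}/x_{k_i},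
   where k_1 < ... < k_i are the elements of I. *)
Definition Omega (i : nat) := {ffun subset_of_card i -> M}.

Definition Omega_coef i (w : Omega i) (I : {set 'I_n}) : M :=
  if insub I is Some J then w J else 0.

(* Exterior product on the left with \sum_l g_l dx_l/x_l. *)
Definition Omega_d i (w : Omega i) : Omega i.+1 :=
  [ffun I : subset_of_card i.+1 => \sum_(l in val I)
     (-1) ^+ #|[set k in val I | (k < l)%N]| * g l * Omega_coef w (val I :\ l)].

Lemma Omega_coefE i (w : Omega i) (J : subset_of_card i) :
  Omega_coef w (val J) = w J.
Proof. by rewrite /Omega_coef valK. Qed.

Lemma Omega_dd i (w : Omega i) : Omega_d (Omega_d w) = 0.
Proof.
apply/ffunP => I; rewrite !ffunE.
pose e (J : {set 'I_n}) (l : 'I_n) : M := (-1) ^+ #|[set k in J | (k < l)%N]|.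
pose T (l k : 'I_n) : M := e (val I) l * g l *
  (e (val I :\ l) k * g k * Omega_coef w (val I :\ l :\ k)).
have TN (l k : 'I_n) :
    l \in val I -> k \in val I -> (k < l)%N -> T k l = - T l k.
  move=> lI kI kl; rewrite /T.
  rewrite (_ : val I :\ k :\ l = val I :\ l :\ k); last first.
    by apply/setP=> j; rewrite !inE andbCA.
  have -> : e (val I :\ l) k = e (val I) k.
    congr (_ ^+ _); apply: eq_card => j; rewrite !inE.
    by case: eqP => //= ->; rewrite ltnNge (ltnW kl) andbF.
  have -> : e (val I) l = - e (val I :\ k) l.
    rewrite /e (cardsD1 k [set j in val I | (j < l)%N]) inE kI kl exprS mulN1r.
    by congr (- (_ ^+ _)); apply: eq_card => j; rewrite !inE andbA.
  by rewrite !mulNr opprK; ring.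
transitivity (\sum_(l in val I) \sum_(k in val I | k != l) T l k).
  apply: eq_bigr => l lI; rewrite -/(e _ l).
  have cIl : #|val I :\ l| == i.+1.
    by have := valP I; rewrite /= (cardsD1 l) lI.
  pose J : subset_of_card i.+1 := exist _ (val I :\ l) cIl.
  have := Omega_coefE (Omega_d w) J => /= ->; rewrite ffunE mulr_sumr /=; apply: eq_bigl => k.
  by rewrite !inE andbC.
rewrite (eq_bigr (fun l : 'I_n => \sum_(k in val I | (k < l)%N) T l k
                         + \sum_(k in val I | (l < k)%N) T l k)); last first.
  move=> l _; rewrite (bigID (fun k : 'I_n => (k < l)%N)) /=.
  congr (_ + _); apply: eq_bigl => k; rewrite -val_eqE /= neq_ltn.
    by case: ltnP; rewrite /= ?andbF ?andbT.
  by rewrite -leqNgt; case: ltngtP; rewrite /= ?andbF ?andbT.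
rewrite big_split /= [X in _ + X](exchange_big_dep (mem (val I))) /=;
  last first.
  by move=> l k _ /andP[].
rewrite -big_split big1 //= => l lI.
rewrite [X in _ + X](eq_bigl (fun k : 'I_n => (k \in val I) && (k < l)%N));
  last first.
  by move=> k; move: lI => /= ->.
rewrite -big_split big1 //= => k /andP[kI kl].
by rewrite (TN l k) // subrr.
Qed.

Definition cocycle i : set (Omega i) := [set w | Omega_d w = 0].

Definition coboundary i : set (Omega i) :=
  match i with 0%N => [set 0] | j.+1 => range (@Omega_d j) end.

Definition acyclic_at i := @cocycle i = @coboundary i.

Definition top_coef (w : Omega n) : M := Omega_coef w [set: 'I_n].

Definition gen_ideal : set M :=
  [set m | exists h : 'I_n -> M, m = \sum_l g l * h l].

End Koszul.

Arguments cocycle {M n} g i.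
Arguments coboundary {M n} g i.

Section Laurent.
Variables (R : realType) (F : fieldType) (n : nat).

(* x_l d/dx_l, where [e k] is the exponent of x in the monomial [k]. *)
Definition xdx (K : choiceType) (e : K -> 'rV[int]_n) (l : 'I_n)
    (g : {malg F[K]}) : {malg F[K]} :=
  [malg k in msupp g => (e k 0 l)%:~R * g@_k].

Implicit Types f : {malg F['rV[int]_n]}.

Definition restrict_to (sigma : set 'rV[R]_n) f : {malg F['rV[int]_n]} :=
  [malg mu in msupp f => if `[< sigma (toR R mu) >] then f@_mu else 0].

Definition laurent_eval (E : fieldType) (iota : F -> E) f (x : 'I_n -> E) : E :=
  \sum_(mu <- msupp f) iota f@_mu * \prod_(j < n) x j ^ mu 0 j.

Definition exps f : set 'rV[R]_n := [set toR R mu | mu in [set` msupp f]].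

Definition Delta f := hull0 (exps f).

Definition wDelta f (mu : 'rV[int]_n) : R := weight (Delta f) (toR R mu).

Definition laurent_nondegenerate (E : fieldType) (iota : F -> E) f :=
  forall sigma, closed_face (Delta f) sigma -> ~ sigma 0 ->
  ~ exists x : 'I_n -> E, (forall j, x j != 0) /\
      forall i, laurent_eval iota (xdx id i (restrict_to sigma f)) x = 0.

Definition Rbar f := calg F (conept (exps f)).

(* The element of Rbar given by f, whose exponents all lie in Cone(f). *)
Definition fbar f : Rbar f :=
  \sum_(mu <- msupp f) if insub mu is Some k then << f@_mu *g k >> else 0.

Definition Dfbar f (l : 'I_n) : Rbar f := xdx val l (fbar f).

End Laurent.

Arguments exps R {F n} f.
Arguments Delta R {F n} f.
Arguments wDelta R {F n} f mu.
Arguments laurent_nondegenerate R {F n E} iota f.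
Arguments Rbar R {F n} f.
Arguments fbar R {F n} f.
Arguments Dfbar R {F n} f l.

Section Family.
Variables (R : realType) (F : fieldType) (n s : nat).
Variables (f : {malg F['rV[int]_n]}).
Variables (P : {malg F[('rV[int]_s * 'rV[int]_n)%type]}).

Definition Gpoly : {malg F[('rV[int]_s * 'rV[int]_n)%type]} :=
  \sum_(mu <- msupp f) << f@_mu *g (0, mu) >> + P.

Definition gexps : set 'rV[R]_s :=
  [set (1 - wDelta R f k.2)^-1 *: toR R k.1 | k in [set` msupp P]].

Definition Gamma := hull0 gexps.

Definition wGamma (ga : 'rV[int]_s) : R := weight Gamma (toR R ga).

Definition W (k : 'rV[int]_s * 'rV[int]_n) : R := wGamma k.1 + wDelta R f k.2.

Definition Sbar := calg F (conept gexps).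

Definition Mbar := biAlg F (conept gexps) (conept (exps R f)).

(* The support of Gpoly is contained in M(Gamma) x M(f), so that [insub] drops
   no term when the weight assumptions on f and P hold. *)
Definition G1 : Mbar :=
  \sum_(k <- msupp Gpoly | W k == 1)
    match insub k.1, insub k.2 with
    | Some ga, Some mu => << Gpoly@_k *g (ga, mu) >>
    | _, _ => 0
    end.

Definition DG1 (l : 'I_n) : Mbar := xdx (fun k => val k.2) l G1.

End Family.

Arguments gexps R {F n s} f P.
Arguments Gamma R {F n s} f P.
Arguments wGamma R {F n s} f P ga.
Arguments W R {F n s} f P k.
Arguments Sbar R {F n s} f P.
Arguments Mbar R {F n s} f P.
Arguments G1 R {F n s} f P.
Arguments DG1 R {F n s} f P l.

(* Main.v *)
Require Import Defs.
From HB Require Import structures.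
From mathcomp Require Import all_boot all_order all_algebra.
From mathcomp Require finfield abelian.
From mathcomp Require Import mxpoly finmap monalg.
From mathcomp Require Import ring lra zify.
From mathcomp Require Import all_classical all_reals.
From mathcomp Require Import ereal topology normedtype sequences.

Set Implicit Arguments.
Unset Strict Implicit.
Unset Printing Implicit Defensive.

Import Order.TTheory GRing.Theory Num.Theory.
Import numFieldNormedType.Exports.
Local Open Scope classical_set_scope.
Local Open Scope ring_scope.

(** The cone over Delta(f) x {1}, rescaled so that weights become integers, is
cut out by finitely many integral forms (Fourier-Motzkin).  Its monoid algebra A
degenerates to Rbar = A/(T), where T is the monomial of height 1, and contains
homogeneous lifts of the x_i df/dx_i.  By the Nullstellensatz on the tori of the
faces, nondegeneracy makes every nontrivial monomial of A nilpotent modulo T and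
these lifts, so Rbar/(x_i df/dx_i) is finite dimensional, with a monomial basis
b_1, ..., b_r.

That the D^k b_j (D_i = x_i df/dx_i) form an F_q-basis of Rbar follows from the
Frobenius map, without any appeal to the Cohen-Macaulay property.  A linear
relation between the monomials in T, D times the b_j would make the rank rho of A
over F_q[T, D] smaller than r.  For q a power of the order of F_q, the map
g -> g^q embeds A into A and sends T, D to their q-th powers; its translates by
the lattice points of a box of side proportional to q each contribute r elements
independent modulo (T^q, D^q).  Comparing dimensions as q grows gives r <= rho.

Counting the basis by weight computes the number of lattice points of t Delta(f)
as r t^n / n! + O(t^(n-1)), while covering by cubes (from above) and by finitely
many boxes (from below, by compactness) identifies the leading coefficient with
the volume.

The partial derivatives of G^(1) differ from those of f by terms that preserve
the weight W and raise the weight of Gamma by at least some delta > 0.  Hence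
t^ga (DG)^k b_j is again an F_q-basis of Mbar, so that the x_i dG^(1)/dx_i form
a regular sequence with quotient free over Sbar on the b_j. *)

(** The obstacle is that products vanish in [Rbar], so nothing there can be translated or divided.
    In A, inside the group algebra of a lattice, multiplication by a monomial is injective and
    multiplication of exponents by q is a ring map; the price is one more element T, hence N = n + 1
    elements [y]. The rank rho is defined without fractions. The products y^k b_j carry a monomial
    order; rho counts the j for which none of them is a combination of smaller ones of its degree,
    and for every other j all but O(t^(N-1)) of them are such combinations. The comparison runs as
    follows. Let g be the number of translates. The standard products with exponents below q
    generate A modulo the y_i^q, and there are at most rho q^N + O(q^(N-1)) of them. Exchanging g r
    of them against the independent translates leaves s', so s' + g r <= rho q^N + O(q^(N-1)).
    Counting A up to degree q t in both ways gives rho q^N <= s' + g rho. Hence g (r - rho) =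
    O(q^(N-1)), whereas g is of order q^N. *)

Section LinearExtension.
Variables (F : fieldType) (K : choiceType) (V : lmodType F).
Implicit Types (h : K -> V) (g : {malg F[K]}).

Definition lext h g : V := \sum_(k <- msupp g) g@_k *: h k.

Lemma lextEw (d : {fset K}) h g : (msupp g `<=` d)%fset ->
  lext h g = \sum_(k <- d) g@_k *: h k.
Proof.
move=> le_d; rewrite /lext (big_fset_incl _ le_d) // => k _ /mcoeff_outdom ->.
by rewrite scale0r.
Qed.

Lemma lext_is_linear h : linear (lext h).
Proof.
move=> c g1 g2; have le1 := fsubset_trans (msuppZ_le c g1) (fsubsetUl _ (msupp g2)).
have le2 : (msupp (c *: g1 + g2) `<=` msupp g1 `|` msupp g2)%fset.
  apply: fsubset_trans (msuppD_le _ _) _; rewrite fsubUset le1.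
  by rewrite fsubsetUr.
rewrite (lextEw _ le2) (lextEw _ (fsubsetUl _ (msupp g2))).
rewrite (lextEw _ (fsubsetUr (msupp g1) _)) scaler_sumr -big_split /=.
by apply: eq_bigr => k _; rewrite mcoeffD mcoeffZ scalerDl scalerA.
Qed.

HB.instance Definition _ h :=
  GRing.isLinear.Build F {malg F[K]} V _ (lext h) (lext_is_linear h).

Lemma lextU h c k : lext h << c *g k >> = c *: h k.
Proof. by rewrite (lextEw _ msuppU_le) big_seq_fset1 mcoeffUU. Qed.

Lemma lextD h g1 g2 : lext h (g1 + g2) = lext h g1 + lext h g2.
Proof. exact: linearD. Qed.

Lemma lextZ h c g : lext h (c *: g) = c *: lext h g.
Proof. exact: linearZ. Qed.

Lemma lext_sum h I (s : seq I) (P : pred I) (G : I -> {malg F[K]}) :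
  lext h (\sum_(i <- s | P i) G i) = \sum_(i <- s | P i) lext h (G i).
Proof. exact: linear_sum. Qed.

Lemma malgUZ c (k : K) : << c *g k >> = c *: (<< k >> : {malg F[K]}).
Proof. by apply/malgP => k'; rewrite mcoeffZ !mcoeffU mulrnAr mulr1. Qed.

Lemma malg_ind (P : {malg F[K]} -> Prop) g : P 0 ->
  (forall c g1 g2, P g1 -> P g2 -> P (c *: g1 + g2)) ->
  (forall k, k \in msupp g -> P << k >>) -> P g.
Proof.
move=> P0 PD PU; rewrite (monalgE g) big_seq; elim/big_rec: _ => // k x kg Px.
by rewrite malgUZ; apply: PD => //; apply: PU.
Qed.

Lemma eq_lext h1 h2 g : {in msupp g, h1 =1 h2} -> lext h1 g = lext h2 g.
Proof.
by move=> e; rewrite /lext !big_seq; apply: eq_bigr => k kg; rewrite e.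
Qed.

End LinearExtension.

Lemma lext_comp (F : fieldType) (K : choiceType) (V1 V2 : lmodType F)
    (h : K -> V1) (L : V1 -> V2) (g : {malg F[K]}) : linear L ->
  L (lext h g) = lext (L \o h) g.
Proof.
move=> Llin; have L0 : L 0 = 0.
  by have := Llin (-1) 0 0; rewrite scaler0 addr0 scaleN1r addNr.
rewrite /lext; elim/big_rec2: _ => // k _ y _ <-; exact: Llin.
Qed.

Lemma lext_id (F : fieldType) (K : choiceType) (g : {malg F[K]}) :
  lext (fun k => << k >>) g = g.
Proof. by rewrite [RHS]monalgE /lext; apply: eq_bigr => k _; rewrite [RHS]malgUZ. Qed.

Lemma mcoeff_lext (F : fieldType) (K K' : choiceType)
  (h : K -> {malg F[K']}) (g : {malg F[K]}) k' :
  (lext h g)@_k' = \sum_(k <- msupp g) g@_k * (h k)@_k'.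
Proof. by rewrite /lext raddf_sum; apply: eq_bigr => k _; rewrite /= mcoeffZ. Qed.

Lemma msupp_lext (F : fieldType) (K K' : choiceType)
  (h : K -> {malg F[K']}) (g : {malg F[K]}) k' :
  k' \in msupp (lext h g) -> exists2 k, k \in msupp g & k' \in msupp (h k).
Proof.
rewrite -mcoeff_neq0 mcoeff_lext => nz.
apply: contrapT => no; case/negP: nz; apply/eqP; rewrite big_seq big1 // => k kg.
suff /eqP-> : (h k)@_k' == 0 by rewrite mulr0.
by rewrite mcoeff_eq0; apply/negP => kh; apply: no; exists k.
Qed.

(** * Contracted algebras and monoid algebras: scalars, monomials, supports *)

Section ContractedAlgebraTheory.
Variables (F : fieldType) (K : monoid0Type).
Implicit Types (g : calg F K) (k : K).

Lemma cmonZ (c a : F) (ok : option K) : c *: cmon a ok = cmon (c * a) ok.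
Proof.
case: ok => [k|] /=; last by rewrite scaler0.
transitivity (c *: (<< a *g k >> : {malg F[K]})) => //.
by rewrite malgUZ scalerA -malgUZ.
Qed.

Lemma calg_scaleAl (c : F) (g1 g2 : calg F K) : c *: (g1 * g2) = (c *: g1) * g2.
Proof.
rewrite -[LHS]/(c *: cmul g1 g2) -[RHS]/(cmul (c *: g1) g2).
rewrite (cmulEw (fsubset_refl (msupp g1)) (fsubset_refl (msupp g2))).
rewrite (cmulEw (msuppZ_le c g1) (fsubset_refl (msupp g2))).
rewrite scaler_sumr; apply: eq_bigr => k1 _.
rewrite scaler_sumr; apply: eq_bigr => k2 _.
by rewrite cmonZ mcoeffZ mulrA.
Qed.

HB.instance Definition _ :=
  GRing.Lmodule_isLalgebra.Build F (calg F K) calg_scaleAl.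
HB.instance Definition _ := GRing.Lalgebra_isComAlgebra.Build F (calg F K).

Definition cX k : calg F K := << k >>.

Lemma cXM k1 k2 : cX k1 * cX k2 = if zmul k1 k2 is Some k then cX k else 0.
Proof.
rewrite -[LHS]/(cmul (cX k1) (cX k2)) cmulUU mulr1.
by case: (zmul k1 k2).
Qed.

Lemma cX1 : cX zone = 1. Proof. by []. Qed.

Lemma calg_sumE g : g = \sum_(k <- msupp g) g@_k *: cX k.
Proof. by rewrite [LHS]monalgE; apply: eq_bigr => k _; rewrite malgUZ. Qed.

Lemma msuppX k k' : (k' \in msupp (cX k)) = (k' == k).
Proof. by rewrite msuppU oner_eq0 inE. Qed.

Lemma msupp_mul g1 g2 k : k \in msupp (g1 * g2) ->
  exists k1 k2, [/\ k1 \in msupp g1, k2 \in msupp g2 & zmul k1 k2 = Some k].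
Proof.
move=> kg; apply: contrapT => no; move: kg.
rewrite -mcoeff_neq0 => /negP; apply; apply/eqP.
rewrite -[_ * _]/(cmul g1 g2) /cmul big_seq raddf_sum big1 // => k1 k1g /=.
rewrite big_seq raddf_sum big1 // => k2 k2g /=.
case E: (zmul k1 k2) => [k'|] /=; last by rewrite mcoeff0.
rewrite mcoeffU; case: eqP => // kk; case: no; exists k1, k2.
by rewrite -kk.
Qed.

End ContractedAlgebraTheory.

Arguments cX {F K} k.

(* The monoid algebra of a commutative monoid, as a contracted algebra in which
   no product of monomials vanishes. *)
Definition lat (V : nmodType) : Type := V.

Section Lat.
Variable V : nmodType.

HB.instance Definition _ := Choice.on (lat V).

Definition lat_mul (x y : lat V) : option (lat V) := Some ((x : V) + y).

Lemma lat_mulC x y : lat_mul x y = lat_mul y x.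
Proof. by rewrite /lat_mul addrC. Qed.

Lemma lat_mulA x y z :
  obind (lat_mul x) (lat_mul y z) = obind (lat_mul^~ z) (lat_mul x y).
Proof. by rewrite /lat_mul /= addrA. Qed.

Lemma lat_mul1 x : lat_mul (0 : V) x = Some x.
Proof. by rewrite /lat_mul add0r. Qed.

HB.instance Definition _ := isMonoid0.Build (lat V) lat_mulC lat_mulA lat_mul1.

End Lat.

Section LatAlgebra.
Variables (F : fieldType) (V : nmodType).
Implicit Types (v w : V) (g : calg F (lat V)).

Definition lX v : calg F (lat V) := cX (v : lat V).

Lemma lXM v w : lX v * lX w = lX (v + w).
Proof. exact: cXM. Qed.

Lemma lX0 : lX 0 = 1. Proof. by []. Qed.

Lemma lXX v m : lX v ^+ m = lX (v *+ m).
Proof.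
elim: m => [|m IH]; first by rewrite expr0 mulr0n.
by rewrite exprS IH lXM mulrS.
Qed.

Lemma lX_prod (I : Type) (s : seq I) (Q : pred I) (G : I -> V) :
  \prod_(i <- s | Q i) lX (G i) = lX (\sum_(i <- s | Q i) G i).
Proof. by rewrite (big_morph lX (fun v w => esym (lXM v w)) lX0). Qed.

Lemma latE g : g = \sum_(v <- msupp g) g@_v *: lX v.
Proof. exact: calg_sumE. Qed.

Lemma msupp_lX v (w : lat V) : (w \in msupp (lX v)) = (w == v).
Proof. exact: msuppX. Qed.

Lemma mcoeff_lX v (w : lat V) : (lX v)@_w = (v == w)%:R.
Proof. exact: mcoeffU. Qed.

Lemma msupp_latM g1 g2 v : v \in msupp (g1 * g2) ->
  exists v1 v2, [/\ v1 \in msupp g1, v2 \in msupp g2 & v = v1 + v2 :> V].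
Proof. by move=> /msupp_mul[v1 [v2 [h1 h2 [<-]]]]; exists v1, v2. Qed.

Lemma lat_ind (P : calg F (lat V) -> Prop) g : P 0 ->
  (forall c g1 g2, P g1 -> P g2 -> P (c *: g1 + g2)) ->
  (forall v, v \in msupp g -> P (lX v)) -> P g.
Proof. exact: malg_ind. Qed.

Section Evaluation.
Variables (S : comNzRingType) (phi : {rmorphism F -> S}) (h : V -> S).
Hypotheses (h0 : h 0 = 1) (hD : {morph h : v w / v + w >-> v * w}).

(** The ring morphism out of a monoid algebra determined by a base change [phi] and a multiplicative
    [h]. Evaluation of polynomials at a point and of Laurent polynomials at a point of a torus are
    both of this kind. *)
Definition rext g : S := \sum_(k <- msupp g) phi g@_k * h k.

Lemma rextEw (d : {fset lat V}) g : (msupp g `<=` d)%fset ->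
  rext g = \sum_(k <- d) phi g@_k * h k.
Proof.
move=> le_d; rewrite /rext (big_fset_incl _ le_d) // => k _ /mcoeff_outdom ->.
by rewrite rmorph0 mul0r.
Qed.

Lemma rext_lin c g1 g2 : rext (c *: g1 + g2) = phi c * rext g1 + rext g2.
Proof.
have le1 := fsubset_trans (msuppZ_le c g1) (fsubsetUl _ (msupp g2)).
have le2 : (msupp (c *: g1 + g2) `<=` msupp g1 `|` msupp g2)%fset.
  apply: fsubset_trans (msuppD_le _ _) _; rewrite fsubUset le1.
  by rewrite fsubsetUr.
rewrite (rextEw le2) (rextEw (fsubsetUl _ (msupp g2))).
rewrite (rextEw (fsubsetUr (msupp g1) _)) mulr_sumr -big_split /=.
by apply: eq_bigr => k _; rewrite mcoeffD mcoeffZ rmorphD rmorphM mulrDl mulrA.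
Qed.

Lemma rext0 : rext 0 = 0.
Proof. by rewrite /rext msupp0 big_seq_fset0. Qed.

Lemma rextX v : rext (lX v) = h v.
Proof. by rewrite (rextEw msuppU_le) big_seq_fset1 mcoeffUU rmorph1 mul1r. Qed.

Lemma rext_is_zmod : zmod_morphism rext.
Proof.
move=> g1 g2; rewrite [g1 - g2]addrC -scaleN1r rext_lin rmorphN1.
by rewrite mulN1r addrC.
Qed.

Lemma rextM g1 g2 : rext (g1 * g2) = rext g1 * rext g2.
Proof.
pattern g1; apply: lat_ind => [|c x y IHx IHy|v _].
- by rewrite mul0r rext0 mul0r.
- by rewrite mulrDl -scalerAl !rext_lin IHx IHy mulrDl mulrA.
pattern g2; apply: lat_ind => [|c x y IHx IHy|w _].
- by rewrite mulr0 rext0 mulr0.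
- by rewrite mulrDr -scalerAr !rext_lin IHx IHy mulrDr mulrCA.
by rewrite lXM !rextX hD.
Qed.

Lemma rext_is_monoid : monoid_morphism rext.
Proof. by split=> [|x y]; [rewrite -lX0 rextX h0|exact: rextM]. Qed.

Lemma rextZ c g : rext (c *: g) = phi c * rext g.
Proof. by rewrite -[c *: g]addr0 rext_lin rext0 addr0. Qed.

End Evaluation.
End LatAlgebra.

Arguments lX {F V} v.

(** * Spans and Steinitz exchange modulo a subspace *)

Section Span.
Variables (F : fieldType) (V : lmodType F).
Implicit Types (X Y W : set V) (v w : V).

Definition submodp W := W 0 /\ forall c v w, W v -> W w -> W (c *: v + w).

(** Defined as an intersection, so that a hypothesis [sp X v] is used by applying it to the
    predicate to be proved: this is induction on linear combinations without writing any. *)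
Definition sp X v := forall W, submodp W -> X `<=` W -> W v.

Lemma sp_sub X : X `<=` sp X.
Proof. by move=> x Xx W _; apply. Qed.

Lemma sp_submod X : submodp (sp X).
Proof.
split=> [W [W0 _] _ //|c v w Xv Xw W sW XW].
by apply: (proj2 sW); [exact: Xv|exact: Xw].
Qed.

Lemma sp0 X : sp X 0. Proof. exact: (proj1 (sp_submod X)). Qed.

Lemma spL X c v w : sp X v -> sp X w -> sp X (c *: v + w).
Proof. exact: (proj2 (sp_submod X)). Qed.

Lemma spZ X c v : sp X v -> sp X (c *: v).
Proof. by move=> Xv; rewrite -[_ *: v]addr0; apply: spL => //; exact: sp0. Qed.

Lemma spD X v w : sp X v -> sp X w -> sp X (v + w).
Proof. by move=> Xv Xw; rewrite -[v]scale1r; apply: spL. Qed.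

Lemma spB X v w : sp X v -> sp X w -> sp X (v - w).
Proof. by move=> Xv Xw; rewrite addrC -scaleN1r; apply: spL. Qed.

Lemma sp_sum X I (s : seq I) (P : pred I) (G : I -> V) :
  (forall i, P i -> sp X (G i)) -> sp X (\sum_(i <- s | P i) G i).
Proof.
move=> XG; elim: s => [|i s IH]; rewrite ?big_nil ?big_cons; first exact: sp0.
by case: ifP => // /XG XGi; exact: spD.
Qed.

Lemma sp_trans X Y v : X `<=` sp Y -> sp X v -> sp Y v.
Proof. by move=> XY Xv; apply: (Xv (sp Y)) => //; exact: sp_submod. Qed.

Lemma sp_mono X Y v : X `<=` Y -> sp X v -> sp Y v.
Proof. by move=> XY; apply: sp_trans => x /XY; apply: sp_sub. Qed.

Lemma sp_add1 X a v : sp (X `|` [set a]) v -> exists c : F, sp X (v - c *: a).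
Proof.
move=> Xv; apply: (Xv (fun v => exists c : F, sp X (v - c *: a))); last first.
  move=> x [Xx|/= ->]; first by exists 0; rewrite scale0r subr0; apply: sp_sub.
  by exists 1; rewrite scale1r subrr; apply: sp0.
split=> [|c x y [k1 H1] [k2 H2]].
  by exists 0; rewrite scale0r subr0; apply: sp0.
exists (c * k1 + k2); rewrite (_ : _ - _ = c *: (x - k1 *: a) + (y - k2 *: a)).
  exact: spL.
by rewrite scalerBr scalerA scalerDl opprD addrACA.
Qed.

Lemma sp_exchange1 X a v : sp (X `|` [set a]) v -> ~ sp X v ->
  sp (X `|` [set v]) a.
Proof.
move=> /sp_add1[c Xvca] nXv; have c0 : c != 0.
  by apply/eqP => c0; apply: nXv; move: Xvca; rewrite c0 scale0r subr0.
rewrite (_ : a = c^-1 *: v - c^-1 *: (v - c *: a)).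
  apply: spB; first by apply: spZ; apply: sp_sub; right.
  by apply: spZ; apply: sp_mono Xvca => x; left.
by rewrite scalerBr scalerA mulVf // scale1r opprB addrC subrK.
Qed.


Section Families.
Variables (I J : eqType) (x : I -> V) (y : J -> V).

Definition fam (T : eqType) (z : T -> V) (s : seq T) : set V :=
  [set z i | i in [set` s]].

Lemma sp_exchange X (s : seq I) v : sp (X `|` fam x s) v -> ~ sp X v ->
  exists2 i, i \in s & sp (X `|` [set v] `|` fam x (rem i s)) (x i).
Proof.
elim: s => [|i s IH] Xv nXv.
  by case: nXv; apply: sp_mono Xv => z [//|[? /=]]; rewrite in_nil.
have [Xv'|nXv'] := pselect (sp (X `|` fam x s) v).
  have [k ks Hk] := IH Xv' nXv; exists k; first by rewrite inE ks orbT.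
  apply: sp_mono Hk => z [Hz|[l /= ls <-]]; [by left|right].
  exists l => //=; case: eqP => [ki|_]; last by rewrite inE ls orbT.
  exact: mem_rem ls.
exists i; first by rewrite mem_head.
rewrite /= eqxx; apply: sp_mono (sp_exchange1 (a := x i) _ nXv').
  by move=> z [[Xz|Hz]|Hz]; [left; left|right|left; right].
apply: sp_mono Xv => z [Xz|[l /=]]; first by left; left.
by rewrite inE => /orP[/eqP-> <-|ls <-]; [right|left; right; exists l].
Qed.

(** Independence in the quotient by [sp X], as a condition on prefixes of the list: it suits an
    induction on the end of the list and forces the entries to be distinct. *)
Definition free_mod X (t : seq J) :=
  forall t1 j t2, t = t1 ++ j :: t2 -> ~ sp (X `|` fam y t1) (y j).

(** Each [y j] enters by pushing out one [x i], and [s'] is what is never pushed out. The exact size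
    of [s'], and not only the resulting inequality, is what the Frobenius count uses. *)
Lemma steinitz X (s : seq I) (t : seq J) : free_mod X t ->
  (forall j, j \in t -> sp (X `|` fam x s) (y j)) ->
  exists s', [/\ {subset s' <= s}, (size s' + size t)%N = size s &
    forall i, i \in s -> sp (X `|` fam y t `|` fam x s') (x i)].
Proof.
elim/last_ind: t => [|t j IH] fr ys.
  exists s; split=> [//||i si]; first by rewrite addn0.
  by apply: sp_sub; right; exists i.
have fr' : free_mod X t.
  by move=> t1 k t2 E; apply: (fr t1 k (rcons t2 j)); rewrite E rcons_cat.
have [|s' [sub sz Hs']] := IH fr' _.
  by move=> k kt; apply: ys; rewrite mem_rcons inE kt orbT.
have nj : ~ sp (X `|` fam y t) (y j) by apply: (fr t j [::]); rewrite cats1.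
have yj : sp (X `|` fam y t `|` fam x s') (y j).
  apply: sp_trans (ys j _); last by rewrite mem_rcons mem_head.
  move=> z [Xz|[i /= /Hs' Hi <-]]; last exact: Hi.
  by apply: sp_sub; left; left.
have [i is' Hi] := sp_exchange yj nj.
exists (rem i s'); split=> [k /mem_rem/sub//||k /Hs' Hk].
  rewrite size_rem // size_rcons -sz.
  by case: (s') is' => //= a l _; rewrite addnS addSn.
apply: sp_trans Hk => z [[Xz|[l /= lt <-]]|[l /= ls' <-]].
- by apply: sp_sub; left; left.
- by apply: sp_sub; left; right; exists l => //=; rewrite mem_rcons inE lt orbT.
have [->|li] := eqVneq l i.
  apply: sp_mono Hi => z' [[[Xz|[m /= mt <-]]|/= ->]|[m /= mt <-]].
  + by left; left.
  + by left; right; exists m => //=; rewrite mem_rcons inE mt orbT.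
  + by left; right; exists j => //=; rewrite mem_rcons mem_head.
  + by right; exists m.
by apply: sp_sub; right; exists l => //=; move: ls' li; elim: (s') => //= a r IHr;
  rewrite inE; case: (eqVneq a i) => [->|ai] /=;
  case: eqP => //= la; rewrite ?inE ?la ?eqxx //= => lr li;
  rewrite IHr ?orbT.
Qed.

Lemma free_mod_size X (s : seq I) (t : seq J) : free_mod X t ->
  (forall j, j \in t -> sp (X `|` fam x s) (y j)) -> (size t <= size s)%N.
Proof. by move=> fr ys; have [s' [_ <- _]] := steinitz fr ys; exact: leq_addl. Qed.

End Families.

Lemma sp_famP (I : eqType) (x : I -> V) (s : seq I) X v : uniq s ->
  sp (X `|` fam x s) v ->
  exists c : I -> F, sp X (v - \sum_(i <- s) c i *: x i).
Proof.
elim: s v => [|i s IH] v /= us Xv.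
  exists (fun=> 0); rewrite big_nil subr0.
  by apply: sp_mono Xv => z [//|[? /=]]; rewrite in_nil.
have /sp_add1[a Ha] : sp ((X `|` fam x s) `|` [set x i]) v.
  apply: sp_mono Xv => z [Xz|[l /=]]; first by left; left.
  by rewrite inE => /orP[/eqP-> <-|ls <-]; [right|left; right; exists l].
case/andP: us => ins us; have [c Hc] := IH _ us Ha.
exists (fun k => if k == i then a else c k); rewrite big_cons eqxx opprD addrA.
rewrite big_seq (eq_bigr (fun k => c k *: x k)) -?big_seq // => k ks.
by case: eqP => // ki; rewrite -ki ks in ins.
Qed.

End Span.

Lemma sp_lin (F : fieldType) (V V' : lmodType F) (L : V -> V') (X : set V)
    (Y : set V') v : linear L ->
  (forall x, X x -> sp Y (L x)) -> sp X v -> sp Y (L v).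
Proof.
move=> Ll XY Xv; have L0 : L 0 = 0.
  by have := Ll (-1) 0 0; rewrite scaler0 addr0 scaleN1r addNr.
apply: (Xv (fun v => sp Y (L v))) => //; split=> [|c a b Ha Hb].
  by rewrite L0; exact: sp0.
by rewrite Ll; apply: spL.
Qed.

Lemma leq_expl m n e : (m <= n)%N -> (m ^ e <= n ^ e)%N.
Proof. by case: e => // e mn; rewrite leq_exp2r. Qed.

(** * Counting exponents in boxes and in weighted simplices *)

Section Counting.
Variables (N : nat).
Local Notation K := {ffun 'I_N -> nat}.
Implicit Types (k al : K) (d : 'I_N -> nat).
Local Open Scope nat_scope.

Definition kadd k al : K := [ffun i => k i + al i].
Definition kbox T : seq K :=
  [seq [ffun i => (x i : nat)] | x : {ffun 'I_N -> 'I_T}].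
Definition wt d k := \sum_i d i * k i.
Definition kap d t := [seq k <- kbox t.+1 | wt d k <= t].
Definition leK al k := [forall i, al i <= k i].

Lemma mem_kbox T k : (k \in kbox T) = [forall i, k i < T].
Proof.
apply/mapP/forallP => [[x _ ->] i|kT]; first by rewrite ffunE.
exists [ffun i => Ordinal (kT i)]; rewrite ?mem_enum //.
by apply/ffunP => i; rewrite ffunE [in RHS]ffunE.
Qed.

Lemma uniq_kbox T : uniq (kbox T).
Proof.
rewrite map_inj_uniq ?enum_uniq // => x y /ffunP e; apply/ffunP => i.
by apply: val_inj; have := e i; rewrite !ffunE.
Qed.

Lemma size_kbox T : size (kbox T) = T ^ N.
Proof. by rewrite size_map -cardE card_ffun !card_ord. Qed.

Lemma wt_ge d k i : (forall i, 0 < d i) -> k i <= wt d k.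
Proof.
move=> d0; rewrite /wt (bigD1 i) //=; apply: leq_trans (leq_addr _ _).
by rewrite -{1}[k i]mul1n leq_mul2r d0 orbT.
Qed.

Lemma mem_kap d t k : (forall i, 0 < d i) -> (k \in kap d t) = (wt d k <= t).
Proof.
move=> d0; rewrite mem_filter mem_kbox andbC; case: forallP => //= kT.
apply/esym/negP => kt; apply: kT => i; rewrite ltnS.
exact: leq_trans (wt_ge _ _ d0) kt.
Qed.

Lemma uniq_kap d t : uniq (kap d t).
Proof. by rewrite filter_uniq // uniq_kbox. Qed.

Lemma wtD d k al : wt d (kadd k al) = wt d k + wt d al.
Proof. by rewrite /wt -big_split; apply: eq_bigr => i _; rewrite ffunE mulnDr. Qed.

(** If [al <= k] fails, then [k i < al i] for some [i], which confines [k] to [al i] layers of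
    T^(N-1) points each; these slabs are summed over [i]. *)
Lemma size_kbox_notle T al :
  size [seq k <- kbox T | ~~ leK al k] <= (\sum_i al i) * T ^ N.-1.
Proof.
have cnt1 i : count (fun k => k i < al i) (kbox T) <= al i * T ^ N.-1.
  pose fm (j : 'I_N) : pred 'I_T :=
    if j == i then [pred z : 'I_T | z < al i] else predT.
  have -> : count (fun k : K => k i < al i) (kbox T) = #|family fm|.
    rewrite count_map -sum1_count big_enum_cond -sum1_card; apply: eq_bigl => x.
    rewrite /= ffunE; apply/idP/familyP => [xi j|/(_ i)].
      by rewrite /fm; case: eqP => // ->.
    by rewrite /fm eqxx.
  rewrite card_family foldrE big_map big_enum /= (bigD1 i) //= {1}/fm eqxx.
  rewrite leq_mul //.
    rewrite cardE -(size_map (@nat_of_ord T)) -[leqRHS](size_iota 0).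
    apply: uniq_leq_size; first by rewrite map_inj_uniq ?enum_uniq //; exact: val_inj.
    by move=> z /mapP[y]; rewrite mem_enum inE => yal ->; rewrite mem_iota.
  rewrite (eq_bigr (fun=> T)) => [|j /negPf ji]; last first.
    by rewrite /fm ji card_ord.
  by rewrite prod_nat_const cardC1 card_ord.
rewrite big_distrl /=; apply: leq_trans (leq_sum _ (fun i _ => cnt1 i)).
rewrite size_filter -sum1_count big_mkcond /=.
under [leqRHS]eq_bigr do rewrite -sum1_count big_mkcond /=.
rewrite exchange_big /=; apply: leq_sum => k _.
case: ifP => //; rewrite negb_forall => /existsP[i]; rewrite -ltnNge => kal.
by rewrite (bigD1 i) //= kal.
Qed.

Lemma size_kap_notle d t al : (forall i, 0 < d i) ->
  size [seq k <- kap d t | ~~ leK al k] <= (\sum_i al i) * t.+1 ^ N.-1.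
Proof.
move=> d0; apply: leq_trans (size_kbox_notle t.+1 al).
apply: uniq_leq_size; first by rewrite !filter_uniq // uniq_kbox.
by move=> k; rewrite !mem_filter => /and3P[-> _ ->].
Qed.

Definition kC d t := size (kap d t).

(** Subtracting [c] from the coordinate [i0] lowers the weight by at least [c]; the exponents too
    small for this form a slab of lower order. *)
Lemma kC_add d t c (i0 : 'I_N) : (forall i, 0 < d i) ->
  kC d (t + c) <= kC d t + c * (t + c).+1 ^ N.-1.
Proof.
move=> d0; pose al : K := [ffun i => if i == i0 then c else 0].
have sal : \sum_i al i = c.
  rewrite (bigD1 i0) //= ffunE eqxx big1 ?addn0 // => i /negPf ii0.
  by rewrite ffunE ii0.
have ali0 : al i0 = c by rewrite ffunE eqxx.
clearbody al.
have := size_kap_notle (t + c) al d0; rewrite sal => le2.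
rewrite /kC -(count_predC (leK al)) -!size_filter leq_add //.
pose sb k : K := [ffun i => k i - al i].
have sbK k : leK al k -> kadd (sb k) al = k.
  by move/forallP => lek; apply/ffunP => i; rewrite ffunE /sb ffunE subnK.
rewrite -(size_map sb); apply: uniq_leq_size.
  rewrite map_inj_in_uniq ?filter_uniq ?uniq_kbox // => k k'.
  rewrite !mem_filter => /andP[/sbK kE _] /andP[/sbK kE' _] e.
  by rewrite -kE -kE' e.
move=> z /mapP[k]; rewrite !(mem_filter (leK al)) mem_kap // => /andP[/sbK kE].
rewrite -{1}kE wtD => le ->; rewrite mem_kap //.
have : c <= wt d al.
  by rewrite -{1}ali0 wt_ge.
by move: le; lia.
Qed.

(** The exponents [q * k + r], with [r] in the box of side [q], are distinct by Euclidean division,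
    and [r] adds at most [q * \sum_i d i] to the weight. *)
Lemma kC_mul d t q : (forall i, 0 < d i) -> 0 < q ->
  q ^ N * kC d t <= kC d (q * (t + \sum_i d i)).
Proof.
move=> d0 q0; rewrite -size_kbox.
pose km (r k : K) : K := [ffun i => q * k i + r i].
rewrite -(size_allpairs km).
apply: uniq_leq_size.
  apply: allpairs_uniq; rewrite ?uniq_kbox ?uniq_kap // => -[r k] [r' k'].
  move=> /allpairsP[[r1 k1] [/= + _ [-> ->]]] /allpairsP[[r2 k2] [/= + _ [-> ->]]].
  rewrite !mem_kbox => /forallP h1 /forallP h2 /ffunP e.
  have E i : (q * k1 i + r1 i) = (q * k2 i + r2 i).
    by have := e i; rewrite !ffunE.
  have kE i : k1 i = k2 i.
    have := congr1 (divn^~ q) (E i); rewrite !(mulnC q) !divnMDl //.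
    by rewrite !divn_small // !addn0.
  have rE i : r1 i = r2 i by have := E i; rewrite kE => /addnI.
  by congr pair; apply/ffunP.
move=> _ /allpairsP[[r k] [/= rq kt ->]]; rewrite mem_kap //.
move: rq kt; rewrite mem_kbox mem_kap // => /forallP rq kt.
rewrite mulnDr (_ : wt d _ = q * wt d k + wt d r); last first.
  rewrite /wt big_distrr -big_split /=; apply: eq_bigr => i _.
  by rewrite ffunE mulnDr mulnCA.
rewrite leq_add ?leq_mul2l ?kt ?orbT // big_distrr; apply: leq_sum => i _ /=.
by rewrite mulnC leq_mul2r (ltnW (rq i)) orbT.
Qed.

Lemma kC_ge d x : (forall i, 0 < d i) -> x.+1 ^ N <= kC d ((\sum_i d i) * x).
Proof.
move=> d0; rewrite -size_kbox; apply: uniq_leq_size (uniq_kbox _) _ => k.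
rewrite mem_kbox mem_kap // => /forallP kx; rewrite /wt big_distrl.
by apply: leq_sum => i _; rewrite leq_mul2l -ltnS kx orbT.
Qed.

Lemma pow_dominates K' e x : 0 < N -> K' * e ^ N.-1 < x ->
  K' * (e * x) ^ N.-1 < x ^ N.
Proof.
case: N => // N' _ /= H; rewrite expnMn mulnA expnS ltn_mul2r H andbT.
by rewrite expn_gt0 (leq_ltn_trans _ H).
Qed.

(** If b < a, then [kC_add] absorbs the shift [c] and leaves [kC d t] of order t^(N-1), against the
    growth of order t^N in [kC_ge]. *)
Lemma kC_dominates d a b K' c : (forall i, 0 < d i) -> 0 < N ->
  (forall t, a * kC d t <= b * kC d (t + c) + K' * (t + c).+1 ^ N.-1) -> a <= b.
Proof.
move=> d0 N0 H; rewrite leqNgt; apply/negP => ba.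
have i0 : 'I_N := Ordinal N0.
have le1 t : kC d t <= (b * c + K') * (t + c).+1 ^ N.-1.
  have := H t; have := kC_add t c i0 d0.
  move: (kC d (t + c)) (kC d t) (_ ^ _) => u v z; nia.
(* With this [e], [(\sum_i d i) * x + c + 1 <= e * x.+1]; and [x] is chosen so that [x.+1] just
   passes the threshold of [pow_dominates]. *)
set e := (\sum_i d i + c).+1; pose x := ((b * c + K') * e ^ N.-1).
have := @pow_dominates (b * c + K') e x.+1 N0 (ltnSn _).
apply/negP; rewrite -leqNgt.
apply: leq_trans (kC_ge x d0) _; apply: leq_trans (le1 _) _.
rewrite leq_mul2l; apply/orP; right; apply: leq_expl.
by rewrite /e; move: (\sum_i d i) x => z x; nia.
Qed.
End Counting.

From mathcomp Require finfield abelian.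

Lemma seq_argmax (T : eqType) (s : seq T) (h : T -> nat) : s != [::] ->
  exists2 x, x \in s & forall y, y \in s -> (h y <= h x)%N.
Proof.
elim: s => // a s IH _; have [->|s0] := eqVneq s [::].
  by exists a => [|y]; rewrite inE // => /eqP->.
have [x xs Hx] := IH s0; case: (leqP (h a) (h x)) => hax.
  exists x => [|y]; first by rewrite inE xs orbT.
  by rewrite inE => /orP[/eqP->|/Hx].
exists a => [|y]; first by rewrite inE eqxx.
by rewrite inE => /orP[/eqP->//|/Hx hy]; exact: leq_trans hy (ltnW hax).
Qed.

(** * A monomial order by prime factorization *)

Section PrimeOrder.
Local Open Scope nat_scope.

Fixpoint pr (k : nat) : nat :=
  if k is k'.+1 then s2val (prime_above (pr k')) else 2.

Lemma pr_prime k : prime (pr k).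
Proof. by case: k => [//|k] /=; case: (prime_above _). Qed.

Lemma pr_lt k l : k < l -> pr k < pr l.
Proof.
elim: l => // l IH; rewrite ltnS leq_eqVlt => /orP[/eqP->|/IH kl] /=.
  by case: (prime_above _).
by apply: ltn_trans kl _; case: (prime_above _).
Qed.

Lemma pr_eq k l : (pr k == pr l) = (k == l).
Proof.
case: (ltngtP k l) => [/pr_lt kl|/pr_lt lk|->]; last by rewrite eqxx.
  by rewrite ltn_eqF.
by rewrite gtn_eqF.
Qed.

Variables (N r : nat).
Local Notation K := {ffun 'I_N -> nat}.

Definition pmon (k : K) : nat := \prod_(i < N) pr i ^ k i.
(* A monomial order on K * 'I_r: unique factorization makes it injective, and
   adding a fixed exponent multiplies it by a constant. *)
Definition kord (x : K * 'I_r) : nat := pmon x.1 * pr (N + x.2).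

Lemma pmon_gt0 k : 0 < pmon k.
Proof. by apply: prodn_gt0 => i; rewrite expn_gt0 prime_gt0 ?pr_prime. Qed.

Lemma logn_pmon l k : logn (pr l) (pmon k) = \sum_(i < N) (l == i) * k i.
Proof.
rewrite /pmon; have: all (fun i : 'I_N => true) (index_enum 'I_N) by apply/allP.
elim: (index_enum _) => [|i s IH] _; first by rewrite !big_nil logn1.
rewrite !big_cons lognM; last first.
- by elim/big_ind: _ => // [m n m0 n0|j _]; rewrite ?muln_gt0 ?m0 // expn_gt0 prime_gt0 ?pr_prime.
- by rewrite expn_gt0 prime_gt0 ?pr_prime.
by rewrite IH ?all_predT // lognX logn_prime ?pr_prime // pr_eq mulnC.
Qed.

(** The multiplicities of the primes [pr i] with i < N record the exponent, and the single prime
    beyond them records the index in ['I_r]. *)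
Lemma kord_inj : injective kord.
Proof.
move=> [k j] [k' j'] /= E.
have L l : logn (pr l) (kord (k, j)) = logn (pr l) (kord (k', j')) by rewrite E.
have LE l (x : K * 'I_r) : logn (pr l) (kord x) =
    \sum_(i < N) (l == i) * x.1 i + (l == N + x.2).
  by rewrite lognM ?pmon_gt0 ?prime_gt0 ?pr_prime // logn_pmon logn_prime
             ?pr_prime // pr_eq.
have kE : k = k'.
  apply/ffunP => i; have := L i; rewrite !LE /= !(ltn_eqF (ltn_addr _ (ltn_ord i))).
  rewrite !addn0 !(bigD1 i (P := xpredT)) //= !eqxx !mul1n.
  by rewrite !big1 ?addn0 // => l li; rewrite (_ : (i == l :> nat) = false) //;
     apply/negbTE; rewrite eq_sym.
congr pair => //; apply/val_inj => /=.
have := L (N + j); rewrite !LE /= kE => /addnI; rewrite eqxx eqn_add2l.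
by case: eqP.
Qed.

Lemma kordD k al j : kord (kadd k al, j) = pmon al * kord (k, j).
Proof.
rewrite /kord /= mulnA; congr (_ * _); rewrite /pmon -big_split /=.
by apply: eq_bigr => i _; rewrite ffunE expnD mulnC.
Qed.

End PrimeOrder.

(** * The Frobenius map of a monoid algebra *)

Section Frobenius.
Variables (F : finFieldType) (V : nmodType) (k : nat).
Let q := (#|F| ^ k)%N.

Lemma frob_gt0 : (0 < q)%N.
Proof. by rewrite expn_gt0; apply/orP; left; apply/card_gt0P; exists 0. Qed.

Lemma fin_exp (c : F) : c ^+ q = c.
Proof.
rewrite /q; elim: k => [|l IH]; first by rewrite expn0.
by rewrite expnSr exprM IH finfield.expf_card.
Qed.

(** As a power of the characteristic, [q] makes the q-th power additive; as a power of the order of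
    [F], it fixes the coefficients. So the map is [F]-linear and acts on exponents only. *)
Lemma frobE (g : calg F (lat V)) : g ^+ q = lext (fun v : V => lX (v *+ q)) g.
Proof.
have [p pp pF] := finfield.finPcharP F.
have pq : [pchar calg F (lat V)].-nat q.
  have : p.-nat q.
    rewrite pnatX; apply/orP; left.
    have := abelian.abelem_pgroup (abelian.fin_ring_pchar_abelem pF).
    by rewrite /pgroup.pgroup cardsT.
  apply: sub_in_pnat => l _ /eqP->; rewrite inE pp /=.
  by rewrite -scaler_nat (pcharf0 pF) scale0r.
pattern g; apply: lat_ind => [|c x y IHx IHy|v _].
- by rewrite expr0n gtn_eqF ?frob_gt0 // linear0.
- by rewrite exprDn_pchar // exprZn fin_exp IHx IHy linearP.
by rewrite lXX lextU scale1r.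
Qed.

End Frobenius.

(** * Cone algebras, their grading, and a graded Nakayama lemma *)

Section GradedCone.
Variables (F : fieldType) (V : zmodType) (I : finType) (lam : I -> V -> int).
Variable deg : V -> int.
Hypothesis lamD : forall i v w, lam i (v + w) = lam i v + lam i w.
Hypothesis degD : forall v w, deg (v + w) = deg v + deg w.

Local Notation P := (calg F (lat V)).
Implicit Types (g h : P) (v w : V).

Definition conem v := [forall i, 0 <= lam i v].

Lemma lam0 i : lam i 0 = 0.
Proof. by have := lamD i 0 0; rewrite addr0 => /eqP; rewrite -subr_eq subrr => /eqP. Qed.

Lemma deg0 : deg 0 = 0.
Proof. by have := degD 0 0; rewrite addr0 => /eqP; rewrite -subr_eq subrr => /eqP. Qed.

Lemma lamMn i v m : lam i (v *+ m) = lam i v *+ m.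
Proof. by elim: m => [|m IH]; rewrite ?mulr0n ?lam0 // !mulrS lamD IH. Qed.

Lemma degMn v m : deg (v *+ m) = deg v *+ m.
Proof. by elim: m => [|m IH]; rewrite ?mulr0n ?deg0 // !mulrS degD IH. Qed.

Lemma conem0 : conem 0.
Proof. by apply/forallP => i; rewrite lam0. Qed.

Lemma conemD v w : conem v -> conem w -> conem (v + w).
Proof. by move=> /forallP Hv /forallP Hw; apply/forallP => i; rewrite lamD addr_ge0. Qed.

Lemma conemMn v m : conem v -> conem (v *+ m).
Proof. by move=> /forallP Hv; apply/forallP => i; rewrite lamMn mulrn_wge0. Qed.

(** The cone algebra A is a predicate on the group algebra, not a type: on a face one has to compute
    with exponents outside the cone before coming back to A. *)
Definition inA g := forall v, v \in msupp g -> conem v.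
Definition HA (t : nat) g := forall v, v \in msupp g -> conem v /\ deg v = t%:Z.

Lemma HA_inA t g : HA t g -> inA g. Proof. by move=> H v /H[]. Qed.

Lemma inA_X v : conem v -> inA (lX v).
Proof. by move=> Mv w; rewrite msupp_lX => /eqP->. Qed.

Lemma HA_X v (t : nat) : conem v -> deg v = t%:Z -> HA t (lX v).
Proof. by move=> Mv dv w; rewrite msupp_lX => /eqP->. Qed.

Lemma inA_M g h : inA g -> inA h -> inA (g * h).
Proof. by move=> Hg Hh v /msupp_latM[a [b [/Hg Ma /Hh Mb ->]]]; exact: conemD. Qed.

Lemma HA_M s t g h : HA s g -> HA t h -> HA (s + t) (g * h).
Proof.
move=> Hg Hh v /msupp_latM[a [b [/Hg[Ma da] /Hh[Mb db] ->]]].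
by split; [exact: conemD|rewrite degD da db PoszD].
Qed.

Lemma HA_exp s g m : HA s g -> HA (m * s) (g ^+ m).
Proof.
move=> Hg; elim: m => [|m IH]; last by rewrite exprS mulSn; exact: HA_M.
by rewrite expr0 mul0n; apply: HA_X; [exact: conem0|exact: deg0].
Qed.

Lemma inA_sub : submodp [set g | inA g].
Proof.
split=> [v|c g h Hg Hh v]; first by rewrite msupp0.
move=> /(fsubsetP (msuppD_le _ _)); rewrite inE => /orP[|/Hh//].
by move=> /(fsubsetP (msuppZ_le _ _))/Hg.
Qed.

Lemma inA_lin (c : F) g h : inA g -> inA h -> inA (c *: g + h).
Proof. exact: (proj2 inA_sub). Qed.

Lemma inA_sum J (s : seq J) (Q : pred J) (G : J -> P) :
  (forall j, Q j -> inA (G j)) -> inA (\sum_(j <- s | Q j) G j).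
Proof.
move=> H; elim/big_rec: _ => [|j x Qj Hx]; first exact: (proj1 inA_sub).
by rewrite -[G j]scale1r; apply: inA_lin => //; exact: H.
Qed.

Lemma inA_Z (c : F) g : inA g -> inA (c *: g).
Proof. by move=> Hg; rewrite -[_ *: _]addr0; apply: inA_lin => //; exact: (proj1 inA_sub). Qed.

Definition mon N (y : 'I_N -> P) (k : {ffun 'I_N -> nat}) : P :=
  \prod_i y i ^+ k i.

Lemma monD N (y : 'I_N -> P) k al : mon y (kadd k al) = mon y k * mon y al.
Proof.
by rewrite /mon -big_split; apply: eq_bigr => i _; rewrite ffunE exprD.
Qed.

Lemma HA_mon N (y : 'I_N -> P) (d : 'I_N -> nat) k :
  (forall i, HA (d i) (y i)) -> HA (wt d k) (mon y k).
Proof.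
move=> Hy; rewrite /wt /mon; elim/big_rec2: _ => [|i t g _ Hg].
  by apply: HA_X; [exact: conem0|exact: deg0].
by rewrite mulnC; apply: HA_M => //; exact: HA_exp.
Qed.

Lemma mon0 N (y : 'I_N -> P) : mon y [ffun=> 0%N] = 1.
Proof. by rewrite /mon big1 // => i _; rewrite ffunE. Qed.

Definition kone N (i : 'I_N) : {ffun 'I_N -> nat} := [ffun l => (l == i) : nat].

Lemma mon1 N (y : 'I_N -> P) i : mon y (kone i) = y i.
Proof.
rewrite /mon (bigD1 i) //= ffunE eqxx expr1 big1 ?mulr1 // => l /negPf li.
by rewrite ffunE li.
Qed.

Lemma wt1 N (d : 'I_N -> nat) i : wt d (kone i) = d i.
Proof.
rewrite /wt (bigD1 i) //= ffunE eqxx muln1 big1 ?addn0 // => l /negPf li.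
by rewrite ffunE li muln0.
Qed.

Definition gproj (t : nat) g : P := lext (fun v : V => if deg v == t%:Z then lX v else 0) g.

Lemma gproj_lin t : linear (gproj t).
Proof. exact: lext_is_linear. Qed.

HB.instance Definition _ t := GRing.isLinear.Build F P P _ (gproj t) (gproj_lin t).

Lemma gproj_sum t (J : Type) (s : seq J) (c : J -> F) (G : J -> P) :
  gproj t (\sum_(x <- s) c x *: G x) = \sum_(x <- s) c x *: gproj t (G x).
Proof.
elim: s => [|x s IH]; first by rewrite !big_nil linear0.
by rewrite !big_cons gproj_lin IH.
Qed.

Lemma gproj_HA t g : HA t g -> gproj t g = g.
Proof.
move=> Hg; rewrite -[RHS]lext_id; apply: eq_lext => v /Hg[_ ->].
by rewrite eqxx.
Qed.

Lemma gproj_HA0 s t g : s != t -> HA s g -> gproj t g = 0.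
Proof.
move=> st Hg; rewrite /gproj /lext big_seq big1 // => v /Hg[_ ->].
by rewrite eqz_nat (negPf st) scaler0.
Qed.

Lemma mul_linear (a : P) : linear (fun g => a * g).
Proof. by move=> c g h; rewrite mulrDr scalerAr. Qed.

Lemma sp_mulr (X Y : set P) (a g : P) : (forall x, X x -> sp Y (a * x)) ->
  sp X g -> sp Y (a * g).
Proof. exact: sp_lin (mul_linear a). Qed.

Lemma sp_inA (X : set P) g : (forall v, conem v -> sp X (lX v)) -> inA g -> sp X g.
Proof.
move=> H Hg; rewrite (latE g) big_seq; apply: sp_sum => v /Hg Mv.
by apply: spZ; apply: H.
Qed.

(** As [h] runs through all of A, the linear span of this set is the ideal of A generated by the
    [y i]. *)
Definition mulA (J : Type) (y : J -> P) : set P :=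
  [set g | exists i h, inA h /\ g = y i * h].

Hypothesis deg_ge0 : forall v, conem v -> 0 <= deg v.

(** Only the component of degree [t] of the given expression of [lX v] matters. In it each [y i]
    multiplies monomials of degree below [t], because [d i] is positive, and the induction on the
    degree applies to them. *)
Lemma nakayama N (y : 'I_N -> P) (d : 'I_N -> nat) (J : Type) (G : set J)
    (e : J -> P) (dl : J -> nat) :
  (forall i, HA (d i) (y i)) -> (forall i, (0 < d i)%N) ->
  (forall j, G j -> HA (dl j) (e j)) ->
  (forall v, conem v -> sp ([set e j | j in G] `|` mulA y) (lX v)) ->
  forall v (t : nat), conem v -> deg v = t%:Z ->
  sp [set x | exists k j, [/\ G j, (wt d k + dl j)%N = t & x = mon y k * e j]]
     (lX v).
Proof.
move=> Hy d0 He Hs v t; elim/ltn_ind: t v => t IH v Mv dv.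
rewrite -(gproj_HA (HA_X Mv dv)); have := Hs v Mv.
apply: sp_lin; first exact: lext_is_linear.
move=> _ [[j Gj <-]|[i [h [Ah ->]]]].
  have [jt|jt] := eqVneq (dl j) t.
    rewrite gproj_HA -?jt; last exact: He.
    apply: sp_sub; exists [ffun=> 0%N], j; rewrite mon0 mul1r; split=> //.
    by rewrite /wt big1 // => i _; rewrite ffunE muln0.
  by rewrite (gproj_HA0 jt); [exact: sp0|exact: He].
pattern h; apply: lat_ind => [|c g1 g2 H1 H2|w /Ah Mw].
- by rewrite mulr0 linear0; exact: sp0.
- rewrite (mul_linear (y i) c g1 g2) gproj_lin; exact: spL H1 H2.
have dw : deg w = `|deg w|%N%:Z by rewrite gez0_abs // deg_ge0.
have Hyw := HA_M (Hy i) (HA_X Mw dw).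
have [E|E] := eqVneq (d i + `|deg w|)%N t; last first.
  by rewrite (gproj_HA0 E) //; exact: sp0.
rewrite gproj_HA -?E //.
have lt : (`|deg w| < t)%N by rewrite -E; move: (d0 i); lia.
have := IH _ lt w Mw dw; apply: sp_mulr => _ [k [j [Gj kj ->]]].
apply: sp_sub; exists (kadd (kone i) k), j; split=> //.
  by rewrite wtD wt1 -addnA kj.
by rewrite monD mon1 mulrA.
Qed.

End GradedCone.

(** * Independence of the products y^k b_j by counting along Frobenius *)

Section FrobeniusCounting.
Variables (F : finFieldType) (V : zmodType) (I : finType) (lam : I -> V -> int).
Variable deg : V -> int.
Hypothesis lamD : forall i v w, lam i (v + w) = lam i v + lam i w.
Hypothesis degD : forall v w, deg (v + w) = deg v + deg w.
Hypothesis tf : forall (v : V) q, (0 < q)%N -> v *+ q = 0 -> v = 0.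
Local Notation M := (conem lam).
Local Notation P := (calg F (lat V)).
Local Notation HA := (@HA F V I lam deg).
Local Notation inA := (@inA F V I lam).
Hypothesis deg_ge0 : forall v, M v -> 0 <= deg v.
Hypothesis Mpt : forall v, M v -> M (- v) -> v = 0.
Variable pts : nat -> seq V.
Hypothesis pts_uniq : forall t, uniq (pts t).
Hypothesis mem_pts : forall t v, (v \in pts t) = M v && (deg v <= t%:Z).
Variable E : nat.
Hypothesis lam_le : forall i v, M v -> lam i v <= E%:Z * deg v.
Variables (N : nat) (y : 'I_N -> P) (d : 'I_N -> nat).
Hypothesis N0 : (0 < N)%N.
Hypothesis d0 : forall i, (0 < d i)%N.
Hypothesis Hy : forall i, HA (d i) (y i).
Variables (r : nat) (b : 'I_r -> V) (db : 'I_r -> nat).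
Hypothesis Mb : forall j, M (b j).
Hypothesis degb : forall j, deg (b j) = (db j)%:Z.
Hypothesis b_span : forall v, M v ->
  sp ([set lX (b j) | j in setT] `|` mulA lam y) (lX v : P).
Hypothesis b_indep : forall c : 'I_r -> F,
  sp (mulA lam y) (\sum_j c j *: lX (b j)) -> forall j, c j = 0.
Variable e : nat.
Hypothesis growth : forall x, (x ^ N <= size (pts (e * x)))%N.

Local Notation K := {ffun 'I_N -> nat}.
Implicit Types (x : K * 'I_r) (k al : K).

Definition bmon x : P := mon y x.1 * lX (b x.2).
Definition bdeg x : nat := (wt d x.1 + db x.2)%N.

Lemma HA_bmon x : HA (bdeg x) (bmon x).
Proof. by apply: HA_M => //; [exact: HA_mon|exact: HA_X]. Qed.

Lemma bmonD k al j : bmon (kadd k al, j) = mon y al * bmon (k, j).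
Proof. by rewrite /bmon /= monD [mon y k * mon _ _]mulrC mulrA. Qed.

Lemma bmon_span v (t : nat) : M v -> deg v = t%:Z ->
  sp [set bmon x | x in [set x | bdeg x = t]] (lX v : P).
Proof.
move=> Mv dv.
have := nakayama lamD degD deg_ge0 (G := setT) (e := fun j => lX (b j)) (dl := db)
  Hy d0 (fun j _ => HA_X (Mb j) (degb j)) b_span Mv dv.
by apply: sp_mono => _ [k [j [_ kt ->]]]; exists (k, j).
Qed.

(** The standard monomials of Groebner theory: [x] is not standard exactly when it leads a
    homogeneous relation among the [bmon]. As [kord] takes values in the naturals, reduction to
    standard ones terminates. *)
Definition stdm x := ~ sp [set bmon x' | x' in
  [set x' | bdeg x' = bdeg x /\ (kord x' < kord x)%N]] (bmon x).

(** A relation led by [(k, j)] can be multiplied by [mon y al], which respects both the degree and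
    the order. *)
Lemma stdm_up k al j : ~ stdm (k, j) -> ~ stdm (kadd k al, j).
Proof.
move=> /contrapT H; apply; rewrite bmonD; move: H.
apply: sp_mulr => _ [[k' j'] [dx ox] <-]; apply: sp_sub.
exists (kadd k' al, j'); last by rewrite bmonD.
split; first by move: dx; rewrite /bdeg /= !wtD; lia.
by rewrite !kordD ltn_mul2l ox pmon_gt0.
Qed.

Lemma stdm_red x :
  sp [set bmon x' | x' in [set x' | stdm x' /\ bdeg x' = bdeg x]] (bmon x).
Proof.
move: {2}(kord x) (erefl (kord x)) => o; elim/ltn_ind: o x => o IH x xo.
have [sx|/contrapT] := pselect (stdm x); first by apply: sp_sub; exists x.
apply: sp_trans => _ [x' [dx ox] <-]; rewrite xo in ox.
by have := IH _ ox x' erefl; rewrite dx.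
Qed.

(** In a nontrivial relation, the component in the degree of the largest term that occurs would
    express this term by smaller ones. *)
Lemma stdm_indep (s : seq (K * 'I_r)) (c : K * 'I_r -> F) : uniq s ->
  (forall x, x \in s -> stdm x) -> \sum_(x <- s) c x *: bmon x = 0 ->
  forall x, x \in s -> c x = 0.
Proof.
move=> us ss s0 x0 x0s; apply/eqP; apply: contrapT => /negP cx0.
pose s' := [seq x <- s | c x != 0].
have [|x xs' Hx] := @seq_argmax _ s' (@kord N r).
  apply/eqP => E0; have : x0 \in s' by rewrite mem_filter cx0.
  by rewrite E0.
move: xs'; rewrite mem_filter => /andP[cx xs]; apply: (ss x xs).
have : gproj deg (bdeg x) (\sum_(x <- s) c x *: bmon x) = 0.
  by rewrite s0; exact: (linear0 (gproj deg (bdeg x))).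
rewrite gproj_sum (bigD1_seq x xs us) (gproj_HA (@HA_bmon x)).
move=> /eqP; rewrite addr_eq0 => /eqP/(congr1 (fun z => (c x)^-1 *: z)).
rewrite scalerA mulVf // scale1r => ->; apply: spZ.
rewrite -scaleN1r; apply: spZ; rewrite big_seq_cond; apply: sp_sum => z /andP[zs zx].
have [->|cz] := eqVneq (c z) 0.
  by rewrite scale0r; exact: sp0.
apply: spZ; have [dz|dz] := eqVneq (bdeg z) (bdeg x); last first.
  by rewrite (gproj_HA0 dz (@HA_bmon z)); exact: sp0.
have Hz := @HA_bmon z; rewrite dz in Hz; rewrite (gproj_HA Hz).
apply: sp_sub; exists z => //; split=> //; rewrite ltn_neqAle.
rewrite (inj_eq (@kord_inj N r)) zx /= Hx // mem_filter cz //.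
Qed.

Lemma sp_set0 (W : lmodType F) (v : W) : sp set0 v -> v = 0.
Proof.
move=> /(_ [set 0]) -> //; split=> // c a b' -> ->.
by rewrite scaler0 addr0.
Qed.

Lemma stdm_free (s : seq (K * 'I_r)) : uniq s ->
  (forall x, x \in s -> stdm x) -> free_mod bmon set0 s.
Proof.
move=> us ss t1 x t2 sE; have := us; rewrite sE cat_uniq /= => /and4P[ut1 + _ _].
rewrite negb_or => /andP[xt1 _] /(sp_famP ut1)[c /sp_set0/eqP].
rewrite subr_eq0 => /eqP xE.
have := @stdm_indep (x :: t1) (fun z => if z == x then -1 else c z).
rewrite /= xt1 ut1 big_cons eqxx scaleN1r xE.
rewrite [X in - _ + X](eq_big_seq (fun z => c z *: bmon z)); last first.
  by move=> z zt1 /=; case: eqP => // zx; move: xt1; rewrite -zx zt1.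
rewrite addNr => /(_ isT _ erefl x).
rewrite mem_head eqxx => /(_ _ isT) H.
have /H/eqP : forall z, z \in x :: t1 -> stdm z.
  by move=> z; rewrite inE => zs; apply: ss; rewrite sE mem_cat inE orbCA orbA zs.
by rewrite oppr_eq0 oner_eq0.
Qed.

Lemma lX_free (s : seq V) : uniq s -> free_mod (fun v => lX v : P) set0 s.
Proof.
move=> us t1 v t2 sE; have := us; rewrite sE cat_uniq /= => /and4P[ut1 + _ _].
rewrite negb_or => /andP[vt1 _] /(_ [set g | g@_v = 0]) /=.
rewrite mcoeff_lX eqxx; apply/not_implyP; split.
  split=> [|c g h]; rewrite /= ?mcoeff0 // => Hg Hh.
  by rewrite mcoeffD mcoeffZ Hg Hh mulr0 addr0.
apply/not_implyP; split; last by apply/eqP; exact: oner_neq0.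
move=> _ [//|[w /= wt1 <-]]; rewrite mcoeff_lX; case: eqP => // wv.
by rewrite -wv wt1 in vt1.
Qed.

Lemma sp_pts g t : inA g -> (forall v, v \in msupp g -> deg v <= t%:Z) ->
  sp (fam (fun v => lX v : P) (pts t)) g.
Proof.
move=> Ag dg; rewrite (latE g) big_seq; apply: sp_sum => v vg; apply: spZ.
by apply: sp_sub; exists v => //=; rewrite mem_pts Ag // dg.
Qed.

(** For [j] that is not full, some [(al, j)] leads a relation, and by [stdm_up] so does every
    [(k, j)] with [al <= k]. *)
Definition full j := `[< forall k, stdm (k, j) >].
Definition rho := size [seq j <- enum 'I_r | full j].
Definition stl (B : seq K) : seq (K * 'I_r) :=
  [seq (k, j) | j <- enum 'I_r, k <- [seq k <- B | `[< stdm (k, j) >]]].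

Lemma mem_stl B x : (x \in stl B) = (x.1 \in B) && `[< stdm x >].
Proof.
case: x => k j; apply/allpairsPdep/andP => [[j' [k' [_ + [-> ->]]]]|[/= kB sx]].
  by rewrite mem_filter => /andP[].
by exists j, k; rewrite mem_enum mem_filter sx kB.
Qed.

(** An index [j] that is not full contributes only exponents failing [al j <= k], a term of lower
    order. The constant is uniform in [B] because it will serve both for boxes of side q and for
    simplices. *)
Lemma size_stl : exists K0 : nat, forall (B : seq K) (Z : nat),
  (forall al, (size [seq k <- B | ~~ leK al k] <= (\sum_i al i) * Z)%N) ->
  (size (stl B) <= rho * size B + K0 * Z)%N.
Proof.
have /choice[al Hal] j : exists al, ~~ full j -> ~ stdm (al, j).
  have [_|/asboolPn/existsNP[al Hal]] := boolP (full j); last by exists al.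
  by exists [ffun=> 0%N].
exists (\sum_j \sum_i al j i)%N => B Z HB.
rewrite size_allpairs_dep sumnE big_map big_enum /=.
rewrite /rho size_filter -sum1_count big_enum_cond /= !big_distrl /=.
rewrite [X in (_ <= X + _)%N]big_mkcond -big_split; apply: leq_sum => j _ /=.
case: ifP => [_|/negbT nf].
  by rewrite mul1n size_filter; apply: leq_trans (count_size _ _) (leq_addr _ _).
rewrite add0n; apply: leq_trans (HB (al j)).
rewrite !size_filter; apply: sub_count => k /asboolP sk; apply/negP => /forallP lek.
apply: (stdm_up (k := al j) (al := [ffun i => k i - al j i]%N) (Hal j nf)).
suff -> : kadd (al j) [ffun i => (k i - al j i)%N] = k by [].
by apply/ffunP => i; rewrite !ffunE subnKC.
Qed.

Definition dmax := (\sum_j db j)%N.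

(** For full [j] all products are standard, hence independent; [dmax] makes room for the degrees of
    the b_j. *)
Lemma size_pts_ge t : (rho * kC d t <= size (pts (t + dmax)))%N.
Proof.
pose s := [seq (k, j) | j <- [seq j <- enum 'I_r | full j], k <- kap d t].
have -> : (rho * kC d t)%N = size s by rewrite size_allpairs.
have us : uniq s.
  apply: allpairs_uniq; [exact/filter_uniq/enum_uniq|exact: uniq_kap|].
  by move=> [j k] [j' k'] _ _ /= [-> ->].
have ss x : x \in s -> stdm x.
  by move=> /allpairsP[[j k] [/=]]; rewrite mem_filter => /andP[/asboolP fj _] _ ->.
apply: (free_mod_size (x := fun v => lX v : P) (stdm_free us ss)) => x xs.
suff H : sp (fam (fun v => lX v : P) (pts (t + dmax))) (bmon x).
  by apply: sp_mono H => z; right.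
apply: sp_pts => [|v /HA_bmon[_ ->]]; first exact: HA_inA (@HA_bmon x).
move: xs => /allpairsP[[j k] [/= _ kt ->]]; rewrite mem_kap // in kt.
by rewrite lez_nat leq_add //= /dmax (bigD1 j) //= leq_addr.
Qed.

Lemma size_pts_le t : (size (pts t) <= size (stl (kap d t)))%N.
Proof.
apply: (free_mod_size (x := bmon) (lX_free (pts_uniq t))) => v.
rewrite mem_pts => /andP[Mv dv].
have dE : deg v = `|deg v|%N%:Z by rewrite gez0_abs // deg_ge0.
have := bmon_span Mv dE; apply: sp_trans => _ [x /= xt <-].
have := @stdm_red x; apply: sp_mono => _ [x' [sx' dx'] <-]; right; exists x' => //=.
rewrite mem_stl asboolT // andbT mem_kap //.
apply: leq_trans (leq_addr (db x'.2) _) _; rewrite -/(bdeg x') dx' xt.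
by move: dv; rewrite {1}dE.
Qed.

Section Exchange.
Variable m : nat.
Let q := (#|F| ^ m)%N.
Variable T0 : nat.
Hypothesis ET0 : (E * T0 < q)%N.

Definition yq (i : 'I_N) : P := y i ^+ q.

Lemma q_gt0 : (0 < q)%N. Proof. exact: frob_gt0. Qed.

(** On the box, [lam i v <= E * T0 < q], so a value [lam i w <= -1] would make [lam i] negative at
    [v + w *+ q]. *)
Lemma good_cone v w : v \in pts T0 -> M (v + w *+ q) -> M w.
Proof.
rewrite mem_pts => /andP[Mv dv] /forallP H; apply/forallP => i.
have := H i; rewrite lamD (lamMn lamD) => Hi.
have lt : lam i v < q%:Z.
  apply: le_lt_trans (lam_le i Mv) _; apply: le_lt_trans (_ : E%:Z * T0%:Z < _).
    by rewrite ler_wpM2l.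
  by rewrite -PoszM ltz_nat.
rewrite leNgt; apply/negP => wl; move: Hi; rewrite leNgt => /negP; apply.
have w1 : lam i w <= -1 by move: wl; lia.
have : lam i w *+ q <= (-1) *+ q by rewrite lerMn2r w1 orbT.
by rewrite mulNrn; move: lt; lia.
Qed.

Definition frb : P -> P := lext (fun v : V => lX (v *+ q) : P).

Lemma frb_lin : linear frb. Proof. exact: lext_is_linear. Qed.

Lemma frb0 : frb 0 = 0.
Proof. by rewrite /frb /lext msupp0 big_seq_fset0. Qed.

Lemma frbX v : frb (lX v) = lX (v *+ q).
Proof. by rewrite /frb lextU scale1r. Qed.

Lemma frbE g : g ^+ q = frb g. Proof. exact: frobE. Qed.

(** The Frobenius embedding g -> g^q followed by translation by [v]. *)
Definition psi v : P -> P := lext (fun w : V => lX (v + w *+ q) : P).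

Lemma psiX v w : psi v (lX w) = lX (v + w *+ q).
Proof. by rewrite /psi lextU scale1r. Qed.

Lemma psi_lin v : linear (psi v). Proof. exact: lext_is_linear. Qed.

Lemma psi0 v : psi v 0 = 0.
Proof. by rewrite /psi /lext msupp0 big_seq_fset0. Qed.

Lemma mulLl (c : F) (g1 g2 h : P) : (c *: g1 + g2) * h = c *: (g1 * h) + g2 * h.
Proof. by rewrite mulrDl scalerAl. Qed.

Lemma mulLr (c : F) (g1 g2 h : P) : h * (c *: g1 + g2) = c *: (h * g1) + h * g2.
Proof. by rewrite mulrDr scalerAr. Qed.

Lemma psiM v g h : psi v (g * h) = g ^+ q * psi v h.
Proof.
rewrite frbE; pattern g; apply: lat_ind => [|c g1 g2 H1 H2|u _].
- by rewrite frb0 !mul0r psi0.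
- by rewrite frb_lin !mulLl psi_lin H1 H2.
rewrite frbX; pattern h; apply: lat_ind => [|c g1 g2 H1 H2|w _].
- by rewrite mulr0 psi0 mulr0.
- by rewrite psi_lin !mulLr psi_lin H1 H2.
by rewrite lXM !psiX lXM mulrnDl addrCA.
Qed.

Lemma mon_yq k : mon yq k = mon y k ^+ q.
Proof.
by rewrite /mon -prodrXl; apply: eq_bigr => i _; rewrite -!exprM mulnC.
Qed.

(** A left inverse of [psi v] on A, which discards the exponents outside v + q M. The chosen [w] is
    unique since [V] is torsion free. *)
Definition phi0 v (u : V) : P :=
  if pselect (exists w, M w /\ u = v + w *+ q) is left H then lX (sval (cid H))
  else 0.

Lemma phi0X v w : M w -> phi0 v (v + w *+ q) = lX w.
Proof.
move=> Mw; rewrite /phi0; case: pselect => [H|[]]; last by exists w.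
case: (cid H) => w' [_ /addrI ww'] /=; congr lX; apply/eqP.
rewrite -subr_eq0; apply/eqP; apply: (tf q_gt0).
by rewrite mulrnBl ww' subrr.
Qed.

Lemma phi0N v u : (forall w, M w -> u <> v + w *+ q) -> phi0 v u = 0.
Proof. by move=> H; rewrite /phi0; case: pselect => // -[w [Mw E1]]; case: (H w Mw). Qed.

Definition phi v : P -> P := lext (phi0 v).

Lemma phi_lin v : linear (phi v). Proof. exact: lext_is_linear. Qed.

Lemma phi_0 v : phi v 0 = 0.
Proof. by rewrite /phi /lext msupp0 big_seq_fset0. Qed.

Lemma phiX v u : phi v (lX u) = phi0 v u.
Proof. by rewrite /phi lextU scale1r. Qed.

Lemma inA_phi v h : inA (phi v h).
Proof.
rewrite /phi /lext; apply: inA_sum => u _; apply: inA_Z; rewrite /phi0.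
case: pselect => [H|_]; last exact: (proj1 (inA_sub _ _)).
by apply: inA_X; case: (cid H) => w [].
Qed.

(** The danger is an exponent [w] of [h] outside v + q M that multiplication by the q-th power of a
    monomial of A moves into it. Then w = v + q (w' - u), and [good_cone] puts w' - u back into the
    cone, a contradiction. *)
Lemma phiM v g h : v \in pts T0 -> inA g -> inA h ->
  phi v (g ^+ q * h) = g * phi v h.
Proof.
move=> vT Ag Ah; rewrite frbE; pattern g; apply: lat_ind => [|c g1 g2 H1 H2|u /Ag Mu].
- by rewrite frb0 !mul0r phi_0.
- rewrite (frb_lin c g1 g2).
  rewrite (mulLl c (frb g1) (frb g2) h).
  rewrite (phi_lin v c (frb g1 * h) (frb g2 * h)).
  rewrite (mulLl c g1 g2 (phi v h)).
  exact: (f_equal2 (fun x1 x2 : P => c *: x1 + x2) H1 H2).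
rewrite frbX; pattern h; apply: lat_ind => [|c g1 g2 H1 H2|w /Ah Mw].
- by rewrite mulr0 !phi_0 mulr0.
- by rewrite phi_lin !mulLr phi_lin H1 H2.
rewrite lXM !phiX; have [[w' [Mw' wE]]|no] := pselect (exists w', M w' /\ w = v + w' *+ q).
  by rewrite wE addrCA -mulrnDl !phi0X ?lXM //; exact: conemD.
rewrite !phi0N ?mulr0 // => w' Mw' wE; apply: no; first by exists w'.
have E1 : (w : V) = v + (w' - u) *+ q by rewrite mulrnBl addrA -wE addrAC subrr add0r.
by exists (w' - u); split=> //; apply: good_cone vT _; rewrite -E1.
Qed.

Definition zfam (x : V * 'I_r) : P := lX (x.1 + b x.2 *+ q).
Definition zl := [seq (v, j) | v <- pts T0, j <- enum 'I_r].

(** If [v'] is carried to the class of [v], then v' - v = q (w - b_j), and [good_cone] in both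
    directions puts w - b_j and its opposite in the cone, which is pointed. So [phi v] separates the
    translates. *)
Lemma phi_zfam v (x : V * 'I_r) : v \in pts T0 -> x.1 \in pts T0 ->
  phi v (zfam x) = if x.1 == v then lX (b x.2) else 0.
Proof.
case: x => v' j /= vT vT'; rewrite phiX; case: eqP => [->|vv'].
  by rewrite phi0X.
apply: phi0N => w Mw /= E1.
have E2 : v' = v + (w - b j) *+ q by rewrite mulrnBl addrA -E1 addrK.
have E3 : v = v' + (b j - w) *+ q by rewrite E2 -addrA -mulrnDl addrC subrKA subrr mul0rn add0r.
have Mv (x : V) : x \in pts T0 -> M x by rewrite mem_pts => /andP[].
have M1 : M (w - b j) by apply: (good_cone vT); rewrite -E2 Mv.
have M2 : M (- (w - b j)) by apply: (good_cone vT'); rewrite opprB -E3 Mv.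
by apply: vv'; rewrite E2 (Mpt M1 M2) mul0rn addr0.
Qed.

(** [phi v] kills the translates by other box points and carries the ideal of the [yq i] into that
    of the [y i], so a dependence becomes one excluded by [b_indep]. *)
Lemma zfam_free : free_mod zfam (mulA lam yq) zl.
Proof.
move=> t1 [v j] t2 zE.
have uz : uniq zl.
  by apply: allpairs_uniq => [||x y' _ _ //]; rewrite ?enum_uniq //=; case: x y' => ? ? [].
have zlP (x : V * 'I_r) : x \in zl -> x.1 \in pts T0 by case/allpairsP => -[? ?] [? _ ->].
have vT : v \in pts T0 by apply: (zlP (v, j)); rewrite zE mem_cat mem_head orbT.
have t1P (x : V * 'I_r) : x \in t1 -> x.1 \in pts T0 by move=> xt; apply: zlP; rewrite zE mem_cat xt.
move: uz; rewrite zE cat_uniq /= => /and4P[ut1 + _ _]; rewrite negb_or => /andP[nt1 _].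
move=> /(sp_famP ut1)[c Hc].
(* The coefficients of the dependence after [phi v]: those of the translates by [v], with 1 at [j]
   from the term being expressed. *)
pose c' j' : F := (j' == j)%:R - \sum_(x <- t1 | x == (v, j')) c x.
have : sp (mulA lam y) (\sum_j' c' j' *: lX (b j')).
  rewrite (_ : \sum_j' _ = phi v (zfam (v, j) - \sum_(i <- t1) c i *: zfam i)).
    move: Hc; apply: sp_lin; first exact: phi_lin.
    move=> _ [i [h [Ah ->]]]; rewrite (phiM vT (HA_inA (@Hy i)) Ah).
    by apply: sp_sub; exists i, (phi v h); split=> //; exact: inA_phi.
  rewrite addrC -scaleN1r phi_lin phi_zfam // eqxx scaleN1r addrC.
  have -> : phi v (\sum_(i <- t1) c i *: zfam i) =
      \sum_j' (\sum_(x <- t1 | x == (v, j')) c x) *: lX (b j').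
    transitivity (\sum_(i <- t1) c i *: (if i.1 == v then lX (b i.2) else 0 : P)).
      elim: t1 t1P {zE ut1 nt1 Hc c'} => [|x t1 IH] t1P; first by rewrite !big_nil phi_0.
      rewrite !big_cons phi_lin phi_zfam ?t1P ?mem_head // IH // => z zt.
      by apply: t1P; rewrite inE zt orbT.
    under [RHS]eq_bigr do rewrite scaler_suml big_mkcond.
    rewrite exchange_big; apply: eq_bigr => -[v1 j1] _ /=.
    rewrite (bigD1 j1) //= big1 ?addr0 => [|j2 j21].
      by rewrite xpair_eqE eqxx andbT; case: eqP => //; rewrite scaler0.
    by rewrite xpair_eqE [j1 == j2]eq_sym (negPf j21) andbF.
  under eq_bigr do rewrite scalerBl.
  rewrite sumrB (bigD1 j) //= eqxx scale1r big1 ?addr0 // => j' /negPf->.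
  by rewrite scale0r.
move=> /b_indep/(_ j)/eqP; rewrite /c' eqxx big_seq_cond big1 ?subr0 ?oner_eq0 //.
by move=> x /andP[xt /eqP xE]; rewrite xE in xt; rewrite xt in nt1.
Qed.

(** Modulo the [yq i], A is spanned by the standard products with exponents below [q], and Steinitz
    trades all but [s'] of them for the translates. By [nakayama] both kinds generate A over the
    monomials in [yq]. Up to degree [q * t], an element of [s'] yields at most [kC d t] products,
    while all those arising from one box point [v] lie in the image by [psi v] of the part of A of
    degree at most [t]. *)
Lemma exchange_count : exists2 s' : nat,
  (s' + size (pts T0) * r)%N = size (stl (kbox N q)) &
  forall t, (size (pts (q * t)) <= s' * kC d t + size (pts T0) * size (pts t))%N.
Proof.
have HAyq i : HA (q * d i) (yq i) by exact: HA_exp.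
have red_q x : sp (mulA lam yq `|` fam bmon (stl (kbox N q))) (bmon x).
  move: {2}(kord x) (erefl (kord x)) => o; elim/ltn_ind: o x => o IH x xo.
  have [sx|/contrapT] := pselect (stdm x); last first.
    by apply: sp_trans => _ [x' [dx ox] <-]; rewrite xo in ox; exact: IH ox x' erefl.
  have [xb|] := boolP (x.1 \in kbox N q).
    by apply: sp_sub; right; exists x => //=; rewrite mem_stl xb asboolT.
  rewrite mem_kbox negb_forall => /existsP[i]; rewrite -leqNgt => qi.
  apply: sp_sub; left; exists i.
  pose k' : K := [ffun l => if l == i then (x.1 l - q)%N else x.1 l].
  exists (bmon (k', x.2)); split; first exact: HA_inA (@HA_bmon _).
  rewrite /bmon /= mulrA; congr (_ * _); rewrite /mon (bigD1 i) //=.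
  rewrite [in RHS](bigD1 i) //= /yq mulrA ffunE eqxx -exprD subnKC //; congr (_ * _).
  by apply: eq_bigr => l /negPf li; rewrite ffunE li.
have spanq v : M v -> sp (mulA lam yq `|` fam bmon (stl (kbox N q))) (lX v).
  move=> Mv; have dE : deg v = `|deg v|%N%:Z by rewrite gez0_abs // deg_ge0.
  by have := bmon_span Mv dE; apply: sp_trans => _ [x _ <-]; exact: red_q.
have Mzf (x : V * 'I_r) : x \in zl -> M (x.1 + b x.2 *+ q).
  case/allpairsP => -[v j] [/= vT _ ->] /=; apply: conemD => //.
    by move: vT; rewrite mem_pts => /andP[].
  exact: conemMn.
have [|s' [ss' sz Hs']] := steinitz (s := stl (kbox N q)) (x := bmon) zfam_free _.
  by move=> x /Mzf/spanq.
exists (size s'); first by rewrite -sz size_allpairs -cardE card_ord.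
move=> t.
pose e1 (z : V * 'I_r + K * 'I_r) : P :=
  match z with inl x => zfam x | inr x => bmon x end.
pose dl (z : V * 'I_r + K * 'I_r) : nat :=
  match z with inl x => (`|deg x.1| + q * db x.2)%N | inr x => bdeg x end.
pose G : set (V * 'I_r + K * 'I_r) := [set z |
  match z with inl x => x \in zl | inr x => x \in s' end].
have HG z : G z -> HA (dl z) (e1 z).
  case: z => x /= xG; last exact: HA_bmon.
  apply: HA_X; first exact: Mzf.
  have Mx : M x.1.
    by case/allpairsP: xG => -[v j] [/= + _ ->] /=; rewrite mem_pts => /andP[].
  by rewrite degD (degMn degD) degb PoszD gez0_abs ?deg_ge0 // PoszM -mulr_natl natz.
have HS v : M v -> sp ([set e1 z | z in G] `|` mulA lam yq) (lX v).
  move=> Mv; have := spanq v Mv; apply: sp_trans => z0 [Uz|[x /= xs <-]].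
    by apply: sp_sub; right.
  have := Hs' x xs; apply: sp_mono => z1 [[Uz|[z /= zz <-]]|[z /= zz <-]].
  - by right.
  - by left; exists (inl z).
  - by left; exists (inr z).
have qd0 i : (0 < q * d i)%N by rewrite muln_gt0 q_gt0 d0.
pose x1 (z : V * V + K * (K * 'I_r)) : P :=
  match z with inl x => lX (x.1 + x.2 *+ q) | inr x => mon yq x.1 * bmon x.2 end.
pose s1 := [seq inr (k, x) | k <- kap d t, x <- s'] ++
           [seq inl (v, w) | v <- pts T0, w <- pts t].
have -> : (size s' * kC d t + size (pts T0) * size (pts t))%N = size s1.
  by rewrite size_cat !size_allpairs mulnC.
apply: (free_mod_size (x := x1) (lX_free (pts_uniq (q * t)))) => v.
rewrite mem_pts => /andP[Mv dv].
have dE : deg v = `|deg v|%N%:Z by rewrite gez0_abs // deg_ge0.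
have := nakayama lamD degD deg_ge0 HAyq qd0 HG HS Mv dE.
have wtq k : wt (fun i => (q * d i)%N) k = (q * wt d k)%N.
  by rewrite /wt big_distrr; apply: eq_bigr => i _; rewrite /= mulnA.
apply: sp_trans => _ [k [[[v0 j]|x] [/= Gz kd ->]]]; rewrite wtq in kd.
  case/allpairsP: Gz => -[v0' j'] [/= v0T _ [? ?]]; subst v0' j'.
  (* The product of a translate by a monomial in [yq] is [psi v0] of [bmon (k, j)], whose degree is
     at most [t] because [q] times it is at most [q * t]. *)
  rewrite mon_yq /zfam /= -psiX -psiM -[mon y k * _]/(bmon (k, j)).
  have : sp (fam (fun v => lX v : P) (pts t)) (bmon (k, j)).
    apply: sp_pts => [|w /HA_bmon[_ ->]]; first exact: HA_inA (@HA_bmon _).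
    rewrite lez_nat -(leq_pmul2l q_gt0) /bdeg /= mulnDr.
    by move: dv; rewrite {1}dE lez_nat -kd; lia.
  apply: sp_lin; first exact: psi_lin.
  move=> _ [w /= wt <-]; rewrite psiX; apply: sp_sub; right.
  by exists (inl (v0, w)) => //=; rewrite mem_cat; apply/orP; right; apply: allpairs_f.
apply: sp_sub; right; exists (inr (k, x)) => //=.
rewrite mem_cat; apply/orP; left; apply: allpairs_f => //; rewrite mem_kap //.
rewrite -(leq_pmul2l q_gt0); move: dv; rewrite {1}dE lez_nat -kd; lia.
Qed.

End Exchange.

Lemma rho_eq : rho = r.
Proof.
apply/eqP; rewrite eqn_leq; apply/andP; split.
  by rewrite -[leqRHS](card_ord r) cardE /rho size_filter count_size.
have [K0 HK0] := size_stl; rewrite leqNgt; apply/negP => rr.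
have cnt_box q : (size (stl (kbox N q)) <= rho * q ^ N + K0 * q ^ N.-1)%N.
  by rewrite -size_kbox; apply: HK0 => al; exact: size_kbox_notle.
have cnt_pts t : (size (pts t) <= rho * kC d t + K0 * t.+1 ^ N.-1)%N.
  by apply: leq_trans (size_pts_le t) _; apply: HK0 => al; exact: size_kap_notle.
(* With x = (q - 1) %/ Ee, the box of degree [e * x] satisfies E (e x) < q and holds at least x^N
   points. [X] is the threshold past which x^N exceeds K0 (2 Ee x)^(N-1), which is at least K0
   q^(N-1); [m] makes [q] large enough for X <= x. *)
pose Ee := (E.+1 * e.+1)%N; pose X := (K0 * (Ee * 2) ^ N.-1).+1.
pose m := (Ee * X.+1)%N; set q := (#|F| ^ m)%N.
have qm : (m < q)%N by apply: ltn_expl; exact: finfield.finNzRing_gt1.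
have q0 : (0 < q)%N by exact: leq_ltn_trans qm.
pose x := (q.-1 %/ Ee)%N.
have Ex : (E * (e * x) < q)%N.
  have : (x * Ee <= q.-1)%N by exact: leq_divM.
  rewrite -ltnS prednK // => /(leq_ltn_trans _); apply.
  by rewrite mulnA mulnC leq_mul2l /Ee leq_mul ?orbT.
have [s' s'E Hs'] := exchange_count Ex.
have := growth x; set g := size (pts (e * x)) in s'E Hs' * => gx.
pose s := (\sum_i d i)%N; pose c := (s + dmax)%N.
(* The factor [q ^ N] comes from [kC_mul]; the shift [c] absorbs its remainders ([s]) and the
   degrees of the b_j ([dmax]). *)
have main t : (rho * q ^ N * kC d t <=
    (s' + g * rho) * kC d (t + c) + g * K0 * (t + c).+1 ^ N.-1)%N.
  apply: (@leq_trans (size (pts (q * (t + c))))); last first.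
    apply: leq_trans (Hs' (t + c)%N) _; rewrite mulnDl -addnA leq_add2l -!mulnA -mulnDr.
    by rewrite leq_mul2l cnt_pts orbT.
  apply: (@leq_trans (size (pts (q * (t + s) + dmax)))).
    apply: leq_trans (size_pts_ge _); rewrite -mulnA leq_mul2l; apply/orP; right.
    exact: kC_mul.
  apply: uniq_leq_size (pts_uniq _) _ => v; rewrite !mem_pts => /andP[-> /= dv].
  apply: le_trans dv _; rewrite lez_nat /c addnA [leqRHS]mulnDr leq_add2l.
  by rewrite leq_pmull.
have le1 := kC_dominates d0 N0 main.
have le2 := cnt_box q; rewrite -s'E in le2.
have le3 : (g <= K0 * q ^ N.-1)%N.
  have : (g * rho + g <= g * r)%N by rewrite -mulnSr leq_mul2l rr orbT.
  by move: le1 le2; lia.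
have xX : (X <= x)%N.
  rewrite /x leq_divRL ?muln_gt0 // mulnC -ltnS prednK //.
  by apply: leq_ltn_trans qm; rewrite /m leq_mul2l leqnSn orbT.
have qx : (q <= Ee * (x * 2))%N.
  have : (q.-1 < x.+1 * Ee)%N by exact: ltn_ceil.
  have : (0 < x)%N by exact: leq_trans xX.
  move=> x0; rewrite prednK // => /leq_trans; apply.
  by rewrite mulnC leq_mul2l muln2 -addnn -addn1 leq_add2l x0 orbT.
have := @pow_dominates N K0 (Ee * 2) x N0 xX; apply/negP; rewrite -leqNgt.
apply: leq_trans gx (leq_trans le3 _); rewrite leq_mul2l; apply/orP; right.
by apply: leq_expl; apply: leq_trans qx _; rewrite mulnAC mulnA.
Qed.

(** By [rho_eq] every index is full, so every product is standard. *)
Theorem bmon_indep (g : {malg F[(K * 'I_r)%type]}) : lext bmon g = 0 -> g = 0.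
Proof.
move=> g0; have fl j : full j.
  have /allP/(_ j) : all full (enum 'I_r).
    by rewrite all_count -size_filter -/rho rho_eq -cardE card_ord.
  by rewrite mem_enum; apply.
apply/malgP => x; rewrite mcoeff0; case: msuppP => // xg.
apply: (@stdm_indep (msupp g) (fun x => g@_x) (fset_uniq _)) => //.
by move=> [k j] _; have /asboolP := fl j; apply.
Qed.

End FrobeniusCounting.

(** * Integral forms and Fourier-Motzkin elimination *)

Section Weyl.
Variables (R : realType) (n : nat).
Implicit Types (a : 'rV[int]_n * int) (u v : 'rV[R]_n) (k : R).

Definition fev a u k : R := dot (toR R a.1) u + a.2%:~R * k.

Lemma fevD a u v k l : fev a (u + v) (k + l) = fev a u k + fev a v l.
Proof. by rewrite /fev dotD mulrDr addrACA. Qed.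

Lemma fevZ a c u k : fev a (c *: u) (c * k) = c * fev a u k.
Proof. by rewrite /fev dotZ mulrDr mulrCA. Qed.

Lemma fev0 a : fev a 0 0 = 0.
Proof. by rewrite /fev dot0 mulr0 addr0. Qed.

Definition fevz a (mu : 'rV[int]_n) (k : int) : int :=
  \sum_(i < n) a.1 0 i * mu 0 i + a.2 * k.

Lemma fev_int a mu (k : int) : fev a (toR R mu) k%:~R = (fevz a mu k)%:~R.
Proof.
rewrite /fev /fevz intrD intrM; congr (_ + _); rewrite /dot rmorph_sum.
by apply: eq_bigr => i _; rewrite /= !mxE intrM.
Qed.

Definition fcomb (c : int) a (c' : int) a' : 'rV[int]_n * int :=
  (c *: a.1 + c' *: a'.1, c * a.2 + c' * a'.2).

Lemma fev_comb c a c' a' u k :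
  fev (fcomb c a c' a') u k = c%:~R * fev a u k + c'%:~R * fev a' u k.
Proof.
rewrite /fev /fcomb /= intrD !intrM.
have -> : dot (toR R (c *: a.1 + c' *: a'.1)) u =
    c%:~R * dot (toR R a.1) u + c'%:~R * dot (toR R a'.1) u.
  rewrite /dot !mulr_sumr -big_split /=; apply: eq_bigr => i _.
  by rewrite !mxE intrD !intrM; ring.
by ring.
Qed.

Definition sat (s : seq ('rV[int]_n * int)) u k := forall a, a \in s -> 0 <= fev a u k.

Lemma max_attained (T : eqType) (s : seq T) (h : T -> R) : exists m,
  0 <= m /\ (forall x, x \in s -> h x <= m) /\ (m = 0 \/ exists2 x, x \in s & m = h x).
Proof.
elim: s => [|x s [m [m0 [Hm Em]]]]; first by exists 0; split=> //; split=> //; left.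
case: (leP (h x) m) => hx.
  exists m; split=> //; split=> [y|]; first by rewrite inE => /orP[/eqP->|/Hm].
  by case: Em => [->|[y ys ->]]; [left|right; exists y => //; rewrite inE ys orbT].
exists (h x); split; first exact: le_trans m0 (ltW hx).
split=> [y|]; last by right; exists x; rewrite ?mem_head.
by rewrite inE => /orP[/eqP->//|/Hm/le_trans]; apply; exact: ltW.
Qed.

(* One step of Fourier-Motzkin elimination: the cone cut out by [s], enlarged by
   the ray through the integral vector (mu, l). *)
Lemma add_ray s (mu : 'rV[int]_n) (l : int) : exists s', forall u k,
  (exists2 y, 0 <= y & sat s (u - y *: toR R mu) (k - y * l%:~R)) <-> sat s' u k.
Proof.
pose g a := fevz a mu l.
have gE a y u k : fev a (u - y *: toR R mu) (k - y * l%:~R) = fev a u k - y * (g a)%:~R.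
  rewrite -scaleNr -mulNr fevD.
  by rewrite (_ : - y * l%:~R = - y * (l%:~R)) // fevZ fev_int mulNr.
pose pos := [seq a <- s | 0 <= g a]; pose neg := [seq a <- s | g a < 0].
exists (pos ++ [seq fcomb (g x.1) x.2 (- g x.2) x.1 | x <- [seq (a, b) | a <- pos, b <- neg]]).
move=> u k; split=> [[y y0 Hy] a|H].
  rewrite mem_cat => /orP[|/mapP[[a1 a2] /allpairsP[[b1 b2] [/=]]]].
    rewrite mem_filter => /andP[ga as_]; have := Hy a as_; rewrite gE => H.
    by apply: le_trans H _; rewrite gerBl mulr_ge0 // ler0z.
  rewrite !mem_filter => /andP[g1 s1] /andP[g2 s2] [-> ->] -> /=.
  have := Hy _ s1; have := Hy _ s2; rewrite !gE fev_comb => H2 H1.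
  have g1' : 0 <= (g b1)%:~R :> R by rewrite ler0z.
  have g2' : 0 <= - (g b2)%:~R :> R by rewrite oppr_ge0 lerz0 ltW.
  rewrite rmorphN /=.
  have := addr_ge0 (mulr_ge0 g1' H2) (mulr_ge0 g2' H1).
  by congr (_ <= _); ring.
have Hpos a : a \in s -> 0 <= g a -> 0 <= fev a u k.
  by move=> as_ ga; apply: H; rewrite mem_cat mem_filter ga as_.
(* Forms negative on the new ray bound [y] from below and the others bound it from above. The
   largest lower bound (or 0) is taken; the combined forms say that it respects every upper
   bound. *)
have [y [y0 [Hy Ey]]] := max_attained neg (fun b => fev b u k / (g b)%:~R).
exists y => // a as_; rewrite gE; case: (ltP (g a) 0) => ga.
  have := Hy a; rewrite mem_filter ga as_ => /(_ isT).
  by rewrite ler_ndivrMr ?ltrz0 // subr_ge0.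
case: Ey => [->|[b]]; first by rewrite mul0r subr0 Hpos.
rewrite mem_filter => /andP[gb bs] ->.
have gb' : (g b)%:~R < 0 :> R by rewrite ltrz0.
have : 0 <= fev (fcomb (g a) b (- g b) a) u k.
  apply: H; rewrite mem_cat; apply/orP; right; apply/mapP.
  exists (a, b) => //; apply/allpairsP; exists (a, b).
  by rewrite !mem_filter ga gb as_ bs.
rewrite fev_comb rmorphN /= => H1.
have -> : fev a u k - fev b u k / (g b)%:~R * (g a)%:~R =
   (- (g b)%:~R)^-1 * ((g a)%:~R * fev b u k + - (g b)%:~R * fev a u k).
  by field; rewrite lt_eqF.
by rewrite mulr_ge0 // invr_ge0 oppr_ge0 ltW.
Qed.

(* The cone over the polytope hull0 of the points in [l], at height 1. *)
Definition hceil (l : seq 'rV[int]_n) u k := exists c : 'rV[int]_n -> R,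
  [/\ forall mu, 0 <= c mu, u = \sum_(mu <- l) c mu *: toR R mu
    & \sum_(mu <- l) c mu <= k].

Lemma weyl (l : seq 'rV[int]_n) : uniq l ->
  exists s : seq ('rV[int]_n * int), forall u k, hceil l u k <-> sat s u k.
Proof.
elim: l => [_|mu l IH /= /andP[al ul]].
  (* Without points the cone is the half-line u = 0, 0 <= k, cut out by the height and by each
     coordinate with both signs. *)
  pose s1 := [seq (\row_j ((j == i)%:R : int), 0 : int) | i <- enum 'I_n].
  pose s2 := [seq (\row_j (- (j == i)%:R : int), 0 : int) | i <- enum 'I_n].
  have e1 i u k : fev (\row_j ((j == i)%:R : int), 0 : int) u k = u 0 i.
    rewrite /fev mul0r addr0 /dot (bigD1 i) //= !mxE eqxx mul1r big1 ?addr0 // => j ji.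
    by rewrite !mxE (negPf ji) mul0r.
  have e2 i u k : fev (\row_j (- (j == i)%:R : int), 0 : int) u k = - u 0 i.
    rewrite /fev mul0r addr0 /dot (bigD1 i) //= !mxE eqxx mulN1r big1 ?addr0 // => j ji.
    by rewrite !mxE (negPf ji) oppr0 mul0r.
  exists ((0, 1) :: s1 ++ s2) => u k; split=> [[c [_ -> ck]]|H].
    rewrite big_nil in ck; rewrite big_nil.
    move=> a; rewrite inE mem_cat => /or3P[/eqP->|/mapP[i _ ->]|/mapP[i _ ->]].
    - by rewrite /fev /= dot0 add0r mul1r.
    - by rewrite e1 mxE.
    - by rewrite e2 mxE oppr0.
  exists (fun=> 0); rewrite !big_nil; split=> //; last first.
    have := H (0, 1) (mem_head _ _); rewrite /fev /= mul1r /dot big1 ?add0r // => i _.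
    by rewrite !mxE mul0r.
  apply/rowP => i; rewrite mxE; apply/eqP; rewrite eq_le.
  apply/andP; split; [rewrite -oppr_ge0 -(e2 i u k)|rewrite -(e1 i u k)].
    by apply: H; rewrite inE mem_cat; apply/or3P; constructor 3; apply/mapP;
       exists i; rewrite ?mem_enum.
  by apply: H; rewrite inE mem_cat; apply/or3P; constructor 2; apply/mapP;
     exists i; rewrite ?mem_enum.
have [s Hs] := IH ul; have [s' Hs'] := add_ray s mu 1; exists s' => u k.
rewrite -Hs'; split=> [[c [c0 -> ck]]|[y y0 /Hs[c [c0 uE ck]]]].
  exists (c mu) => //; apply/Hs; exists c; split=> //.
    by rewrite big_cons addrC addKr.
  by rewrite mulr1 lerBrDl; move: ck; rewrite big_cons.
exists (fun b => if b == mu then y else c b); split=> [b||].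
- by case: ifP.
- rewrite big_cons eqxx -[u](subrK (y *: toR R mu)) uE addrC; congr (_ + _).
  by apply: eq_big_seq => b bl; case: eqP => // ba; rewrite -ba bl in al.
- rewrite big_cons eqxx -lerBrDl; move: ck; rewrite mulr1; congr (_ <= _).
  by apply: eq_big_seq => b bl; case: eqP => // ba; rewrite -ba bl in al.
Qed.

End Weyl.

(** * The weight as least height over a point, and cofaciality *)

Section Weight.
Variables (R : realType) (n : nat) (l : seq 'rV[int]_n) (A : set 'rV[R]_n).
Variable s : seq ('rV[int]_n * int).
Hypothesis Hs : forall (u : 'rV[R]_n) k, hceil l u k <-> sat s u k.
Hypothesis HA : forall x, A x <-> exists2 mu, mu \in l & x = toR R mu.
Hypothesis ul : uniq l.
Local Notation D := (hull0 A).
Local Notation w := (weight D).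
Implicit Types (u v x : 'rV[R]_n) (k : R).

Lemma conv_hull_sub (B : set 'rV[R]_n) : B `<=` conv_hull B.
Proof.
move=> x Bx; exists 1%N, (fun=> x), (fun=> 1).
by split=> //; rewrite ?big_ord1 ?scale1r.
Qed.

(** The missing mass sits at the origin. One point is split off and the rest rescaled by [1 - c a],
    unless [c a = 1], when all other coefficients vanish. *)
Lemma hull0_comb (r : seq 'rV[int]_n) (c : 'rV[int]_n -> R) :
  {subset r <= l} -> (forall mu, 0 <= c mu) -> \sum_(mu <- r) c mu <= 1 ->
  D (\sum_(mu <- r) c mu *: toR R mu).
Proof.
elim: r c => [|a r IH] c rl c0; first by rewrite !big_nil => _; exact: hull0_0.
rewrite !big_cons => c1; have Da : D (toR R a).
  by apply: conv_hull_sub; right; apply/HA; exists a; rewrite ?rl ?mem_head.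
have s0 : 0 <= \sum_(mu <- r) c mu by apply: sumr_ge0.
have rl' : {subset r <= l} by move=> b br; apply: rl; rewrite inE br orbT.
have ca1 : c a <= 1 by apply: le_trans c1; rewrite lerDl.
have [E|ne] := eqVneq (c a) 1.
  have z : \sum_(mu <- r) c mu = 0.
    by move: c1 s0; rewrite E; move: (\sum_(_ <- _) _) => S; lra.
  rewrite E scale1r [X in _ + X]big_seq big1 ?addr0 // => b br.
  have : c b <= 0 by rewrite -z (big_rem b) //= lerDl sumr_ge0.
  by move=> cb; have -> : c b = 0; [apply/eqP; rewrite eq_le cb c0|rewrite scale0r].
have lt1 : 0 < 1 - c a by rewrite subr_gt0 lt_neqAle ne ca1.
have -> : c a *: toR R a + \sum_(mu <- r) c mu *: toR R mu = c a *: toR R a +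
    (1 - c a) *: \sum_(mu <- r) (c mu / (1 - c a)) *: toR R mu.
  congr (_ + _); rewrite scaler_sumr; apply: eq_bigr => b _.
  by rewrite scalerA mulrC divfK // gt_eqF.
apply: conv_hull_convex => //; apply: (IH (fun mu => c mu / (1 - c a))) => //.
  by move=> mu; rewrite divr_ge0 // ltW.
by rewrite -mulr_suml ler_pdivrMr // mul1r lerBrDl.
Qed.

Lemma hull0_hceil x : D x -> hceil l x 1.
Proof.
move=> [m [p [c [Ap c0 c1 ->]]]]; apply/Hs => a as_.
have -> : 1 = \sum_i c i * 1 :> R by under eq_bigr do rewrite mulr1.
have -> : fev a (\sum_i c i *: p i) (\sum_i c i * 1) = \sum_i c i * fev a (p i) 1.
  elim/big_rec3: _ => [|i y1 y2 y3 _ IH]; first by rewrite fev0.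
  by rewrite fevD IH fevZ.
apply: sumr_ge0 => i _; rewrite mulr_ge0 //.
have : hceil l (p i) 1; last by move/Hs; apply.
case: (Ap i) => [/= ->|/HA[mu mul ->]].
  exists (fun=> 0); split=> //; last by rewrite big1.
  by rewrite big1 // => b _; rewrite scale0r.
exists (fun b => (b == mu)%:R); split=> [b||]; first exact: ler0n.
  rewrite (bigD1_seq mu) //= eqxx scale1r big1 ?addr0 // => b /negPf->.
  by rewrite scale0r.
by rewrite (bigD1_seq mu) //= eqxx big1 ?addr0 // => b /negPf->.
Qed.

Lemma hceilP u k : hceil l u k <-> 0 <= k /\ exists2 x, D x & u = k *: x.
Proof.
split=> [[c [c0 -> ck]]|[k0 [x /hull0_hceil/Hs Hx ->]]]; last first.
  by apply/Hs => a as_; rewrite -[X in fev _ _ X]mulr1 fevZ mulr_ge0 // Hx.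
have sc0 : 0 <= \sum_(mu <- l) c mu by apply: sumr_ge0.
have k0 := le_trans sc0 ck; split=> //.
have [k_0|kn0] := eqVneq k 0.
  exists 0; first exact: hull0_0.
  rewrite k_0 scale0r big_seq big1 // => b bl.
  have : c b <= 0 by rewrite -k_0; apply: le_trans ck; rewrite (big_rem b) //= lerDl sumr_ge0.
  by move=> cb; have -> : c b = 0; [apply/eqP; rewrite eq_le cb c0|rewrite scale0r].
have kp : 0 < k by rewrite lt_neqAle eq_sym kn0.
exists (\sum_(mu <- l) (c mu / k) *: toR R mu).
  apply: (hull0_comb (c := fun mu => c mu / k)) => // [mu|].
    by rewrite divr_ge0.
  by rewrite -mulr_suml ler_pdivrMr // mul1r.
by rewrite scaler_sumr; apply: eq_bigr => b _; rewrite scalerA mulrC divfK.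
Qed.

Lemma sat_hullP u k : sat s u k <-> 0 <= k /\ exists2 x, D x & u = k *: x.
Proof. by rewrite -Hs hceilP. Qed.

Lemma sat_ge0 u k : sat s u k -> 0 <= k. Proof. by move/sat_hullP => []. Qed.

Lemma sat_cone u k : sat s u k -> cone D u.
Proof. by move/sat_hullP => [k0 [x Dx ->]]; exists k, x. Qed.

Lemma cone_sat u : cone D u -> exists k, sat s u k.
Proof. by move=> [k [x [k0 Dx ->]]]; exists k; apply/sat_hullP; split=> //; exists x. Qed.

Lemma weightE u : w u = inf [set k | sat s u k].
Proof. by rewrite /weight; congr inf; apply/seteqP; split=> k /=; rewrite sat_hullP. Qed.

Lemma weight_le u k : sat s u k -> w u <= k.
Proof.
move=> Hk; rewrite weightE; apply: ge_inf => //.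
by exists 0 => x /= /sat_ge0.
Qed.

Lemma weight_ge0 u : 0 <= w u.
Proof.
rewrite weightE; have [->|/set0P ne] := eqVneq [set k | sat s u k] set0.
  by rewrite inf0.
by apply: lb_le_inf => // k /= /sat_ge0.
Qed.

Lemma fev_shift a u k k' : fev a u k' = fev a u k + a.2%:~R * (k' - k).
Proof. by rewrite /fev mulrBr; ring. Qed.

Lemma fev_sub a u k e : fev a u (k - e) = fev a u k - a.2%:~R * e.
Proof. by rewrite (fev_shift a u k); ring. Qed.

(** A form negative at height [w u] but not at some admissible greater height has [0 < a.2]; it then
    keeps all admissible heights away from their infimum. *)
Lemma weight_sat u : cone D u -> sat s u (w u).
Proof.
move=> /cone_sat[k0 Hk0] a as_; rewrite leNgt; apply/negP => lt0.
have Hk k : sat s u k -> 0 <= fev a u (w u) + a.2%:~R * (k - w u).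
  by move=> /(_ a as_); rewrite (fev_shift a u (w u) k).
have a2 : 0 < a.2%:~R :> R.
  rewrite ltNge; apply/negP => a2; have := Hk _ Hk0.
  rewrite leNgt => /negP; apply; rewrite -[ltRHS]addr0 ltr_leD //.
  by rewrite mulr_le0_ge0 ?subr_ge0 ?weight_le.
have : w u - fev a u (w u) / a.2%:~R <= w u.
  rewrite {3}weightE; apply: lb_le_inf => [|k /= /Hk]; first by exists k0.
  rewrite -lerBlDl sub0r => H; rewrite -lerBrDl -mulNr ler_pdivrMr //.
  by rewrite mulrC.
by rewrite gerBl leNgt pmulr_llt0 ?invr_gt0 // lt0.
Qed.

Lemma sat_weight u k : cone D u -> w u <= k -> sat s u k.
Proof.
move=> cu wk; apply/sat_hullP; split; first exact: le_trans (weight_ge0 u) wk.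
have [w0 [x Dx uE]] := (proj1 (sat_hullP _ _)) (weight_sat cu).
have [k0|kn0] := eqVneq k 0.
  exists x => //; rewrite {1}uE k0; congr (_ *: _).
  by apply/eqP; rewrite eq_le w0 -k0 wk.
have kp : 0 < k by rewrite lt_neqAle eq_sym kn0 (le_trans w0 wk).
exists ((w u / k) *: x + (1 - w u / k) *: 0).
  apply: conv_hull_convex Dx (hull0_0 A); last by rewrite ler_pdivrMr ?mul1r.
  by rewrite divr_ge0 // ltW.
by rewrite scaler0 addr0 scalerA mulrC divfK.
Qed.

(** If all forms that increase with the height had slack at [w u], the height could be lowered a
    little. A tight form with [0 < a.2] supports a face that avoids the origin. *)
Lemma weight_tight u : cone D u ->
  exists2 a, a \in s & 0 < a.2 /\ fev a u (w u) = 0.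
Proof.
move=> cu; have Hw := weight_sat cu; apply: contrapT => no.
suff [e e0 He] : exists2 e, 0 < e & sat s u (w u - e).
  have := weight_le He; rewrite leNgt => /negP; apply.
  by rewrite ltrBlDr ltrDl.
have {no} : forall a, a \in s -> 0 < a.2 -> 0 < fev a u (w u).
  move=> a as_ a2; rewrite lt_neqAle Hw // andbT eq_sym; apply/eqP => E.
  by apply: no; exists a.
move: Hw; rewrite /sat; elim: (s) => [|a r IH] Hw pos; first by exists 1.
have [|b br b2|e e0 He] := IH.
- by move=> b br; apply: Hw; rewrite inE br orbT.
- by apply: pos => //; rewrite inE br orbT.
have [a2|a2] := ltP 0 a.2; last first.
  exists e => // b; rewrite inE => /orP[/eqP->|/He//].
  rewrite fev_sub -mulNr.
  apply: addr_ge0; first exact: Hw (mem_head _ _).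
  by apply: mulr_ge0; [rewrite oppr_ge0 lerz0|exact: ltW].
have fa := pos a (mem_head _ _) a2; have a2' : 0 < a.2%:~R :> R by rewrite ltr0z.
exists (Num.min e (fev a u (w u) / a.2%:~R)).
  by rewrite lt_min e0 divr_gt0.
have aux b e1 e2 : e1 <= e2 -> 0 <= fev b u (w u) -> 0 <= fev b u (w u - e2) ->
    0 <= e1 -> 0 <= fev b u (w u - e1).
  move=> e12 b0; rewrite !fev_sub => b1 e10.
  have [b2|b2] := leP b.2%:~R (0 : R); first by rewrite subr_ge0 (le_trans _ b0) // mulr_le0_ge0.
  by apply: le_trans b1 _; rewrite lerD2l lerN2 ler_pM2l.
have m0 : 0 <= Num.min e (fev a u (w u) / a.2%:~R) by rewrite le_min ltW //= divr_ge0 // ltW.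
move=> b; rewrite inE => /orP[/eqP->|br].
  apply: (aux _ _ (fev a u (w u) / a.2%:~R)) => //; [by rewrite ge_min lexx orbT|exact: ltW|].
  rewrite fev_sub mulrCA divff ?mulr1 ?subrr //.
  by rewrite gt_eqF.
apply: (aux _ _ e) => //; [by rewrite ge_min lexx|by rewrite Hw // inE br orbT|exact: He].
Qed.

Lemma weight_eq0 u : cone D u -> w u = 0 -> u = 0.
Proof. by move=> /weight_sat/sat_hullP[_ [x _ uE]] w0; rewrite uE w0 scale0r. Qed.

Lemma weight0 : w 0 = 0.
Proof.
apply/eqP; rewrite eq_le weight_ge0 andbT; apply: weight_le => a _.
by rewrite fev0.
Qed.

Lemma weight_subadd u v : cone D u -> cone D v -> w (u + v) <= w u + w v.
Proof.
move=> cu cv; apply: weight_le => a as_.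
by rewrite fevD addr_ge0 // ?(weight_sat cu) ?(weight_sat cv).
Qed.

Lemma coneD u v : cone D u -> cone D v -> cone D (u + v).
Proof.
move=> /weight_sat cu /weight_sat cv; apply: (sat_cone (k := w u + w v)) => a as_.
by rewrite fevD addr_ge0 ?cu ?cv.
Qed.

(** A form tight at [u + v] is a sum of two nonnegative values, hence tight at [u] and at [v]; its
    zero set at height 1 is the common face. *)
Lemma weight_cofacial u v : cone D u -> cone D v ->
  w (u + v) = w u + w v -> cofacial D u v.
Proof.
move=> cu cv wE; have [->|u0] := eqVneq u 0; first exact: Or31.
have [->|v0] := eqVneq v 0; first exact: Or32.
apply: Or33; have [a as_ [a2]] := weight_tight (coneD cu cv).
rewrite wE fevD => /eqP; rewrite paddr_eq0 ?(weight_sat cu) ?(weight_sat cv) //.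
move=> /andP[/eqP ua /eqP va].
have a2' : 0 < a.2%:~R :> R by rewrite ltr0z.
have dN (c : 'rV[R]_n) x : dot (- c) x = - dot c x.
  by rewrite /dot -sumrN; apply: eq_bigr => i _; rewrite mxE mulNr.
pose la := - toR R a.1; pose sg := [set x | D x /\ dot la x = a.2%:~R].
have key x : cone D x -> x != 0 -> fev a x (w x) = 0 -> exists2 z, sg z & x = w x *: z.
  move=> cx x0 fx; have [w0 [z Dz xE]] := (proj1 (sat_hullP _ _)) (weight_sat cx).
  have wx : 0 < w x.
    by rewrite lt_neqAle eq_sym w0 andbT; apply: contra x0 => /eqP/(weight_eq0 cx)->.
  exists z => //; split=> //; rewrite dN; move: fx; rewrite {1}xE /fev dotZ mulrC -mulrDl.
  move=> /eqP; rewrite mulf_eq0 (gt_eqF wx) orbF addrC addr_eq0 => /eqP->; exact: erefl.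
have [z1 sz1 uE] := key u cu u0 ua; have [z2 sz2 vE] := key v cv v0 va.
exists sg; split.
- split; first by exists z1.
  exists la, a.2%:~R; split=> // x /hull0_hceil/Hs/(_ a as_).
  by rewrite /fev mulr1 dN => H; rewrite -subr_ge0 opprK addrC.
- by move=> [_]; rewrite dot0 => /eqP; rewrite lt_eqF.
- by exists (w u), z1; split=> //; exact: weight_ge0.
- by exists (w v), z2; split=> //; exact: weight_ge0.
Qed.

End Weight.

Section FaceWeight.
Variables (R : realType) (n : nat) (A : set 'rV[R]_n).
Local Notation D := (hull0 A).

(** The supporting form equals m > 0 on the face and is at most m on the polytope, so comparing its
    values bounds every admissible height from below. *)
Lemma weight_face sigma c x : closed_face D sigma -> ~ sigma 0 -> 0 <= c ->
  sigma x -> weight D (c *: x) = c.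
Proof.
move=> [_ [l [m [lm ->]]]] s0 c0 [Dx lx].
have m0 : 0 < m.
  rewrite lt_neqAle; have := lm 0 (hull0_0 A); rewrite dot0 => ->.
  rewrite andbT; apply/eqP => m_0; apply: s0; split; first exact: hull0_0.
  by rewrite dot0.
apply/eqP; rewrite eq_le; apply/andP; split.
  apply: ge_inf; last by split=> //; exists x.
  by exists 0 => k [].
apply: lb_le_inf; first by exists c; split=> //; exists x.
move=> k [k0 [y Dy E]]; rewrite -(ler_pM2r m0) -{1}lx -dotZ E dotZ.
by rewrite ler_wpM2l // lm.
Qed.

Lemma cofacial_weight u v : cone D u -> cone D v -> weight D 0 = 0 ->
  cofacial D u v -> weight D (u + v) = weight D u + weight D v.
Proof.
move=> cu cv w0 [->|->|[sg [Fs s0 su sv]]]; rewrite ?w0 ?add0r ?addr0 //.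
have suv := cone_face_add Fs su sv.
have [l [m [lm sE]]] := proj2 Fs.
move: su sv suv => [c [x [c0 sx ->]]] [d [y [d0 sy ->]]] [e [z [e0 sz E]]].
rewrite {1}E !(weight_face Fs) //.
have m0 : m != 0.
  by apply/eqP => m_0; apply: s0; rewrite sE; split; [exact: hull0_0|rewrite dot0].
have := congr1 (dot l) E; rewrite dotD !dotZ.
move: sx sy sz; rewrite sE => -[_ ->] [_ ->] [_ ->].
by rewrite -mulrDl => /(mulIf m0).
Qed.

End FaceWeight.

(** * A Nullstellensatz for ideals given as predicates *)

Section RootExtension.
Variables (A : comNzRingType) (J : A -> Prop) (Kb : closedFieldType).
Hypothesis JD : forall a b, J a -> J b -> J (a + b).
Hypothesis JM : forall a b, J b -> J (a * b).
Variables (Q : comNzRingType) (al : {rmorphism Q -> A}) (ga : {rmorphism Q -> Kb}).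
Hypothesis Hg : forall q, J (al q) -> ga q = 0.
Hypothesis Hinv : forall q, ga q != 0 -> exists q', ga q' * ga q = 1.
Variable z : A.
Implicit Types (p q : {poly Q}).

Let E p : A := (map_poly al p).[z].

Let ED p q : E (p + q) = E p + E q.
Proof. by rewrite /E rmorphD hornerD. Qed.
Let EM p q : E (p * q) = E p * E q.
Proof. by rewrite /E rmorphM hornerM. Qed.
Let EN p : E (- p) = - E p.
Proof. by rewrite /E rmorphN hornerN. Qed.
Let EC c : E c%:P = al c.
Proof. by rewrite /E map_polyC hornerC. Qed.
Let EX : E 'X = z.
Proof. by rewrite /E map_polyX hornerX. Qed.

Let JN a : J a -> J (- a).
Proof. by move=> Ja; rewrite -mulN1r; apply: JM. Qed.

(* Lying over: as z is integral modulo J, no polynomial congruent to 1 under ga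
   vanishes at z.  The proof eliminates the degree of the integral equation. *)
Lemma no_unit_relation d p q : (size p <= d.+1)%N -> ga p`_d = 1 ->
  J (E p) -> J (E q) -> map_poly ga q = 1 -> False.
Proof.
elim: d p q => [|d IH] p q sp lp Jp.
  have pE : p = (p`_0)%:P by apply: size1_polyC.
  move=> _ _; have := Hg (q := p`_0); rewrite lp -EC -pE => /(_ Jp)/eqP.
  by rewrite oner_eq0.
have qcoef r i : map_poly ga r = 1 -> ga r`_i = (i == 0%N)%:R.
  by move=> Hr; rewrite -coef_map Hr coef1.
have [m] := ubnP (size q); elim: m q => // m IHm q; rewrite ltnS => sq Jq gq.
have [big|small] := ltnP d.+1 (size q).
  pose k := (size q).-1; have kE : size q = k.+1 by rewrite /k prednK // (leq_trans _ big).
  have k0 : (k == 0%N) = false by apply/negbTE; move: big; rewrite kE; lia.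
  (* Leading terms are cross-multiplied since [Q] is only a ring. Under [ga] the leading coefficient
     of [q] vanishes and that of [p] is 1, so the image stays 1 while the size drops. *)
  pose q' := p`_d.+1 *: q - q`_k *: 'X^(k - d.+1) * p.
  apply: (IHm q').
  - apply: leq_trans sq; rewrite kE ltnS; apply/leq_sizeP => i ki.
    rewrite coefB coefZ -scalerAl coefZ coefXnM.
    move: ki; rewrite leq_eqVlt => /orP[/eqP<-|ki].
      by rewrite ltnNge leq_subr /= subKn ?(mulrC q`_k) ?subrr //; move: big; rewrite kE.
    rewrite [q`_i]nth_default ?kE // mulr0 sub0r.
    case: ifP => _; rewrite ?mulr0 ?oppr0 //.
    rewrite [p`__]nth_default ?mulr0 ?oppr0 //; apply: leq_trans sp _.
    by move: ki big; rewrite kE; lia.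
  - rewrite /q' -!mul_polyC -mulrA ED EN !EM !EC.
    by apply: JD; [exact: JM|apply: JN; do 2!apply: JM].
  - rewrite /q' -!mul_polyC rmorphB !rmorphM /= !map_polyC /= gq lp.
    by rewrite (qcoef q k gq) k0 polyC0 !mul0r subr0 mulr1.
pose u := q`_0; have gu : ga u = 1 by rewrite /u qcoef.
(* Clearing the constant term and dividing by X gives [p'] of lower degree, whose coefficient at [d]
   still maps to 1. *)
pose pp := u *: p - p`_0 *: q.
have [p' p'E] : exists p', pp = p' * 'X.
  exists (\poly_(i < size pp) pp`_i.+1); apply/polyP => i; rewrite coefMX.
  case: i => [|i] /=; first by rewrite /pp coefB !coefZ /u mulrC subrr.
  rewrite coef_poly; case: ltnP => // si; rewrite nth_default //.
  exact: leq_trans si (leqnSn _).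
have [r rE] : exists r, q = u%:P + r * 'X.
  exists (\poly_(i < size q) q`_i.+1); apply/polyP => i; rewrite coefD coefC coefMX.
  case: i => [|i] /=; first by rewrite addr0.
  rewrite add0r coef_poly; case: ltnP => // si; rewrite nth_default //.
  exact: leq_trans si (leqnSn _).
have Jpp : J (E pp).
  by rewrite /pp -!mul_polyC ED EN !EM; apply: JD; [|apply: JN]; apply: JM.
have p'c i : p'`_i = pp`_i.+1 by rewrite p'E coefMX.
apply: (IH (u *: p') q) => //.
- apply: leq_trans (size_scale_leq _ _) _; apply/leq_sizeP => i di.
  have sp1 : (size p <= i.+1)%N by apply: leq_trans sp _.
  have sq1 : (size q <= i.+1)%N by apply: leq_trans small _; exact: leq_trans di _.
  by rewrite p'c /pp coefB !coefZ (nth_default _ sp1) (nth_default _ sq1) !mulr0 subrr.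
- rewrite coefZ rmorphM gu mul1r p'c /pp coefB !coefZ rmorphB !rmorphM gu lp mul1r.
  by rewrite (qcoef q d.+1 gq) mulr0 subr0.
(* Division by X is not legitimate at [z], which may not be invertible modulo J. But [q] vanishes
   there modulo J, so its constant term [u] is congruent to a multiple of [z], and this recovers the
   factor. *)
have -> : E (u *: p') = E p' * E q - E r * E pp.
  have Eq : E q = al u + E r * z by rewrite {1}rE ED EM EC EX.
  by rewrite Eq p'E -mul_polyC !EM EC EX; ring.
by apply: JD; [exact: JM|apply: JN; exact: JM].
Qed.

(** The images under [ga] of the polynomials vanishing at [z] modulo J are closed under division
    with remainder, as nonzero values of [ga] are invertible among its values. One of least degree
    divides them all; it is not constant by [no_unit_relation], and [c] is any root of it. *)
Lemma root_extension d p : (size p <= d.+1)%N -> ga p`_d = 1 -> J (E p) ->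
  exists c, forall q, J (E q) -> (map_poly ga q).[c] = 0.
Proof.
move=> sp lp Jp.
pose S m := `[< exists q, [/\ J (E q), map_poly ga q != 0 & size (map_poly ga q) = m] >].
have exS : exists m, S m.
  exists (size (map_poly ga p)); apply/asboolP; exists p; split=> //.
  apply/eqP => /polyP/(_ d); rewrite coef_map /= lp coef0.
  by apply/eqP; exact: oner_neq0.
have [m /asboolP[q [Jq q0 sq]] minq] := ex_minnP exS.
pose lq := ga q`_m.-1.
have lqE : lead_coef (map_poly ga q) = lq by rewrite lead_coefE sq coef_map.
have lq0 : lq != 0 by rewrite -lqE lead_coef_eq0.
have [qi qiE] := Hinv lq0.
have [c rc] : exists c, root (map_poly ga q) c.
  apply/closed_rootP; apply/eqP => s1.
  apply: (no_unit_relation sp lp Jp (q := qi%:P * q)).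
    by rewrite EM; exact: JM.
  have qc := size1_polyC (eq_leq s1); rewrite coef_map in qc.
  rewrite rmorphM /= map_polyC /= qc -polyCM.
  by move: qiE; rewrite /lq -sq s1 /= => ->.
exists c => q1; have [k] := ubnP (size (map_poly ga q1)).
elim: k q1 => // k IH q1; rewrite ltnS => sk Jq1.
have [->|q10] := eqVneq (map_poly ga q1) 0; first by rewrite horner0.
have mle : (m <= size (map_poly ga q1))%N.
  by apply: minq; apply/asboolP; exists q1.
set s := size (map_poly ga q1) in mle sk.
have s0 : (0 < s)%N by rewrite size_poly_gt0.
have m0 : (0 < m)%N by rewrite -sq size_poly_gt0.
pose q2 := q1 - (q1`_s.-1 * qi)%:P * 'X^(s - m) * q.
have Jq2 : J (E q2).
  by rewrite /q2 ED EN EM; apply: JD => //; apply: JN; exact: JM.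
have -> : (map_poly ga q1).[c] = (map_poly ga q2).[c].
  rewrite /q2 rmorphB rmorphM hornerD hornerN hornerM.
  by move/rootP: rc => ->; rewrite mulr0 subr0.
apply: IH Jq2; apply: leq_trans sk.
apply: (@leq_ltn_trans s.-1); last by rewrite prednK.
have mq2 : map_poly ga q2 = map_poly ga q1 -
    (ga q1`_s.-1 * ga qi)%:P * ('X^(s - m) * map_poly ga q).
  rewrite /q2 (rmorphB (map_poly ga)) !(rmorphM (map_poly ga)) /=.
  by rewrite map_polyC map_polyXn /= (rmorphM ga) mulrA.
apply/leq_sizeP => i; rewrite mq2 coefB coefCM coefXnM.
rewrite leq_eqVlt => /orP[/eqP<-|si].
  rewrite ifF; last by apply/negbTE; rewrite -leqNgt; move: m0 mle; lia.
  rewrite (_ : s.-1 - (s - m) = m.-1)%N; last by move: m0 mle s0; lia.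
  by rewrite !coef_map -mulrA qiE mulr1 subrr.
rewrite [(map_poly ga q1)`_i]nth_default; last by rewrite -/s; move: si s0; lia.
case: ifP => _; rewrite ?mulr0 ?subrr //.
have h : (size (map_poly ga q) <= i - (s - m))%N by rewrite sq; move: si s0 mle m0; lia.
by rewrite (nth_default _ h) mulr0 subrr.
Qed.

End RootExtension.

Lemma alg_inverse (F : fieldType) (Kb : fieldType) (iota : {rmorphism F -> Kb})
    (c : Kb) : integralOver iota c -> c != 0 ->
  exists r : {poly F}, (map_poly iota r).[c] * c = 1.
Proof.
move=> [p mp rp] c0; have {mp} : p != 0 by exact: monic_neq0.
elim/poly_ind: p rp => [|p a IH]; first by rewrite eqxx.
rewrite rmorphD rmorphM /= map_polyX map_polyC /= => /rootP.
rewrite hornerD hornerM hornerX hornerC.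
have [->|a0] := eqVneq a 0.
  rewrite rmorph0 !addr0 => /eqP; rewrite mulf_eq0 (negPf c0) orbF => rp.
  by rewrite mulf_eq0 polyX_eq0 orbF => p0; exact: IH.
move=> E _; exists (- a^-1 *: p); rewrite map_polyZ hornerZ -mulrA.
move/eqP: E; rewrite addr_eq0 => /eqP->; rewrite rmorphN fmorphV.
by rewrite mulNr mulrN opprK mulVf // fmorph_eq0.
Qed.

Section Evaluation.
Variables (F : fieldType) (S : comNzRingType) (phi : {rmorphism F -> S}) (m : nat).
Variable z : 'I_m -> S.

Definition mz (k : {ffun 'I_m -> nat}) : S := \prod_i z i ^+ k i.

Lemma mz0 : mz 0 = 1.
Proof. by rewrite /mz big1 // => i _; rewrite ffunE. Qed.

Lemma mzD : {morph mz : k l / k + l >-> k * l}.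
Proof.
by move=> k l; rewrite /mz -big_split; apply: eq_bigr => i _; rewrite ffunE; exact: exprD.
Qed.

Definition evm (p : calg F (lat {ffun 'I_m -> nat})) : S := rext phi mz p.

HB.instance Definition _ := GRing.isZmodMorphism.Build _ _ evm (rext_is_zmod phi mz).
HB.instance Definition _ :=
  GRing.isMonoidMorphism.Build _ _ evm (rext_is_monoid phi mz0 mzD).

Lemma evmX k : evm (lX k) = mz k.
Proof. exact: rextX. Qed.

Lemma evmZ c p : evm (c *: p) = phi c * evm p.
Proof. exact: rextZ. Qed.

Lemma evmA c : evm c%:A = phi c.
Proof. by rewrite evmZ rmorph1 mulr1. Qed.

Lemma mz_kone i : mz [ffun l => (l == i) : nat] = z i.
Proof.
rewrite /mz (bigD1 i) //= ffunE eqxx expr1 big1 ?mulr1 // => l /negPf li.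
by rewrite ffunE li.
Qed.

End Evaluation.

Lemma base_digits_inj m T (k l : 'I_m -> nat) : (forall i, k i < T)%N ->
  (forall i, l i < T)%N ->
  (\sum_(i < m) k i * T ^ i = \sum_(i < m) l i * T ^ i)%N -> k =1 l.
Proof.
elim: m k l => [|m IH] k l kT lT; first by move=> _ [].
rewrite !big_ord_recl !expn0 !muln1.
have E (h : 'I_m.+1 -> nat) : (\sum_(i < m) h (lift ord0 i) * T ^ (lift ord0 i) =
    T * \sum_(i < m) h (lift ord0 i) * T ^ i)%N.
  by rewrite big_distrr; apply: eq_bigr => i _ /=; rewrite /bump leq0n add1n expnS mulnCA.
rewrite !E => H.
have T0 : (0 < T)%N by exact: leq_ltn_trans (kT ord0).
have H0 : k ord0 = l ord0.
  have := congr1 (modn^~ T) H; rewrite ![(T * _)%N]mulnC !(addnC (_ ord0)) !modnMDl.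
  by rewrite !modn_small.
have H1 : (\sum_(i < m) k (lift ord0 i) * T ^ i = \sum_(i < m) l (lift ord0 i) * T ^ i)%N.
  by move: H; rewrite H0 => /addnI/eqP; rewrite eqn_pmul2l // => /eqP.
have := IH (fun i => k (lift ord0 i)) (fun i => l (lift ord0 i)) _ _ H1.
move=> IH' i; case: (unliftP ord0 i) => [j ->|->] //.
by apply: IH' => j'.
Qed.

Section Nullstellensatz.
Variables (F : fieldType) (A : comNzRingType) (phi : {rmorphism F -> A}).
Variables (J : A -> Prop) (Kb : closedFieldType) (iota : {rmorphism F -> Kb}).
Hypothesis JD : forall a b, J a -> J b -> J (a + b).
Hypothesis JM : forall a b, J b -> J (a * b).
Hypothesis J1 : ~ J 1.
Hypothesis alg : forall c, integralOver iota c.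

Section Nagata.
Variables (m T : nat).
Local Notation K := {ffun 'I_m -> nat}.
Local Notation K' := {ffun 'I_m.+1 -> nat}.
Local Notation Q := (calg F (lat K)).
Let e (i : 'I_m) := (T ^ i.+1)%N.

(** Nagata's substitution: the variable 0 becomes X and the variable i + 1 becomes x_i +
    X^(T^(i+1)). Each monomial becomes monic in X, of degree [nagdeg k], the number whose base-T
    digits are the exponents. *)
Definition nagmon (k : K') : {poly Q} :=
  'X^(k ord0) * \prod_(i < m) ('X^(e i) + (lX [ffun l => (l == i) : nat])%:P) ^+ k (lift ord0 i).

Definition nagpol (p : calg F (lat K')) : {poly Q} :=
  \sum_(k <- msupp p) ((p@_k)%:A)%:P * nagmon k.

Definition nagdeg (k : K') := (\sum_(i < m.+1) k i * T ^ i)%N.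

Lemma nagmon_monic k : (0 < T)%N ->
  nagmon k \is monic /\ size (nagmon k) = (nagdeg k).+1.
Proof.
move=> T0; have mon1 i : 'X^(e i) + (lX [ffun l => (l == i) : nat] : Q)%:P \is monic /\
    size ('X^(e i) + (lX [ffun l => (l == i) : nat] : Q)%:P) = (e i).+1.
  have e0 : (0 < e i)%N by rewrite expn_gt0 T0.
  have sz : (size (lX [ffun l => (l == i) : nat] : Q)%:P < size ('X^(e i) : {poly Q}))%N.
    by rewrite size_polyXn; apply: leq_ltn_trans (size_polyC_leq1 _) _.
  split; last by rewrite size_polyDl // size_polyXn.
  by rewrite monicE lead_coefDl // lead_coefXn.
have mX i j : ('X^(e i) + (lX [ffun l => (l == i) : nat] : Q)%:P) ^+ j \is monic.
  by apply: rpredX; have [] := mon1 i.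
have sX i j : size (('X^(e i) + (lX [ffun l => (l == i) : nat] : Q)%:P) ^+ j) = (j * e i).+1.
  have [mi si] := mon1 i; elim: j => [|j IH]; first by rewrite expr0 size_poly1.
  by rewrite exprS size_monicM ?monic_neq0 // si IH /= mulSn addnS.
have pr (s : seq 'I_m) : \prod_(i <- s) ('X^(e i) + (lX [ffun l => (l == i) : nat] : Q)%:P) ^+ k (lift ord0 i) \is monic
   /\ size (\prod_(i <- s) ('X^(e i) + (lX [ffun l => (l == i) : nat] : Q)%:P) ^+ k (lift ord0 i)) =
   (\sum_(i <- s) k (lift ord0 i) * e i).+1%N.
  elim: s => [|i s [IH1 IH2]]; first by rewrite !big_nil size_poly1 monic1.
  rewrite !big_cons; split; first by rewrite monicMl ?mX.
  by rewrite size_monicM ?monic_neq0 // sX IH2 /= addnS.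
have [pm psz] := pr (index_enum _); split; first by rewrite monicMl ?monicXn.
rewrite size_monicM ?monicXn ?monic_neq0 // size_polyXn psz /= addnS.
congr _.+1; rewrite /nagdeg big_ord_recl expn0 muln1; congr (_ + _)%N.
Qed.

Lemma map_nagpol (S : comNzRingType) (psi : {rmorphism F -> S}) (x' : 'I_m -> S)
   (x0 : S) (p : calg F (lat K')) :
  (map_poly (evm psi x') (nagpol p)).[x0] =
  evm psi (fun i => if unlift ord0 i is Some j then x' j + x0 ^+ e j else x0) p.
Proof.
rewrite /nagpol rmorph_sum /= horner_sum; apply: eq_bigr => k _.
rewrite rmorphM /= map_polyC hornerM hornerC /= evmA; congr (_ * _).
rewrite /nagmon rmorphM /= map_polyXn hornerM hornerXn /mz big_ord_recl unlift_none.
congr (_ * _); rewrite rmorph_prod horner_prod; apply: eq_bigr => i _.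
rewrite rmorphXn /= horner_exp rmorphD /= map_polyXn map_polyC hornerD hornerXn hornerC /=.
by rewrite evmX mz_kone liftK addrC.
Qed.

End Nagata.

(** Induction on the number of variables. Without a nonzero relation modulo J any point will do;
    otherwise Nagata's substitution makes [z ord0] integral over the others, and [root_extension]
    supplies its value. *)
Lemma null_ord m (z : 'I_m -> A) : exists c : 'I_m -> Kb,
  forall p, J (evm phi z p) -> evm iota c p = 0.
Proof.
elim: m z => [|m IH] z.
  exists (fun=> 0) => p.
  have -> : p = (p@_0)%:A.
    apply/malgP => k; rewrite mcoeffZ -lX0 mcoeff_lX.
    have -> : k = 0 by apply/ffunP => -[].
    by rewrite eqxx mulr1.
  rewrite !evmA => Jp; have [->|p0] := eqVneq p@_0 0; first by rewrite rmorph0.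
  case: J1; rewrite -(rmorph1 phi) -(mulVf p0) rmorphM; exact: JM.
have [no|/existsNP[p /not_implyP[Jp /eqP p0]]] :=
    pselect (forall p, J (evm phi z p) -> p = 0).
  by exists (fun=> 0) => p /no ->; rewrite rmorph0.
(* Larger than every exponent of [p], so that distinct monomials of [p] get distinct degrees and
   exactly one is leading. *)
pose T := (\sum_(k <- msupp p) \sum_i k i).+1%N.
have kT k i : k \in msupp p -> (k i < T)%N.
  by move=> kp; rewrite /T ltnS (big_rem k) //= (bigD1 i) //= -addnA leq_addr.
pose z' (i : 'I_m) := z (lift ord0 i) - z ord0 ^+ (T ^ i.+1).
have [c' Hc'] := IH z'.
have [|k0 k0p Hk0] := @seq_argmax _ (msupp p : seq _) (@nagdeg m T).
  by apply/eqP => E; case/eqP: p0; rewrite [p]latE E big_nil.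
pose d := nagdeg T k0.
pose P := ((p@_k0)^-1%:A)%:P * nagpol T p.
have zE : (fun i => if unlift ord0 i is Some j then z' j + z ord0 ^+ (T ^ j.+1) else z ord0) =1 z.
  by move=> i; case: unliftP => [j ->|->] //; rewrite /z' subrK.
have JE q : J (map_poly (evm phi z') (nagpol T q)).[z ord0] <-> J (evm phi z q).
  rewrite map_nagpol (_ : evm _ _ q = evm phi z q) //; apply: eq_bigr => k _.
  by congr (_ * _); apply: eq_bigr => i _; rewrite zE.
have Hinv q : evm iota c' q != 0 -> exists q', evm iota c' q' * evm iota c' q = 1.
  move=> q0; have [r Hr] := alg_inverse (alg _) q0.
  exists (map_poly (in_alg _) r).[q].
  rewrite -horner_map /= -map_poly_comp -[RHS]Hr; congr (_.[_] * _).
  by apply: eq_map_poly => a /=; rewrite evmA.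
have T0 : (0 < T)%N by [].
have nd k : k \in msupp p -> k != k0 -> (nagdeg T k < d)%N.
  move=> kp kk0; rewrite ltn_neqAle Hk0 // andbT; apply: contra kk0 => /eqP E.
  apply/eqP/ffunP; apply: (@base_digits_inj _ T) => // i; exact: kT.
have sP : (size P <= d.+1)%N.
  apply/leq_sizeP => i di; rewrite /P coefCM coef_sum big1_seq ?mulr0 // => k /andP[_ kp].
  rewrite coefCM nth_default ?mulr0 // (proj2 (nagmon_monic k T0)).
  by apply: leq_trans di; rewrite ltnS Hk0.
have lP : evm iota c' P`_d = 1.
  rewrite /P coefCM coef_sum (bigD1_seq k0) ?fset_uniq //= big1_seq => [|k /andP[kk0 kp]].
    rewrite addr0 coefCM; have [/monicP + sz] := nagmon_monic k0 T0.
    rewrite lead_coefE sz /= -/d => ->; rewrite mulr1 -scalerAl mul1r scalerA mulVf ?mcoeff_neq0 //.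
    by rewrite scale1r rmorph1.
  by rewrite coefCM nth_default ?mulr0 // (proj2 (nagmon_monic k T0)) nd.
have JP : J (map_poly (evm phi z') P).[z ord0].
  by rewrite /P rmorphM hornerM; apply: JM; apply/JE.
have [c Hc] := root_extension JD JM Hc' Hinv sP lP JP.
exists (fun i => if unlift ord0 i is Some j then c' j + c ^+ (T ^ j.+1) else c) => q Jq.
by rewrite -map_nagpol; apply: Hc; apply/JE.
Qed.

Theorem nullstellensatz (I : finType) (z : I -> A) : exists c : I -> Kb,
  forall s : seq (F * (I -> nat)),
    J (\sum_(x <- s) phi x.1 * \prod_i z i ^+ x.2 i) ->
    \sum_(x <- s) iota x.1 * \prod_i c i ^+ x.2 i = 0.
Proof.
have [c Hc] := null_ord (fun j : 'I_#|I| => z (enum_val j)).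
exists (fun i => c (enum_rank i)) => s Js.
pose p : calg F (lat {ffun 'I_#|I| -> nat}) :=
  \sum_(x <- s) x.1 *: lX [ffun j => x.2 (enum_val j)].
have pE (S : comNzRingType) (psi : {rmorphism F -> S}) (x : 'I_#|I| -> S) :
    evm psi x p = \sum_(y <- s) psi y.1 * \prod_i x (enum_rank i) ^+ y.2 i.
  rewrite /p rmorph_sum; apply: eq_bigr => y _ /=; rewrite evmZ evmX; congr (_ * _).
  rewrite /mz (reindex (@enum_rank I)) /=; last first.
    by exists enum_val => j _; rewrite ?enum_rankK ?enum_valK.
  by apply: eq_bigr => i _; rewrite ffunE enum_rankK.
rewrite -pE; apply: Hc; rewrite pE; move: Js; congr J.
by apply: eq_bigr => y _; congr (_ * _); apply: eq_bigr => i _; rewrite enum_rankK.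
Qed.

End Nullstellensatz.

Section TorusNullstellensatz.
Variables (F : fieldType) (V : zmodType) (I : finType) (ev : I -> V).
Variable crd : V -> I -> int.
Hypothesis crdE : forall v, v = \sum_i ev i *~ crd v i.
Local Notation P := (calg F (lat V)).
Variables (J : P -> Prop) (Kb : closedFieldType) (iota : {rmorphism F -> Kb}).
Hypotheses (J0 : J 0) (JD : forall a b, J a -> J b -> J (a + b)).
Hypothesis JM : forall a b, J b -> J (a * b).
Hypothesis J1 : ~ J 1.
Hypothesis alg : forall c, integralOver iota c.

Let pexp (x : int) (s : bool) : nat :=
  match x, s with Posz m, true => m | Negz m, false => m.+1 | _, _ => 0%N end.

(** Each coordinate is doubled into a variable for the monomial and one for its inverse; the
    relation that their product is 1 passes to the values and makes them nonzero. *)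
Theorem torus_nullstellensatz : exists c : I -> Kb, (forall i, c i != 0) /\
  forall g, J g -> \sum_(v <- msupp g) iota g@_v * \prod_i c i ^ crd v i = 0.
Proof.
pose z (x : I * bool) : P := lX (if x.2 then ev x.1 else - ev x.1).
have [c Hc] := nullstellensatz (in_alg P) JD JM J1 alg z.
have pr (S : comNzRingType) (h : I * bool -> S) (k : I -> bool -> nat) :
    \prod_x h x ^+ k x.1 x.2 = \prod_i (h (i, true) ^+ k i true * h (i, false) ^+ k i false).
  transitivity (\prod_i \prod_s h (i, s) ^+ k i s).
    by rewrite pair_bigA; apply: eq_bigr => -[i s].
  by apply: eq_bigr => i _; rewrite big_bool.
have cc i : c (i, true) * c (i, false) = 1.
  have := Hc [:: (1, fun x => (x.1 == i) : nat); (-1, fun=> 0%N)].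
  have pr1 (S : comNzRingType) (h : I * bool -> S) :
      \prod_x h x ^+ (x.1 == i) = h (i, true) * h (i, false).
    rewrite (pr _ h (fun l _ => (l == i) : nat)) (bigD1 i) // big1 => [|l /negPf li].
      by rewrite /= eqxx !expr1 mulr1.
    by rewrite li mulr1.
  rewrite !big_cons !big_nil /= !pr1 (big1 _ _ (fun x : I * bool => z x ^+ 0)) //.
  rewrite (big1 _ _ (fun x : I * bool => c x ^+ 0)) //.
  have zz : z (i, true) * z (i, false) = 1 by rewrite /z /= lXM subrr lX0.
  have E1 : 1%:A * (z (i, true) * z (i, false)) + ((-1)%:A * 1 + 0) = 0 :> P.
    by rewrite zz !mulr1 addr0 scale1r scaleN1r subrr.
  rewrite E1 rmorph1 mul1r rmorphN1 mulr1 addr0.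
  by move=> /(_ J0)/eqP; rewrite subr_eq0 => /eqP.
have c0 i : c (i, true) != 0.
  by apply/eqP => E; have /eqP := cc i; rewrite E mul0r eq_sym oner_eq0.
have cV i : c (i, false) = (c (i, true))^-1.
  by apply: (mulfI (c0 i)); rewrite cc divff.
exists (fun i => c (i, true)); split=> // g Jg.
have := Hc [seq (g@_v, fun x => pexp (crd v x.1) x.2) | v <- msupp g].
rewrite !big_map /= => H; rewrite -[RHS]H.
  apply: eq_bigr => v _; congr (_ * _); rewrite (pr _ c (fun i s => pexp (crd v i) s)).
  apply: eq_bigr => i _; case: (crd v i) => k /=; first by rewrite expr0 mulr1.
  by rewrite expr0 mul1r cV exprVn NegzE exprnN.
move: Jg; congr J; rewrite [LHS]latE; apply: eq_bigr => v _.
rewrite mulr_algl; congr (_ *: _); rewrite (pr _ z (fun i s => pexp (crd v i) s)).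
rewrite {1}[v : V]crdE -lX_prod; apply: eq_bigr => i _; rewrite /z /= !lXX lXM; congr lX.
case: (crd v i) => k /=; first by rewrite mulr0n addr0 pmulrn.
by rewrite mulr0n add0r NegzE mulrNz -pmulrn mulNrn.
Qed.

End TorusNullstellensatz.

Section AlgebraSums.
Variables (F : fieldType) (A : comAlgType F).

Lemma linear_sum_fun (pr : A -> A) : linear pr ->
  forall J (r : seq J) (Q : pred J) (G : J -> A),
  pr (\sum_(j <- r | Q j) G j) = \sum_(j <- r | Q j) pr (G j).
Proof.
move=> pr_lin J r Q G.
pose prL : {linear A -> A} := HB.pack pr (GRing.isLinear.Build _ _ _ _ pr pr_lin).
exact: (raddf_sum prL).
Qed.

Lemma linear_mul_sum (pr : A -> A) T (r : seq T) (Q : pred T) (c : T -> F) (X : T -> A) :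
  linear pr -> (forall t a, Q t -> pr (a * X t) = pr a * X t) -> forall a,
  pr (a * \sum_(t <- r | Q t) c t *: X t) = pr a * \sum_(t <- r | Q t) c t *: X t.
Proof.
move=> pr_lin prM a.
pose prL : {linear A -> A} := HB.pack pr (GRing.isLinear.Build _ _ _ _ pr pr_lin).
rewrite !mulr_sumr (linear_sum_fun pr_lin); apply: eq_bigr => t Qt.
have prZ c x : pr (c *: x) = c *: pr x := linearZ_LR prL c x.
by rewrite -!scalerAr prZ prM.
Qed.

Lemma expS_unit_sum (J : finType) (p g : J -> A) (x xK : A) K :
  1 = \sum_j p j * g j -> x ^+ K = xK ->
  x ^+ K.+1 = \sum_j (p j * xK) * (x * g j).
Proof.
move=> E <-; rewrite exprSr -[LHS]mulr1 {1}E mulr_sumr; apply: eq_bigr => j _.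
by ring.
Qed.

End AlgebraSums.

(** * The radical of the ideal generated in a cone algebra *)

Section Radical.
Variables (F : fieldType) (V : zmodType) (I : finType) (lam : I -> V -> int).
Hypothesis lamD : forall i v w, lam i (v + w) = lam i v + lam i w.
Local Notation P := (calg F (lat V)).
Local Notation inA := (@inA F V I lam).
Variables (N : nat) (y : 'I_N -> P).
Hypothesis Ay : forall i, inA (y i).
Local Notation U := (sp (mulA lam y)).

Lemma U_inA g : U g -> inA g.
Proof.
move=> /(_ [set g | inA g]); apply; first exact: inA_sub.
by move=> _ [i [h [Ah ->]]]; apply: inA_M.
Qed.

Lemma U_mul g h : inA g -> U h -> U (g * h).
Proof.
move=> Ag; apply: sp_mulr => _ [i [h' [Ah ->]]]; apply: sp_sub; exists i, (g * h').
by rewrite mulrCA; split=> //; exact: inA_M.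
Qed.

Definition rad g := inA g /\ exists m, U (g ^+ m).

Lemma inA_exp g m : inA g -> inA (g ^+ m).
Proof.
move=> Ag; elim: m => [|m IH]; last by rewrite exprS; exact: inA_M.
by rewrite expr0; apply: inA_X; exact: conem0.
Qed.

Lemma rad_sub g : U g -> rad g.
Proof. by move=> Ug; split; [exact: U_inA|exists 1%N; rewrite expr1]. Qed.

Lemma rad_mul g h : inA g -> rad h -> rad (g * h).
Proof.
move=> Ag [Ah [m Uh]]; split; first exact: inA_M.
by exists m; rewrite exprMn; apply: U_mul => //; exact: inA_exp.
Qed.

Lemma inA_add g h : inA g -> inA h -> inA (g + h).
Proof. by move=> Ag Ah; rewrite -[g]scale1r; apply: inA_lin. Qed.

Lemma rad_add g h : rad g -> rad h -> rad (g + h).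
Proof.
move=> [Ag [m Um]] [Ah [k Uk]]; split; first exact: inA_add.
exists (m + k)%N; rewrite exprDn; apply: sp_sum => i _.
rewrite -scaler_nat; apply: spZ; have [ki|ik] := leqP k i.
  rewrite -[X in h ^+ X](subnK ki) exprD mulrA; apply: U_mul => //.
  by apply: (inA_M lamD); exact: inA_exp.
have le : (m <= m + k - i)%N by move: ik; lia.
rewrite -(subnK le) exprD mulrAC; apply: U_mul => //.
by apply: (inA_M lamD); exact: inA_exp.
Qed.

Lemma rad0 : rad 0.
Proof. by apply: rad_sub; exact: sp0. Qed.

Lemma rad_sum J (s : seq J) (Q : pred J) (G : J -> P) :
  (forall j, Q j -> rad (G j)) -> rad (\sum_(j <- s | Q j) G j).
Proof.
move=> H; elim/big_rec: _ => [|j x Qj Hx]; first exact: rad0.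
exact: rad_add (H j Qj) Hx.
Qed.

Lemma rad_scale c g : rad g -> rad (c *: g).
Proof.
move=> rg; rewrite -[g]mul1r scalerAl; apply: rad_mul => //.
by apply: inA_Z; apply: inA_X; exact: conem0.
Qed.

Lemma rad_exp g m : inA g -> rad (g ^+ m) -> rad g.
Proof. by move=> Ag [_ [k]]; rewrite -exprM => H; split=> //; exists (m * k)%N. Qed.

End Radical.

(** * The lattice cone over the polytope, and nilpotence from nondegeneracy *)

Section ConeLattice.
Variables (R : realType) (F : finFieldType) (n : nat) (f : {malg F['rV[int]_n]}).
Local Notation l := (msupp f : seq _).
Local Notation D := (Delta R f).
Local Notation w := (weight D).
Variable s : seq ('rV[int]_n * int).
Hypothesis Hs : forall (u : 'rV[R]_n) k, hceil l u k <-> sat s u k.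

Lemma expsP x : exps R f x <-> exists2 mu, mu \in l & x = toR R mu.
Proof. by split=> [[mu mf <-]|[mu mf ->]]; exists mu. Qed.

Local Notation V := ('rV[int]_n * int)%type.
Implicit Types (v : V).

(** A common denominator of all weights: a tight form solves for the weight with denominator
    [a.2]. *)
Definition wden : nat := \prod_(a <- s | 0 < a.2) `|a.2|%N.

Lemma Dw_gt0 : (0 < wden)%N.
Proof. by rewrite /wden; elim/big_rec: _ => // a x; rewrite muln_gt0 absz_gt0 => /gt_eqF->. Qed.

Lemma DwR_gt0 : 0 < wden%:R :> R. Proof. by rewrite ltr0n Dw_gt0. Qed.

(** Heights are counted in units of 1/[wden]; the form has been multiplied through by [wden] to stay
    integral. *)
Definition lam (i : 'I_(size s)) v : int :=
  wden%:Z * (\sum_j (tnth (in_tuple s) i).1 0 j * v.1 0 j) + (tnth (in_tuple s) i).2 * v.2.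

Lemma lamD i v w' : lam i (v + w') = lam i v + lam i w'.
Proof.
rewrite /lam /= (_ : \sum_j _ = \sum_j (tnth (in_tuple s) i).1 0 j * v.1 0 j +
  \sum_j (tnth (in_tuple s) i).1 0 j * w'.1 0 j); first by ring.
by rewrite -big_split; apply: eq_bigr => j _; rewrite mxE mulrDr.
Qed.

Definition vdeg v : int := v.2.

Lemma vdegD v w' : vdeg (v + w') = vdeg v + vdeg w'. Proof. by []. Qed.

Lemma lam_fev i v : (lam i v)%:~R =
  wden%:R * fev (tnth (in_tuple s) i) (toR R v.1) (v.2%:~R / wden%:R).
Proof.
set a := tnth _ i; rewrite /lam -/a intrD !intrM /fev mulrDr; congr (_ + _).
  congr (_ * _); rewrite /dot rmorph_sum; apply: eq_bigr => j _.
  by rewrite /= !mxE intrM.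
by rewrite mulrCA [wden%:R * _]mulrC divfK // gt_eqF ?DwR_gt0.
Qed.

Local Notation M := (conem lam).

Lemma conemP v : reflect (sat s (toR R v.1) (v.2%:~R / wden%:R)) (M v).
Proof.
have key i : (0 <= lam i v) = (0 <= fev (tnth (in_tuple s) i) (toR R v.1) (v.2%:~R / wden%:R)).
  by rewrite -(ler0z R) lam_fev pmulr_rge0 // DwR_gt0.
apply: (iffP forallP) => [H a /seq_tnthP[i ->]|H i]; first by rewrite -key.
by rewrite key; apply: H; exact: mem_tnth.
Qed.

Lemma conem_deg_ge0 v : M v -> 0 <= vdeg v.
Proof.
move=> /conemP/(sat_ge0 Hs expsP (fset_uniq _)).
by rewrite pmulr_lge0 ?invr_gt0 ?DwR_gt0 // ler0z.
Qed.

Lemma toR_eq0 (mu : 'rV[int]_n) : toR R mu = 0 -> mu = 0.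
Proof.
move=> /rowP H; apply/rowP => i; have := H i; rewrite !mxE => /eqP.
by rewrite intr_eq0 => /eqP.
Qed.

Lemma conem_deg0 v : M v -> vdeg v = 0 -> v = 0.
Proof.
case: v => mu k /conemP /= H; rewrite /vdeg /= => k0; subst k.
move: H; rewrite mul0r => /(sat_hullP Hs expsP (fset_uniq _))[_ [x _]].
by rewrite scale0r => /toR_eq0->.
Qed.

Lemma conem_pointed v : M v -> M (- v) -> v = 0.
Proof.
move=> Mv Mv'; apply: conem_deg0 => //; apply/eqP; rewrite eq_le.
by rewrite conem_deg_ge0 // -oppr_ge0 (conem_deg_ge0 Mv').
Qed.

Lemma V_torsion_free v q : (0 < q)%N -> v *+ q = 0 -> v = 0.
Proof.
have E1 m : (v *+ m).1 = v.1 *+ m by elim: m => [|m IH]; rewrite ?mulr0n // !mulrS /= IH.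
have E2 m : (v *+ m).2 = v.2 *+ m by elim: m => [|m IH]; rewrite ?mulr0n // !mulrS /= IH.
move=> q0 H; have := congr1 fst H; have := congr1 snd H; rewrite E1 E2 /=.
move=> /eqP; rewrite mulrn_eq0 -leqn0 leqNgt q0 /= => /eqP v2 H1.
have v1 : v.1 = 0.
  apply/rowP => i; have /rowP/(_ i) := H1; rewrite mulmxnE !mxE => /eqP.
  by rewrite mulrn_eq0 -leqn0 leqNgt q0 /= => /eqP.
by case: v v1 v2 {E1 E2 H H1} => a b /= -> ->.
Qed.

Definition Kb : nat := \sum_(a <- l) \sum_i absz (a 0%R i).

Lemma conem_bound v i : M v -> `|v.1 0 i| <= Kb%:Z * v.2.
Proof.
move=> Mv; have v2 := conem_deg_ge0 Mv; move/conemP: Mv => /Hs[c [c0 vE ck]].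
rewrite -(ler_int R) intr_norm intrM; have /rowP/(_ i) := vE.
rewrite mxE summxE => ->; apply: le_trans (ler_norm_sum _ _ _) _.
apply: (@le_trans _ _ (\sum_(a <- l) c a * Kb%:R)).
  rewrite !big_seq; apply: ler_sum => a al; rewrite !mxE normrM ger0_norm //.
  rewrite ler_wpM2l // -intr_norm -abszE -[leRHS]/(Kb%:Z%:~R) ler_int lez_nat /Kb.
  rewrite (big_rem a) //= (bigD1 i) //= -addnA; exact: leq_addr.
rewrite -mulr_suml mulrC ler_wpM2l ?ler0n //; apply: le_trans ck _.
rewrite ler_pdivrMr ?DwR_gt0 // ler_peMr ?ler0z //.
by rewrite ler1n Dw_gt0.
Qed.

Definition ibox (T : nat) : seq 'rV[int]_n :=
  [seq \row_i ((x i : nat)%:Z - T%:Z) | x : {ffun 'I_n -> 'I_(2 * T).+1}].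

Lemma mem_ibox T (mu : 'rV[int]_n) : (forall i, `|mu 0 i| <= T%:Z) -> mu \in ibox T.
Proof.
move=> H; apply/mapP.
have lt i : (`|(mu 0 i + T%:Z)%R| < (2 * T).+1)%N by have := H i; lia.
exists [ffun i => Ordinal (lt i)]; first by rewrite mem_enum.
apply/rowP => i; rewrite !mxE ffunE /=; have := H i; lia.
Qed.

Definition vpts (t : nat) : seq V :=
  [seq v <- undup [seq (mu, k%:Z) | mu <- ibox (Kb * t), k <- iota 0 t.+1] | M v].

Lemma vpts_uniq t : uniq (vpts t).
Proof. by rewrite filter_uniq ?undup_uniq. Qed.

Lemma mem_vpts t v : (v \in vpts t) = M v && (vdeg v <= t%:Z).
Proof.
rewrite mem_filter mem_undup; case Mv: (M v) => //; rewrite !andTb; apply/idP/idP.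
  by case/allpairsP => p [_ + ->]; rewrite mem_iota /vdeg /= lez_nat; lia.
move=> vt; have v0 := conem_deg_ge0 Mv; apply/allpairsP.
exists (v.1, `|v.2|%N); split.
- apply: mem_ibox => i; apply: le_trans (conem_bound i Mv) _.
  by rewrite PoszM ler_wpM2l.
- by rewrite mem_iota /=; move: vt v0; rewrite /vdeg; lia.
- by case: v v0 {vt Mv} => a b; rewrite /vdeg /= => b0; rewrite gez0_abs.
Qed.

Definition Elam : nat := (\sum_(a <- s) (wden * (\sum_j absz (a.1 0%R j) * Kb) + absz a.2))%N.

Lemma lam_bound i v : M v -> lam i v <= Elam%:Z * vdeg v.
Proof.
move=> Mv; have v2 := conem_deg_ge0 Mv; rewrite /lam; set a := tnth _ i.
apply: (@le_trans _ _ ((wden * (\sum_j absz (a.1 0%R j) * Kb) + absz a.2)%N%:Z * vdeg v)); last first.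
  rewrite ler_wpM2r // lez_nat /Elam (big_rem a) ?mem_tnth //=; exact: leq_addr.
rewrite PoszD PoszM mulrDl -mulrA lerD //; last first.
  by rewrite ler_wpM2r // abszE; exact: ler_norm.
rewrite ler_wpM2l // (big_morph Posz PoszD (erefl _)) mulr_suml.
apply: ler_sum => j _; rewrite PoszM -mulrA; apply: le_trans (ler_norm _) _.
by rewrite normrM abszE ler_wpM2l // conem_bound.
Qed.

(** [vT] is the origin raised by one unit; [va a] places [a] at height [wden], that is, at weight
    1. *)
Definition vT : V := (0, 1).
Definition va (a : 'rV[int]_n) : V := (a, wden%:Z).

Lemma conem_T : M vT.
Proof.
apply/conemP => a as_.
rewrite /vT /= toR0; apply: ((proj2 (sat_hullP Hs expsP (fset_uniq _) _ _)) _ a as_).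
split; first by rewrite divr_ge0 // ?ler0n.
by exists 0; [exact: hull0_0|rewrite scaler0].
Qed.

Lemma conem_a a : a \in l -> M (va a).
Proof.
move=> al; apply/conemP => /=; rewrite divff ?gt_eqF ?DwR_gt0 //.
apply/(sat_hullP Hs expsP (fset_uniq _)); split=> //; exists (toR R a); rewrite ?scale1r //.
by apply: conv_hull_sub; right; apply/expsP; exists a.
Qed.

Local Notation P := (calg F (lat V)).

Definition gens (i : 'I_n.+1) : P :=
  if unlift ord0 i is Some j then \sum_(a <- l) (f@_a * (a 0 j)%:~R) *: lX (va a)
  else lX vT.

Definition gdeg (i : 'I_n.+1) : nat := if unlift ord0 i is Some j then wden else 1%N.

Lemma dd_gt0 i : (0 < gdeg i)%N.
Proof. by rewrite /gdeg; case: unliftP => // *; exact: Dw_gt0. Qed.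

Lemma HA_yy i : HA lam vdeg (gdeg i) (gens i).
Proof.
rewrite /gdeg /gens; case: unliftP => [j _|_]; last by apply: HA_X; [exact: conem_T|].
suff : [set g : P | HA lam vdeg wden g] (\sum_(a <- l) (f@_a * (a 0 j)%:~R) *: lX (va a)) by [].
have sub : submodp [set g : P | HA lam vdeg wden g].
  split=> [v|c g h Hg Hh v]; first by rewrite msupp0.
  move=> /(fsubsetP (msuppD_le _ _)); rewrite inE => /orP[|/Hh//].
  by move=> /(fsubsetP (msuppZ_le _ _))/Hg.
have : sp [set g : P | HA lam vdeg wden g] (\sum_(a <- l) (f@_a * (a 0 j)%:~R) *: lX (va a)).
  rewrite big_seq; apply: sp_sum => a al; apply: spZ; apply: sp_sub.
  by apply: HA_X; [exact: conem_a|].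
by apply.
Qed.

Lemma inA_yy i : inA lam (gens i).
Proof. exact: HA_inA (@HA_yy i). Qed.

Definition vcrd v (i : 'I_n.+1) : int := if unlift ord0 i is Some j then v.1 0 j else v.2.
Definition vev (i : 'I_n.+1) : V := if unlift ord0 i is Some j then (delta_mx 0 j, 0) else (0, 1).

Lemma vcrdE v : v = \sum_i vev i *~ vcrd v i.
Proof.
have E1 (x : V) (m : int) : (x *~ m) = (x.1 *~ m, x.2 *~ m).
  have E (k : nat) : x *+ k = (x.1 *+ k, x.2 *+ k).
    by elim: k => [|k IH]; rewrite ?mulr0n // !mulrS IH.
  by case: m => k; rewrite -?pmulrn ?NegzE ?mulrNz -?pmulrn E.
rewrite big_ord_recl /vev /vcrd unlift_none; under eq_bigr do rewrite liftK E1 /=.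
rewrite E1 /= mul0rz -[v.2]intz -[1 *~ _]/(_%:~R) intz.
have -> : \sum_i ((delta_mx 0 i : 'rV[int]_n) *~ v.1 0 i, 0 *~ v.1 0 i) = (v.1, 0) :> V.
  rewrite [in RHS](row_sum_delta v.1).
  elim/big_rec2: _ => // i x1 x2 _ ->; rewrite mul0rz; congr pair => /=.
    by congr (_ + _); rewrite -scaler_int intz.
rewrite intz -[RHS]/((0 + v.1, v.2 + 0)) add0r addr0.
by case: (v).
Qed.

Section Nondegenerate.
Variables (Fbar : closedFieldType) (iota : {rmorphism F -> Fbar}).
Hypothesis alg : integralRange iota.
Hypothesis f_nondeg : laurent_nondegenerate R iota f.

(** The forms tight at [v] determine the face through [v]; [Jb] selects the exponents of f on this
    face, and [gl] is the part of the lifted derivative carried by it. *)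
Let tight v (i : 'I_(size s)) := lam i v == 0.
Let Jb v a := [forall i, tight v i ==> tight (va a) i].
Let gl v (j : 'I_n) : P := \sum_(a <- l | Jb v a) (f@_a * (a 0 j)%:~R) *: lX (va a).

Lemma laurent_eval_face (sg : set 'rV[R]_n) (j : 'I_n) (x : 'I_n -> Fbar) :
  laurent_eval iota (xdx id j (restrict_to sg f)) x =
  \sum_(a <- l | `[< sg (toR R a) >]) iota (f@_a * (a 0 j)%:~R) * \prod_i x i ^ a 0 i.
Proof.
set g := xdx _ _ _; have gE a : a \in msupp f ->
    g@_a = if `[< sg (toR R a) >] then f@_a * (a 0 j)%:~R else 0.
  move=> af; rewrite /g /xdx mcoeffE; have rE : (restrict_to sg f)@_a =
      if `[< sg (toR R a) >] then f@_a else 0 by rewrite /restrict_to mcoeffE af.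
  case: ifPn => [_|ns]; rewrite ?rE; first by case: ifP => _; rewrite ?mulr0 // mulrC.
  by move: ns; rewrite -mcoeff_eq0 rE; case: ifP => // _ /eqP ->; rewrite mul0r.
have sub : (msupp g `<=` msupp f)%fset.
  apply/fsubsetP => a; rewrite -!mcoeff_neq0; apply: contraNneq => fa.
  rewrite /g /xdx mcoeffE /restrict_to mcoeffE; case: ifP => // _.
  by rewrite fa; case: ifP; rewrite ?if_same ?mulr0.
rewrite /laurent_eval (big_fset_incl _ sub) /=; last first.
  by move=> a _ /mcoeff_outdom->; rewrite rmorph0 mul0r.
rewrite big_seq [RHS]big_mkcond [RHS]big_seq; apply: eq_bigr => a af.
by rewrite gE //; case: ifP => // _; rewrite rmorph0 mul0r.
Qed.

(** Otherwise the [gl v j] have a common zero in the torus of dimension n + 1. The height coordinate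
    contributes one common nonzero factor, and the other coordinates form a zero excluded by
    nondegeneracy. The form tight at [v] but not at [vT] is what keeps the face away from the
    origin. *)
Lemma face_unit v : M v -> v != 0 -> (exists2 i, tight v i & lam i vT != 0) ->
  exists h : 'I_n -> P, 1 = \sum_j h j * gl v j.
Proof.
move=> Mv v0 [i0 ti0 li0]; apply: contrapT => no.
pose J (g : P) := exists h : 'I_n -> P, g = \sum_j h j * gl v j.
have J0 : J 0 by exists (fun=> 0); rewrite big1 // => j _; rewrite mul0r.
have JD a b : J a -> J b -> J (a + b).
  move=> [h1 ->] [h2 ->]; exists (fun j => h1 j + h2 j).
  by rewrite -big_split; apply: eq_bigr => j _; rewrite mulrDl.
have JM a b : J b -> J (a * b).
  move=> [h1 ->]; exists (fun j => a * h1 j).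
  by rewrite mulr_sumr; apply: eq_bigr => j _; rewrite mulrA.
have [c [c0 Hc]] := torus_nullstellensatz vcrdE J0 JD JM no alg.
(* The sum of the tight forms supports the face: as all are nonnegative on the polytope, their sum
   vanishes only where each does. *)
pose al : 'rV[R]_n := \sum_(i | tight v i) toR R (tnth (in_tuple s) i).1.
pose be : R := \sum_(i | tight v i) (tnth (in_tuple s) i).2%:~R.
have dN (b : 'rV[R]_n) x : dot (- b) x = - dot b x.
  by rewrite /dot -sumrN; apply: eq_bigr => i _; rewrite mxE mulNr.
have fevS x : be - dot (- al) x = \sum_(i | tight v i) fev (tnth (in_tuple s) i) x 1.
  rewrite dN opprK addrC big_split /= /be; congr (_ + _); last first.
    by apply: eq_bigr => i _; rewrite mulr1.
  rewrite /dot exchange_big /=; apply: eq_bigr => i _.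
  by rewrite /al summxE mulr_suml.
pose sg := [set x | D x /\ dot (- al) x = be].
have fge x i : D x -> 0 <= fev (tnth (in_tuple s) i) x 1.
  by move=> /(hull0_hceil Hs expsP (fset_uniq _))/Hs; apply; exact: mem_tnth.
have sgP x : D x -> sg x <-> forall i, tight v i -> fev (tnth (in_tuple s) i) x 1 = 0.
  move=> Dx; have fS := fevS x; split=> [[_ xE] i ti|H].
    move: fS; rewrite xE subrr => /esym/eqP.
    by rewrite psumr_eq0 => [/allP/(_ i (mem_index_enum _))/implyP/(_ ti)/eqP|k _]; rewrite ?fge.
  split=> //; apply/eqP; rewrite eq_sym -subr_eq0 fS big1 // => i ti; exact: H.
have lamT i : lam i vT = (tnth (in_tuple s) i).2.
  by rewrite /lam /= big1 => [|j _]; rewrite ?mxE ?mulr0 // mulr1 add0r.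
have be0 : 0 < be.
  have a2 i : 0 <= (tnth (in_tuple s) i).2%:~R :> R.
    by rewrite ler0z -lamT; have /forallP := conem_T; apply.
  rewrite /be (bigD1 i0) //= ltr_pwDl ?sumr_ge0 // lt_neqAle a2 andbT eq_sym intr_eq0.
  by rewrite -lamT.
have v2 : 0 < vdeg v.
  rewrite lt_neqAle conem_deg_ge0 // andbT eq_sym.
  by apply: contra v0 => /eqP/(conem_deg0 Mv)->.
have [k0 [x Dx vE]] := (proj1 (sat_hullP Hs expsP (fset_uniq _) _ _)) (elimT (conemP v) Mv).
have k1 : v.2%:~R / wden%:R != 0 :> R.
  by rewrite mulf_neq0 ?intr_eq0 ?gt_eqF // ?invr_gt0 ?DwR_gt0.
have sx : sg x.
  apply/(sgP _ Dx) => i; rewrite /tight -(intr_eq0 R) lam_fev mulf_eq0 (gt_eqF DwR_gt0) /=.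
  rewrite vE -[X in fev _ _ X]mulr1 fevZ mulf_eq0 (negPf k1) /= => /eqP.
  by [].
have cf : closed_face D sg.
  split; first by exists x.
  exists (- al), be; split=> // z Dz; rewrite -subr_ge0 fevS.
  by apply: sumr_ge0 => i _; exact: fge.
have s0 : ~ sg 0 by move=> [_]; rewrite dot0 => /esym/eqP; rewrite gt_eqF.
apply: (f_nondeg cf s0); exists (fun j => c (lift ord0 j)); split=> // j.
rewrite laurent_eval_face.
have JbE a : a \in l -> `[< sg (toR R a) >] = Jb v a.
  move=> af; have Da : D (toR R a).
    by apply: conv_hull_sub; right; apply/expsP; exists a.
  have E i : tight (va a) i <-> fev (tnth (in_tuple s) i) (toR R a) 1 = 0.
    rewrite /tight -(intr_eq0 R) lam_fev mulf_eq0 (gt_eqF DwR_gt0) /=.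
    by rewrite -pmulrn divff ?(gt_eqF DwR_gt0) //; split=> /eqP.
  apply/asboolP/forallP => [/(sgP _ Da) H i|H].
    by apply/implyP => /H/E.
  by apply/(sgP _ Da) => i ti; apply/E; have /implyP := H i; apply.
rewrite big_seq_cond (eq_bigl (fun a => (a \in l) && Jb v a)); last first.
  by move=> a; case af: (a \in msupp f) => //=; rewrite JbE.
rewrite -big_seq_cond.
pose chi (u : V) := \prod_i c i ^ vcrd u i.
have chiE a : chi (va a) = c ord0 ^ wden%:Z * \prod_i c (lift ord0 i) ^ a 0 i.
  rewrite /chi big_ord_recl /vcrd unlift_none; congr (_ * _).
  by apply: eq_bigr => i _; rewrite liftK.
have Jg : J (gl v j).
  exists (fun k => (k == j)%:R); rewrite (bigD1 j) //= eqxx mul1r big1 ?addr0 //.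
  by move=> k /negPf->; rewrite mul0r.
have := Hc _ Jg; rewrite -[LHS]/(rext iota chi (gl v j)).
have -> : rext iota chi (gl v j) =
    \sum_(a <- l | Jb v a) iota (f@_a * (a 0 j)%:~R) * chi (va a).
  rewrite /gl; elim/big_rec2: _ => [|a z1 z2 _ IH]; first by rewrite rext0.
  by rewrite rext_lin rextX IH.
have -> : \sum_(a <- l | Jb v a) iota (f@_a * (a 0 j)%:~R) * chi (va a) =
    c ord0 ^ wden%:Z *
    \sum_(a <- l | Jb v a) iota (f@_a * (a 0 j)%:~R) * \prod_i c (lift ord0 i) ^ a 0 i.
  by rewrite mulr_sumr; apply: eq_bigr => a _; rewrite chiE mulrCA.
move=> /eqP; rewrite mulf_eq0 expfz_eq0 (negPf (c0 _)) andbF /=.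
by move=> /eqP.
Qed.

(** Induction on the number of forms tight at [v]. If the face contains the origin, a power of
    [lX v] is divisible by T. Otherwise [face_unit] writes 1 by the [gl v j]; modulo the lifted
    derivatives, [lX v * gl v j] involves only exponents of f off the face, which lead to monomials
    with fewer tight forms. *)
Lemma lX_rad v : M v -> v != 0 -> rad lam gens (lX v).
Proof.
have [m] := ubnP #|[pred i | tight v i]|; elim: m v => // m IH v; rewrite ltnS => cm Mv v0.
have Av : inA lam (lX v : P) by exact: inA_X.
have [nt|/existsNP[i0 /not_implyP[ti0 /eqP li0]]] :=
    pselect (forall i, tight v i -> lam i vT = 0).
  (* Forms not tight at [v] are at least 1 there, so [K] copies of [v] pay for one [vT]; tight forms
     vanish at [vT] by assumption. *)
  pose K := (\sum_i absz (lam i vT))%N.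
  have MK : M (v *+ K - vT).
    have lamN i u : lam i (- u) = - lam i u.
      by apply/eqP; rewrite -addr_eq0 -lamD addNr (lam0 lamD).
    apply/forallP => i; rewrite lamD (lamMn lamD) lamN subr_ge0.
    have [/eqP ti|nti] := boolP (tight v i); first by rewrite nt ?ti ?mul0rn // /tight ti.
    have l1 : 1 <= lam i v.
      by move/forallP: Mv => /(_ i); rewrite le_eqVlt eq_sym -/(tight v i) (negPf nti) gtz0_ge1.
    apply: (@le_trans _ _ K%:Z); last by rewrite -[K%:Z]intz -pmulrn lerMn2r l1 orbT.
    apply: le_trans (ler_norm _) _; rewrite -abszE lez_nat /K (bigD1 i) //=.
    exact: leq_addr.
  split=> //; exists K; rewrite lXX -[v *+ K](subrK vT) addrC -lXM.
  apply: sp_sub; exists ord0, (lX (v *+ K - vT)); split; first exact: inA_X.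
  by rewrite /gens unlift_none.
have [h hE] := face_unit Mv v0 (ex_intro2 _ _ i0 ti0 li0).
pose L (u : V) := [forall i, tight v i ==> tight u i].
(* The coefficients [h] may have exponents anywhere in the lattice. Keeping those on which the tight
   forms vanish is linear over the group algebra of the face, so the identity survives. *)
pose pr : P -> P := lext (fun u : V => if L u then lX u else 0 : P).
have pr_lin : linear pr by exact: lext_is_linear.
have prX u : pr (lX u) = if L u then lX u else 0 by rewrite /pr lextU scale1r.
have LD u u' : L u' -> L (u + u') = L u.
  move=> /forallP Lu'; apply: eq_forallb => i; case ti: (tight v i) => //=.
  have /implyP/(_ ti)/eqP l' := Lu' i; by rewrite /tight lamD l' addr0.
have pr0 : pr 0 = 0 by rewrite /pr /lext msupp0 big_seq_fset0.
have prS g u : u \in msupp (pr g) -> L u.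
  move=> /msupp_lext[u' _]; case: ifP => [Lu'|_]; last by rewrite msupp0.
  by rewrite msupp_lX => /eqP->.
clearbody pr.
have prM (a : P) u : L u -> pr (a * lX u) = pr a * lX u.
  move=> Lu; pattern a; apply: lat_ind => [|c0 g1 g2 H1 H2|w' _].
  - by rewrite mul0r pr0 mul0r.
  - rewrite mulLl pr_lin pr_lin mulLl.
    exact: (f_equal2 (fun x1 x2 : P => c0 *: x1 + x2) H1 H2).
  have E1 := prX ((w' : V) + u); rewrite (LD _ _ Lu) in E1; have E2 := prX w'.
  apply: etrans (congr1 pr (@lXM F _ w' u)) _; apply: etrans E1 _.
  apply: etrans _ (congr1 (fun z : P => z * lX u) (esym E2)).
  by case: (L w'); [exact: esym (@lXM F _ w' u)|exact: esym (mul0r _)].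
have prsum := linear_sum_fun pr_lin.
have prG a j : pr (a * gl v j) = pr a * gl v j.
  apply: (@linear_mul_sum F P pr _ l (Jb v) (fun b => f@_b * (b 0 j)%:~R)
    (fun b => lX (va b)) pr_lin) => b z Jbb; exact: prM.
have hE' : 1 = \sum_j pr (h j) * gl v j.
  have <- : pr 1 = 1.
    rewrite -lX0 prX; case: ifP => // /negP[]; apply/forallP => i.
    by rewrite /tight (lam0 lamD) eqxx implybT.
  by rewrite {1}hE prsum; apply: eq_bigr => j _; exact: prG.
(* Large enough for [lX (v *+ K)] to bring all projected coefficients into the cone. *)
pose K := (\sum_j \sum_(u <- msupp (pr (h j))) \sum_i absz (lam i u))%N.
have AK j : inA lam (pr (h j) * lX (v *+ K)).
  move=> u /msupp_latM[u1 [u2 [u1h + ->]]]; rewrite msupp_lX => /eqP->.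
  have Lu1 : L u1 by exact: prS u1h.
  apply/forallP => i; rewrite lamD (lamMn lamD).
  have [ti|nti] := boolP (tight v i).
    by have /forallP/(_ i)/implyP/(_ ti)/eqP-> := Lu1; rewrite (eqP ti) mul0rn.
  have l1 : 1 <= lam i v.
    by move/forallP: Mv => /(_ i); rewrite le_eqVlt eq_sym -/(tight v i) (negPf nti) gtz0_ge1.
  have l2 : K%:Z <= lam i v *+ K by rewrite -{1}[K%:Z]intz -pmulrn lerMn2r l1 orbT.
  have l3 : `|lam i u1| <= K%:Z.
    rewrite -abszE lez_nat /K (bigD1 j) //= (big_rem u1) //= (bigD1 i) //= -!addnA.
    exact: leq_addr.
  by move: l2 l3; lia.
have Hva j : rad lam gens (lX v * gl v j).
  have glE : gl v j = gens (lift ord0 j) -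
      \sum_(a <- l | ~~ Jb v a) (f@_a * (a 0 j)%:~R) *: lX (va a).
    by rewrite /gens liftK [X in _ = X - _](bigID (Jb v)) /= addrK.
  rewrite glE mulrBr; apply: (rad_add lamD).
    apply: rad_sub; [exact: lamD|exact: inA_yy|].
    by apply: sp_sub; exists (lift ord0 j), (lX v); rewrite mulrC.
  rewrite -scaleN1r; apply: (rad_scale lamD).
  rewrite mulr_sumr big_seq_cond; apply: (rad_sum lamD); first exact: inA_yy.
  move=> a /andP[al nJ]; rewrite -scalerAr; apply: (rad_scale lamD).
  have Ma := conem_a al; rewrite lXM; apply: IH.
  - apply: leq_trans cm; apply: proper_card; apply/properP; split.
      apply/fintype.subsetP => i; rewrite !inE /tight lamD.
      move/forallP: Mv => /(_ i) l1; move/forallP: Ma => /(_ i) l2.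
      by rewrite paddr_eq0 // => /andP[].
    move: nJ; rewrite negb_forall => /existsP[i]; rewrite negb_imply => /andP[ti nti].
    exists i; rewrite !inE // /tight lamD (eqP ti) add0r //.
  - by apply: (conemD lamD).
  - apply: contra v0 => /eqP E; apply/eqP; apply: (conem_pointed Mv).
    suff -> : - v = va a by [].
    by apply/eqP; rewrite eq_sym -addr_eq0 addrC E.
have : rad lam gens (lX v ^+ K.+1).
  have -> : lX v ^+ K.+1 = \sum_j (pr (h j) * lX (v *+ K)) * (lX v * gl v j) :> P.
    by apply: (expS_unit_sum hE'); exact: lXX.
  apply: (rad_sum lamD); first exact: inA_yy.
  by move=> j _; apply: (rad_mul lamD).
exact: rad_exp.
Qed.

End Nondegenerate.

End ConeLattice.

Section BilinearProduct.
Variables (F : fieldType) (A : comAlgType F).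

Lemma algLl (c : F) (a b h : A) : (c *: a + b) * h = c *: (a * h) + b * h.
Proof. by rewrite mulrDl scalerAl. Qed.

Lemma algLr (c : F) (a b h : A) : h * (c *: a + b) = c *: (h * a) + h * b.
Proof. by rewrite mulrDr scalerAr. Qed.

End BilinearProduct.

Section XdxLinear.
Variables (F : fieldType) (n : nat) (K : choiceType) (e : K -> 'rV[int]_n) (j : 'I_n).

Lemma xdxE (g : {malg F[K]}) :
  xdx e j g = lext (fun k => (e k 0 j)%:~R *: (<< k >> : {malg F[K]})) g.
Proof.
apply/malgP => k; rewrite mcoeff_lext /xdx mcoeffE; case: ifPn => [kg|ng].
  rewrite (big_rem k) //= mcoeffZ mcoeffUU mulr1 mulrC big_seq big1 ?addr0 // => k' k'g.
  rewrite mcoeffZ mcoeffU; case: eqP => [kk|_]; last by rewrite !mulr0.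
  by move: k'g; rewrite -kk mem_rem_uniq ?fset_uniq // inE eqxx.
rewrite big_seq big1 // => k' k'g; rewrite mcoeffZ mcoeffU; case: eqP => [kk|_]; last by rewrite !mulr0.
by move: ng; rewrite -kk k'g.
Qed.

Lemma xdx_lin : linear (xdx e j : {malg F[K]} -> {malg F[K]}).
Proof. by move=> c g h; rewrite !xdxE lext_is_linear. Qed.

End XdxLinear.

(** * Finite dimension of the quotient, and growth of the cone *)

Section FiniteDimension.
Variables (R : realType) (F : finFieldType) (n : nat) (f : {malg F['rV[int]_n]}).
Local Notation l := (msupp f : seq _).
Local Notation D := (Delta R f).
Local Notation w := (weight D).
Variable s : seq ('rV[int]_n * int).
Hypothesis Hs : forall (u : 'rV[R]_n) k, hceil l u k <-> sat s u k.
Local Notation lam := (@lam n s).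
Local Notation Dw := (@wden n s).
Local Notation M := (conem lam).
Local Notation V := ('rV[int]_n * int)%type.
Local Notation P := (calg F (lat V)).
Local Notation va := (@va n s).
Local Notation vT := (@vT n).
Local Notation yy := (@gens F n f s).
Local Notation U := (sp (mulA lam yy)).
Local Notation lamD := (@lamD n s).
Local Notation DwR := (DwR_gt0 R s).

(** For each exponent a of f some power [m a] of its monomial lies in the ideal. A point of large
    height either contains [m a] copies of some [va a] or lies high enough above the polytope to be
    divisible by T. *)
Lemma high_deg (Fbar : closedFieldType) (iota : {rmorphism F -> Fbar}) :
  integralRange iota -> laurent_nondegenerate R iota f ->
  exists E0 : nat, forall v, M v -> E0%:Z < vdeg v -> U (lX v).
Proof.
move=> alg nd.
have /choice[m Hm] : forall a, exists m, a \in l -> U (lX (va a *+ m)).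
  move=> a; have [al|_] := boolP (a \in l); last by exists 0%N.
  have [||_ [m Um]] := @lX_rad R F n f s Hs Fbar iota alg nd (va a).
  - exact: conem_a Hs _ al.
  - by apply/negP => /eqP[_ E]; have := Dw_gt0 s; rewrite E.
  by exists m => _; rewrite -lXX.
exists (Dw * \sum_(a <- l) m a)%N => v Mv kE.
have [c [c0 vE cs]] := proj2 (Hs _ _) (elimT (conemP R s v) Mv).
have [[a [al ca]]|no] := pselect (exists a, a \in l /\ (m a)%:R <= c a).
  have Mr : M (v - va a *+ m a).
    have v1 k : (va a *+ k).1 = a *+ k by elim: k => [|k IH]; rewrite ?mulr0n // !mulrS /= IH.
    have v2 k : (va a *+ k).2 = Dw%:Z *+ k by elim: k => [|k IH]; rewrite ?mulr0n // !mulrS /= IH.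
    apply/(conemP R); apply/Hs; rewrite /= v1 v2.
    exists (fun b => if b == a then c b - (m a)%:R else c b); split.
    - by move=> b; case: eqP => [->|_]; rewrite ?subr_ge0.
    - have -> : toR R (v.1 - a *+ m a) = toR R v.1 - (m a)%:R *: toR R a.
        by apply/rowP => i; rewrite !mxE mulmxnE rmorphB rmorphMn /= mulr_natl.
      rewrite vE (bigD1_seq a) ?fset_uniq //= [in RHS](bigD1_seq a) ?fset_uniq //= eqxx.
      rewrite scalerBl addrAC; congr (_ + _ + _).
      by apply: eq_bigr => b /negPf->.
    rewrite (bigD1_seq a) ?fset_uniq //= eqxx.
    move: cs; rewrite (bigD1_seq a) ?fset_uniq //= => cs.
    rewrite (eq_bigr c) => [|b /negPf->//]; rewrite intrD mulrDl rmorphN rmorphMn /=.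
    have -> : - (Dw%:R *+ m a) / Dw%:R = - (m a)%:R :> R.
      by rewrite -mulr_natr mulNr mulrAC divff ?gt_eqF ?DwR // mul1r.
    by rewrite addrAC lerD2r.
  rewrite -[v](subrK (va a *+ m a)) -lXM; apply: U_mul; [exact: lamD| |exact: Hm].
  exact: inA_X.
have Mr : M (v - vT).
  apply/(conemP R); apply/Hs; exists c; split=> //; first by rewrite /= subr0.
  apply: (@le_trans _ _ (\sum_(a <- l) (m a)%:R)).
    rewrite !big_seq; apply: ler_sum => a al; rewrite leNgt; apply/negP => ca.
    by apply: no; exists a; split=> //; exact: ltW.
  rewrite ler_pdivlMr ?DwR // -natr_sum -natrM -[leLHS]/((_ %:Z)%:~R) ler_int /=.
  rewrite mulnC -[leRHS]/(v.2 - 1); move: kE; rewrite /vdeg.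
  by rewrite -ltzD1 subrK.
rewrite -[v](subrK vT) addrC -lXM; apply: sp_sub; exists ord0, (lX (v - vT)).
by split; [exact: inA_X|rewrite /yy unlift_none].
Qed.

(** Every point of the polytope lies in the span of the exponents, so their matrix has rank n, and n
    independent rows can be chosen. *)
Lemma indep_exps : has_dim D n -> exists h : 'I_n -> 'rV[int]_n,
  (forall i, h i \in l) /\
  forall c : 'I_n -> R, \sum_i c i *: toR R (h i) = 0 -> forall i, c i = 0.
Proof.
move=> [[x0 [B [Dx0 Dxi fB]]] _].
pose lt := in_tuple (enum_fset (msupp f)).
pose L := \matrix_(i < size (enum_fset (msupp f)), j < n) (toR R (tnth lt i)) 0 j.
have rowL i : row i L = toR R (tnth lt i) by apply/rowP => j; rewrite !mxE.
have DL x : D x -> (x <= L)%MS.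
  move=> /(hull0_hceil Hs (@expsP R F n f) (fset_uniq _))[c [_ -> _]].
  rewrite (big_tnth _ _ (enum_fset (msupp f))); apply: summx_sub => i _.
  by apply: scalemx_sub; rewrite -rowL row_sub.
have BL : (B <= L)%MS.
  apply/row_subP => i; rewrite -[row i B](addKr x0); apply: addmx_sub; last exact: DL.
  by rewrite -scaleN1r scalemx_sub // DL.
have rL : row_full L.
  by rewrite /row_full eqn_leq rank_leq_col /= -{1}(eqP fB) mxrankS.
exists (fun i => tnth lt (fullrankfun rL i)); split; first by move=> i; exact: mem_tnth.
move=> c cE; have E : (\row_i c i) *m rowsub (fullrankfun rL) L = 0.
  rewrite -cE; apply/rowP => j; rewrite !mxE summxE; apply: eq_bigr => i _.
  by rewrite !mxE.
have cr : \row_i c i = 0.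
  by rewrite -[LHS](mulmxK (fullrowsub_unit rL)) E mul0mx.
by move=> i; have /rowP/(_ i) := cr; rewrite !mxE.
Qed.

(** [vT] and the [va (h i)] for independent exponents [h i] are n + 1 independent vectors of the
    cone, so their combinations with coefficients below [x] are distinct. *)
Lemma growth : has_dim D n ->
  exists e : nat, forall x, (x ^ n.+1 <= size (vpts f s (e * x)))%N.
Proof.
move=> /indep_exps[h [hl hi]]; exists (Dw * n + 1)%N => x.
pose pt (k : {ffun 'I_n.+1 -> nat}) : V :=
  (\sum_i h i *+ k (lift ord0 i), (k ord0 + Dw * \sum_i k (lift ord0 i))%N%:Z).
have ptM k : M (pt k).
  have -> : pt k = \sum_i va (h i) *+ k (lift ord0 i) + vT *+ k ord0.
    have E1 (v : V) m : (v *+ m) = (v.1 *+ m, v.2 *+ m).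
      by elim: m => [|m IH]; rewrite ?mulr0n // !mulrS IH.
    rewrite E1 /= mul0rn /pt; under [in RHS]eq_bigr do rewrite E1 /=.
    have -> : \sum_i (h i *+ k (lift ord0 i), Dw%:Z *+ k (lift ord0 i)) =
        (\sum_i h i *+ k (lift ord0 i), (Dw * \sum_i k (lift ord0 i))%N%:Z) :> V.
      rewrite big_distrr /= (big_morph Posz PoszD (erefl _)).
      by elim/big_rec3: _ => // i x1 x2 x3 _ ->; congr pair; rewrite PoszM -mulr_natr natz.
    by congr pair; rewrite ?addr0 //= addnC PoszD -[1 *+ _]/(_%:R) natz.
  apply: (conemD lamD); last by apply: (conemMn lamD); exact: conem_T Hs.
  elim/big_rec: _ => [|i v _ Mv]; first exact: conem0 lamD.
  by apply: (conemD lamD) => //; apply: (conemMn lamD); exact: conem_a Hs _ (hl i).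
have pt_inj : injective pt.
  move=> k k' [E1 E2].
  have E3 i : k (lift ord0 i) = k' (lift ord0 i).
    have /(_ (fun i => (k (lift ord0 i))%:R - (k' (lift ord0 i))%:R))/(_ _)/(_ i) := hi.
    move=> H; apply/eqP; rewrite -(eqr_nat R) -subr_eq0; apply/eqP; apply: H.
    under eq_bigr do rewrite scalerBl; rewrite sumrB; apply/eqP; rewrite subr_eq0; apply/eqP.
    have E4 (k0 : {ffun 'I_n.+1 -> nat}) : \sum_i0 (k0 (lift ord0 i0))%:R *: toR R (h i0) =
        toR R (\sum_i h i *+ k0 (lift ord0 i)).
      rewrite (big_morph (toR R) (@toRD R n) (@toR0 R n)); apply: eq_bigr => i0 _.
      by apply/rowP => j; rewrite !mxE mulmxnE rmorphMn /= mulr_natl.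
    by rewrite !E4 E1.
  apply/ffunP => i; case: (unliftP ord0 i) => [j ->|->]; first exact: E3.
  by move: E2; under eq_bigr do rewrite E3; move/addIn.
rewrite -size_kbox -(size_map pt); apply: uniq_leq_size.
  by rewrite map_inj_uniq // uniq_kbox.
move=> v /mapP[k]; rewrite mem_kbox => /forallP kx ->.
rewrite (mem_vpts Hs) ptM /vdeg /pt /= lez_nat mulnDl mul1n addnC leq_add //; last exact: ltnW.
rewrite -mulnA leq_mul2l; apply/orP; right.
apply: (@leq_trans (\sum_(i < n) x)); last by rewrite sum_nat_const card_ord.
by apply: leq_sum => i _; exact: ltnW.
Qed.

End FiniteDimension.

(** * The projection from the cone algebra onto [Rbar], with kernel (T) *)

Section Projection.
Variables (R : realType) (F : finFieldType) (n : nat) (f : {malg F['rV[int]_n]}).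
Local Notation l := (msupp f : seq _).
Local Notation D := (Delta R f).
Local Notation w := (weight D).
Variable s : seq ('rV[int]_n * int).
Hypothesis Hs : forall (u : 'rV[R]_n) k, hceil l u k <-> sat s u k.
Local Notation lam := (@lam n s).
Local Notation Dw := (@wden n s).
Local Notation M := (conem lam).
Local Notation V := ('rV[int]_n * int)%type.
Local Notation P := (calg F (lat V)).
Local Notation va := (@va n s).
Local Notation vT := (@vT n).
Local Notation yy := (@gens F n f s).
Local Notation U := (sp (mulA lam yy)).
Local Notation lamD := (@lamD n s).
Local Notation DwR := (DwR_gt0 R s).
Local Notation EP := (@expsP R F n f).
Local Notation K := (conept (exps R f)).
Local Notation Rb := (Rbar R f).
Implicit Types (mu nu : 'rV[int]_n) (v : V).

(** The floor only casts to the integers: on the cone the product is already an integer, by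
    [wzE]. *)
Definition wz mu : int := Num.floor (w (toR R mu) * Dw%:R).

Lemma wzE mu : cone D (toR R mu) -> (wz mu)%:~R = w (toR R mu) * Dw%:R.
Proof.
move=> Cm; have [a as_ [a0]] := weight_tight Hs EP (fset_uniq _) Cm; rewrite /fev => aE.
have [q qE] : exists q : nat, Dw = (`|a.2| * q)%N.
  by rewrite /wden (big_rem a) //= a0; eexists.
suff [z zE] : exists z : int, w (toR R mu) * Dw%:R = z%:~R.
  by rewrite /wz zE intrKfloor.
exists (- (\sum_i a.1 0 i * mu 0 i) * q%:Z).
have a2 : a.2%:~R = `|a.2|%N%:R :> R by rewrite -[a.2 in LHS]gez0_abs // ltW.
rewrite qE natrM mulrA -a2 [w _ * _]mulrC intrM; congr (_ * _).
rewrite rmorphN /= rmorph_sum /=; move/eqP: aE; rewrite addrC addr_eq0 => /eqP->.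
by congr (- _); apply: eq_bigr => i _; rewrite !mxE intrM.
Qed.

Lemma conem_cone v : M v -> cone D (toR R v.1).
Proof. by move=> /(conemP R)/(sat_cone Hs EP (fset_uniq _)). Qed.

Lemma conem_wz v : M v -> wz v.1 <= v.2.
Proof.
move=> Mv; have Cv := conem_cone Mv; rewrite -(ler_int R) wzE //.
by rewrite -ler_pdivlMr ?DwR //; apply: (weight_le Hs EP (fset_uniq _)); exact/conemP.
Qed.

Lemma cone_conem mu (k : int) : cone D (toR R mu) -> wz mu <= k -> M (mu, k).
Proof.
move=> Cm mk; apply/(conemP R); apply: (sat_weight Hs EP (fset_uniq _)) => //=.
by rewrite ler_pdivlMr ?DwR // -wzE // ler_int.
Qed.

Lemma wz0 : wz 0 = 0.
Proof. by rewrite /wz toR0 (weight0 Hs EP (fset_uniq _)) mul0r (intrKfloor 0). Qed.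

Lemma wz_ge0 mu : cone D (toR R mu) -> 0 <= wz mu.
Proof. by move=> Cm; rewrite -(ler_int R) wzE // mulr_ge0 ?ler0n // (weight_ge0 Hs EP (fset_uniq _)). Qed.

Lemma wzD mu nu : cone D (toR R mu) -> cone D (toR R nu) -> wz (mu + nu) <= wz mu + wz nu.
Proof.
move=> Cm Cn; have Cmn : cone D (toR R (mu + nu)).
  by rewrite toRD; exact: (coneD Hs EP (fset_uniq _)).
rewrite -(ler_int R) intrD !wzE // -mulrDl ler_pM2r ?DwR // toRD.
exact: (weight_subadd Hs EP (fset_uniq _)).
Qed.

Lemma wz_cofacial mu nu : cone D (toR R mu) -> cone D (toR R nu) ->
  (wz (mu + nu) = wz mu + wz nu <-> cofacial D (toR R mu) (toR R nu)).
Proof.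
move=> Cm Cn; have Cmn : cone D (toR R (mu + nu)).
  by rewrite toRD; exact: (coneD Hs EP (fset_uniq _)).
split=> [E|cof].
  apply: (weight_cofacial Hs EP (fset_uniq _)) => //; rewrite -toRD.
  apply: (mulIf (lt0r_neq0 DwR)); rewrite mulrDl -!wzE //.
  by rewrite E intrD.
apply/eqP; rewrite -(eqr_int R) intrD !wzE // -mulrDl toRD.
by rewrite (cofacial_weight Cm Cn) // (weight0 Hs EP (fset_uniq _)).
Qed.

Lemma coneptP (mu : K) : cone D (toR R mu).
Proof. by case: mu => m /= /asboolP. Qed.

Definition vw (mu : K) : V := (val mu, wz (val mu)).

Lemma M_vw (mu : K) : M (vw mu).
Proof. by apply: cone_conem => //; exact: coneptP. Qed.

(** A point of the cone strictly above its weight is divisible by T, hence sent to 0. *)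
Definition prjm v : Rb :=
  if (insub v.1 : option K) is Some mu then if v.2 == wz v.1 then cX mu else 0 else 0.

Definition prj : P -> Rb := lext prjm.

Lemma prj_lin : linear prj. Proof. exact: lext_is_linear. Qed.

Lemma prjX v : prj (lX v) = prjm v.
Proof. by rewrite /prj lextU scale1r. Qed.

(** By subadditivity a sum lies exactly at its weight only if both terms do and their weights add
    up, which is cofaciality: the vanishing products of [Rbar] are the sums that rise above their
    weight. *)
Lemma prjm_M v v' : M v -> M v' -> prjm (v + v') = prjm v * prjm v'.
Proof.
move=> Mv Mv'; have Cv := conem_cone Mv; have Cv' := conem_cone Mv'.
have i1 : in_cone0 (exps R f) v.1 by apply/asboolP.
have i2 : in_cone0 (exps R f) v'.1 by apply/asboolP.
have i3 : in_cone0 (exps R f) (v.1 + v'.1).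
  by apply/asboolP; rewrite toRD; exact: (coneD Hs EP (fset_uniq _)).
rewrite /prjm /= !insubT; have w1 := conem_wz Mv; have w2 := conem_wz Mv'.
have w3 := wzD Cv Cv'.
have [E|NE] := eqVneq (v + v').2 (wz (v.1 + v'.1)).
  have [E1 E2] : v.2 = wz v.1 /\ v'.2 = wz v'.1 by move: E w1 w2 w3 => /=; lia.
  have cof : cofacial D (toR R v.1) (toR R v'.1).
    by apply/(wz_cofacial Cv Cv'); move: E => /=; rewrite E1 E2.
  rewrite E1 E2 !eqxx cXM.
  have [ka kaE0 kaE] := @conept_mulP R n (exps R f) (Sub v.1 i1) (Sub v'.1 i2) cof.
  have -> : zmul (Sub v.1 i1 : K) (Sub v'.1 i2) = Some ka := kaE0.
  by congr cX; apply: val_inj; rewrite kaE.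
case: eqP => [E1|_]; last by rewrite mul0r.
case: eqP => [E2|_]; last by rewrite mulr0.
rewrite cXM /zmul /= conept_mulN // => cof; move/eqP: NE; apply => /=.
by rewrite E1 E2; apply/esym; apply/(wz_cofacial Cv Cv').
Qed.

Lemma prjM (g h : P) : inA lam g -> inA lam h -> prj (g * h) = prj g * prj h.
Proof.
move=> Ag Ah; pattern g; apply: lat_ind => [|c g1 g2 H1 H2|v /Ag Mv].
- by rewrite mul0r /prj linear0 mul0r.
- rewrite mulLl prj_lin prj_lin algLl.
  exact: (f_equal2 (fun x1 x2 : Rb => c *: x1 + x2) H1 H2).
pattern h; apply: lat_ind => [|c g1 g2 H1 H2|v' /Ah Mv'].
- by rewrite mulr0 /prj linear0 mulr0.
- rewrite mulLr prj_lin prj_lin algLr.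
  exact: (f_equal2 (fun x1 x2 : Rb => c *: x1 + x2) H1 H2).
apply: etrans (congr1 prj (@lXM F _ v v')) _; apply: etrans (prjX _) _.
apply: etrans (prjm_M Mv Mv') _; exact: esym (f_equal2 _ (prjX v) (prjX v')).
Qed.

Lemma prj1 : prj 1 = 1.
Proof.
rewrite -lX0 prjX /prjm /= wz0 eqxx insubT; first exact: (conept0_subproof (exps R f)).
by move=> H; rewrite -cX1; congr cX; apply: val_inj.
Qed.

Lemma prj_vw (mu : K) : prj (lX (vw mu)) = cX mu.
Proof. by rewrite prjX /prjm /vw /= valK eqxx. Qed.

Lemma prj_T : prj (lX vT) = 0.
Proof. by rewrite prjX /prjm /= wz0; case: insub. Qed.

Definition sec : Rb -> P := lext (fun mu : K => lX (vw mu)).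

Lemma sec_lin : linear sec. Proof. exact: lext_is_linear. Qed.

Lemma secX (mu : K) : sec (cX mu) = lX (vw mu).
Proof. by rewrite /sec lextU scale1r. Qed.

Lemma sec_inA g : inA lam (sec g).
Proof.
by move=> v /msupp_lext[mu _]; rewrite msupp_lX => /eqP->; exact: M_vw.
Qed.

Lemma secK g : prj (sec g) = g.
Proof.
rewrite /sec (lext_comp _ _ prj_lin) -[RHS]lext_id; apply: eq_lext => mu _ /=.
exact: prj_vw.
Qed.

Lemma sec_pi (g : P) : inA lam g -> exists2 h, inA lam h & g - sec (prj g) = lX vT * h.
Proof.
move=> Ag; pattern g; apply: lat_ind => [|c g1 g2 H1 H2|v /Ag Mv].
- have -> : 0 - sec (prj 0) = 0 by rewrite /prj linear0 /sec linear0 subr0.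
  by exists 0; rewrite ?mulr0 // => v; rewrite msupp0.
- have -> : c *: g1 + g2 - sec (prj (c *: g1 + g2)) =
     c *: (g1 - sec (prj g1)) + (g2 - sec (prj g2)).
    by rewrite prj_lin sec_lin scalerBr opprD addrACA.
  case: H1 => h1 A1 E1; case: H2 => h2 A2 E2; exists (c *: h1 + h2); first exact: inA_lin.
  apply: etrans _ (esym (mulLr _ _ _ _)).
  exact: (f_equal2 (fun x1 x2 : P => c *: x1 + x2) E1 E2).
have Cv := conem_cone Mv; have vw_ := conem_wz Mv; rewrite prjX /prjm insubT; first exact/asboolP.
move=> Hc; case: eqP => [E|NE].
  have -> : lX v - sec (cX (Sub v.1 Hc : K)) = 0 :> P.
    by rewrite secX /vw -E /=; case: (v) => a b; exact: subrr.
  by exists 0; rewrite ?mulr0 // => v'; rewrite msupp0.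
rewrite /sec linear0 subr0; exists (lX (v - vT)).
  apply: inA_X; rewrite (_ : v - vT = (v.1, v.2 - 1)); last by case: (v) => a b; rewrite -[LHS]/((a - 0, b - 1)) subr0.
  by apply: cone_conem => //; move: vw_ NE => /=; lia.
by apply: etrans _ (esym (@lXM F _ vT (v - vT))); rewrite addrC subrK.
Qed.

Hypothesis f_weight : forall mu, mu \in msupp f -> wDelta R f mu = 1.

Lemma prj_yy j : prj (yy (lift ord0 j)) = Dfbar R f j.
Proof.
rewrite /gens liftK /Dfbar /fbar.
pose xd : Rb -> Rb := xdx val j.
have xd_lin : linear xd by exact: xdx_lin.
rewrite -/xd (linear_sum_fun xd_lin).
rewrite (_ : prj _ = \sum_(a <- l) (f@_a * (a 0 j)%:~R) *: prjm (va a)); last first.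
  elim/big_rec2: _ => [|a x1 x2 _ <-]; first by rewrite /prj linear0.
  by rewrite prj_lin prjX.
rewrite !big_seq; apply: eq_bigr => a al.
have Ca : cone D (toR R a) by exact: (conem_cone (conem_a Hs al)).
rewrite /prjm /= insubT; first exact/asboolP.
move=> Ha; have -> : wz a = Dw%:Z.
  by apply/eqP; rewrite -(eqr_int R) wzE // -/(wDelta R f a) f_weight // mul1r.
rewrite eqxx /xd xdxE lextU mulrC [in RHS]scalerA mulrC //.
Qed.

Lemma If_sub : submodp (gen_ideal (Dfbar R f) : set Rb).
Proof.
split; first by exists (fun=> 0); rewrite big1 // => i _; rewrite mulr0.
move=> c _ _ [h1 ->] [h2 ->]; exists (fun i => c *: h1 i + h2 i).
by rewrite scaler_sumr -big_split; apply: eq_bigr => i _; rewrite mulrDr scalerAr.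
Qed.

Lemma prj_U g : U g -> gen_ideal (Dfbar R f) (prj g).
Proof.
have [I0 IL] := If_sub; move=> /(_ [set g | gen_ideal (Dfbar R f) (prj g)]); apply.
  split; first by rewrite /mkset /prj linear0.
  by move=> c g1 g2 H1 H2; rewrite /mkset prj_lin; exact: (IL c _ _ H1 H2).
move=> _ [i [h [Ah ->]]]; rewrite /mkset prjM //; last exact: inA_yy.
case: (unliftP ord0 i) => [j ->|->]; last first.
  by rewrite /gens unlift_none prj_T mul0r.
rewrite prj_yy; exists (fun k => if k == j then prj h else 0).
rewrite (bigD1 j) //= eqxx big1 ?addr0 // => k /negPf->; exact: mulr0.
Qed.

(** The evident lift \sum_j D_j h_j lies in the ideal; it differs from [sec g] by a multiple of T,
    which lies there too. *)
Lemma sec_If g : gen_ideal (Dfbar R f) g -> U (sec g).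
Proof.
move=> [h gE]; pose t : P := \sum_j yy (lift ord0 j) * sec (h j).
have Ut : U t.
  apply: sp_sum => j _; apply: sp_sub; exists (lift ord0 j), (sec (h j)).
  by split=> //; exact: sec_inA.
have At : inA lam t by apply: (U_inA lamD) Ut => i; exact: inA_yy.
have tE : prj t = g.
  rewrite gE /t; elim/big_rec2: _ => [|j x1 x2 _ <-]; first by rewrite /prj linear0.
  rewrite -[X in prj (X + _)]scale1r prj_lin scale1r prjM ?secK ?prj_yy //; first exact: inA_yy.
  exact: sec_inA.
have [h' Ah' hE] := sec_pi At; rewrite -tE.
rewrite (_ : sec (prj t) = t - (t - sec (prj t))); last by rewrite opprB addrC subrK.
apply: spB => //; rewrite hE; apply: sp_sub; exists ord0, h'.
by rewrite /gens unlift_none.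
Qed.

End Projection.

Lemma linear_comb (F : fieldType) (V1 V2 : lmodType F) (L : V1 -> V2) : linear L ->
  forall J (r : seq J) (Q : pred J) (c : J -> F) (x : J -> V1),
  L (\sum_(j <- r | Q j) c j *: x j) = \sum_(j <- r | Q j) c j *: L (x j).
Proof.
move=> Llin J r Q c x; elim/big_rec2: _ => [|j y1 y2 _ <-]; last exact: Llin.
by have := Llin (-1) 0 0; rewrite scaler0 addr0 scaleN1r addNr.
Qed.

Lemma mcoeff_lextU (F : fieldType) (K K' : choiceType) (h : K -> K') (g : {malg F[K]}) x :
  injective h -> (lext (fun k => << h k >> : {malg F[K']}) g)@_(h x) = g@_x.
Proof.
move=> h_inj; pattern g; apply: malg_ind => [|c g1 g2 H1 H2|k _].
- by rewrite linear0 !mcoeff0.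
- by rewrite lext_is_linear !mcoeffD !mcoeffZ H1 H2.
by rewrite lextU scale1r !mcoeffU inj_eq.
Qed.

(** * The products D^k b_j form a basis of [Rbar] *)

Section MonomialBasis.
Variables (R : realType) (F : finFieldType) (n : nat) (f : {malg F['rV[int]_n]}).
Local Notation l := (msupp f : seq _).
Local Notation D := (Delta R f).
Variable s : seq ('rV[int]_n * int).
Hypothesis Hs : forall (u : 'rV[R]_n) k, hceil l u k <-> sat s u k.
Hypothesis f_weight : forall mu, mu \in msupp f -> wDelta R f mu = 1.
Hypothesis f_dim : has_dim D n.
Local Notation lam := (@lam n s).
Local Notation Dw := (@wden n s).
Local Notation M := (conem lam).
Local Notation V := ('rV[int]_n * int)%type.
Local Notation P := (calg F (lat V)).
Local Notation vT := (@vT n).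
Local Notation yy := (@gens F n f s).
Local Notation dd := (@gdeg n s).
Local Notation U := (sp (mulA lam yy)).
Local Notation lamD := (@lamD n s).
Local Notation K := (conept (exps R f)).
Local Notation Rb := (Rbar R f).
Local Notation If := (gen_ideal (Dfbar R f)).
Local Notation prj := (@prj R F n f s).
Local Notation sec := (@sec R F n f s).
Local Notation wz := (@wz R F n f s).
Local Notation vw := (@vw R F n f s).
Local Notation deg0 := (conem_deg_ge0 Hs).
Variables (r : nat) (b : 'I_r -> K).
Hypothesis b_span : forall g : Rb, exists c : 'I_r -> F, If (g - \sum_j c j *: cX (b j)).
Hypothesis b_indep : forall c : 'I_r -> F, If (\sum_j c j *: cX (b j)) -> forall j, c j = 0.

Let b' j := vw (b j).
Definition db j := `|wz (val (b j))|%N.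

Lemma Mb' j : M (b' j). Proof. exact: M_vw Hs _. Qed.

Lemma degb' j : vdeg (b' j) = (db j)%:Z.
Proof. by rewrite /db gez0_abs // (wz_ge0 Hs) //; exact: coneptP. Qed.

Lemma b'_span v : M v -> sp ([set lX (b' j) | j in setT] `|` mulA lam yy) (lX v : P).
Proof.
move=> Mv; have [c Hc] := b_span (prj (lX v)).
have [h Ah hE] := sec_pi Hs (inA_X Mv : inA lam (lX v : P)).
pose S : P := \sum_j c j *: lX (b' j).
have secS : sec (\sum_j c j *: cX (b j)) = S.
  by rewrite (linear_comb (@sec_lin R F n f s)); apply: eq_bigr => j _; rewrite secX.
have E : sec (prj (lX v) - \sum_j c j *: cX (b j)) = sec (prj (lX v)) - S.
  by rewrite -secS [LHS](raddfB (lext _)).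
have -> : lX v = (lX v - sec (prj (lX v))) + (sec (prj (lX v)) - S) + S :> P.
  by rewrite addrA subrK subrK.
have UX (g : P) : U g -> sp ([set lX (b' j) | j in setT] `|` mulA lam yy) g.
  by apply: sp_mono => z Hz; right.
apply: spD; last by apply: sp_sum => j _; apply: spZ; apply: sp_sub; left; exists j.
apply: spD; apply: UX; last by rewrite -E; exact: sec_If Hs f_weight _ Hc.
by rewrite hE; apply: sp_sub; exists ord0, h; rewrite /gens unlift_none.
Qed.

Lemma b'_indep (c : 'I_r -> F) : U (\sum_j c j *: (lX (b' j) : P)) -> forall j, c j = 0.
Proof.
move=> H; apply: b_indep.
have E : prj (\sum_j c j *: lX (b' j)) = \sum_j c j *: (cX (b j) : Rb).
  apply: etrans (linear_comb (@prj_lin R F n f s) _ _ _ _) _; apply: eq_bigr => j _.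
  exact: (congr1 (fun z : Rb => c j *: z) (prj_vw s (b j))).
exact: (eq_ind _ If (prj_U Hs f_weight H) _ E).
Qed.

Local Notation KK := ({ffun 'I_n -> nat} * 'I_r)%type.
Local Notation KK' := ({ffun 'I_n.+1 -> nat} * 'I_r)%type.
Local Notation bm := (bmon yy b').

Definition tmon (x : KK) : Rb := (\prod_i Dfbar R f i ^+ x.1 i) * cX (b x.2).

Definition ktail (k : {ffun 'I_n.+1 -> nat}) : {ffun 'I_n -> nat} := [ffun i => k (lift ord0 i)].
Definition kemb (k : {ffun 'I_n -> nat}) : {ffun 'I_n.+1 -> nat} :=
  [ffun i => if unlift ord0 i is Some j then k j else 0%N].

Lemma kembK : cancel kemb ktail.
Proof. by move=> k; apply/ffunP => i; rewrite !ffunE liftK. Qed.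

Lemma kemb0 k : kemb k ord0 = 0%N.
Proof. by rewrite ffunE unlift_none. Qed.

Lemma prj_exp (g : P) m : inA lam g -> prj (g ^+ m) = prj g ^+ m.
Proof.
move=> Ag; elim: m => [|m IH]; first by rewrite !expr0; exact: prj1 Hs.
have Am : inA lam (g ^+ m) by exact: (inA_exp lamD).
rewrite !exprS; apply: etrans (prjM Hs Ag Am) _.
exact: (congr1 ( *%R (prj g)) IH).
Qed.

Lemma prj_mon k : inA lam (mon yy k) /\ prj (mon yy k) = \prod_i prj (yy i) ^+ k i.
Proof.
rewrite /mon; elim/big_rec2: _ => [|i g1 g2 _ [A1 E1]].
  by split; [apply: (inA_X (conem0 lamD))|exact: prj1 Hs].
have Hi : inA lam (yy i) by exact: inA_yy.
have Ai : inA lam (yy i ^+ k i) by exact: (inA_exp lamD).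
split; first exact: (inA_M lamD).
apply: etrans (prjM Hs Ai A1) _.
exact: (f_equal2 *%R (@prj_exp (yy i) (k i) Hi) E1).
Qed.

Lemma prj_bmon (x : KK') : prj (bm x) = if x.1 ord0 == 0%N then tmon (ktail x.1, x.2) else 0.
Proof.
have [A E] := prj_mon x.1; apply: etrans (prjM Hs A (inA_X (Mb' x.2))) _.
apply: etrans (f_equal2 *%R E (prj_vw s (b x.2))) _.
have E0 : prj (yy ord0) = 0 by rewrite /gens unlift_none; exact: prj_T Hs.
rewrite big_ord_recl E0 expr0n; case: eqP => _; last by rewrite !mul0r.
rewrite mul1r /tmon; congr (_ * _); apply: eq_bigr => i _; rewrite ffunE.
exact: (congr1 (fun z : Rb => z ^+ _) (prj_yy Hs f_weight i)).
Qed.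

Definition tmon_deg (x : KK) : nat := (Dw * \sum_i x.1 i + db x.2)%N.

Lemma bmon_sp v : M v -> sp [set bm x | x in [set x | bdeg dd db x = `|vdeg v|%N]] (lX v : P).
Proof.
move=> Mv; have Hy := HA_yy Hs.
apply: (bmon_span lamD (@vdegD n) deg0 (@dd_gt0 n s) Hy Mb' degb' b'_span Mv).
by rewrite gez0_abs // deg0.
Qed.

Lemma tmon_span (mu : K) :
  sp [set tmon x | x in [set x | tmon_deg x = `|wz (val mu)|%N]] (cX mu : Rb).
Proof.
rewrite -(prj_vw s mu); have := bmon_sp (M_vw Hs mu).
apply: sp_lin; first exact: prj_lin.
move=> _ [x xE <-]; rewrite prj_bmon; case: eqP => [x0|_]; last exact: sp0.
apply: sp_sub; exists (ktail x.1, x.2) => //.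
rewrite /= /tmon_deg -[RHS]xE /bdeg /wt big_ord_recl x0 muln0 add0n /=; congr (_ + _)%N.
by rewrite big_distrr; apply: eq_bigr => i _; rewrite ffunE /gdeg liftK.
Qed.

(** A relation in [Rbar] lifts to an element divisible by T. Expanded in the basis of A, it involves
    only positive exponents of T, whereas the lift of the relation involves only the exponent 0. *)
Lemma tmon_inj (g : {malg F[KK]}) : lext tmon g = 0 -> g = 0.
Proof.
move=> g0; pose G : P := lext (fun x => bm (kemb x.1, x.2)) g.
have prG : prj G = 0.
  rewrite -g0 /G (lext_comp _ _ (@prj_lin R F n f s)); apply: eq_lext => x _ /=.
  by rewrite prj_bmon /= kemb0 eqxx kembK; case: x.
have Abm x : inA lam (bm x).
  by apply: (inA_M lamD); [exact: (proj1 (prj_mon _))|exact: inA_X (Mb' _)].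
have AG : inA lam G by move=> v /msupp_lext[x _]; exact: Abm.
have [h Ah] := sec_pi Hs AG; rewrite prG (_ : sec 0 = 0) ?subr0; last exact: linear0.
move=> GE.
pose W := [set y : P | exists2 q : {malg F[KK']}, lext bm q = y &
  forall x, x \in msupp q -> (0 < x.1 ord0)%N].
have subW : submodp W.
  split; first by exists 0; rewrite ?linear0 // => x; rewrite msupp0.
  move=> c _ _ [q1 <- H1] [q2 <- H2]; exists (c *: q1 + q2); first exact: lext_is_linear.
  move=> x /(fsubsetP (msuppD_le _ _)); rewrite inE => /orP[|/H2//].
  by move=> /(fsubsetP (msuppZ_le _ _))/H1.
have WG : W G.
  rewrite GE; have spW : sp W (lX vT * h).
    have : sp (range bm) h.
      apply: sp_inA Ah => v Mv; apply: sp_mono (bmon_sp Mv) => _ [x _ <-].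
      by exists x; [exact: I|exact: erefl].
    apply: sp_mulr => _ [x _ <-]; apply: sp_sub.
    exists << (kadd (kone ord0) x.1, x.2) >>.
      rewrite lextU scale1r /bmon /= monD mon1 {1}/gens unlift_none.
      exact: esym (mulrA _ _ _).
    by move=> y; rewrite msuppU oner_eq0 inE => /eqP->; rewrite /= !ffunE eqxx.
  exact: spW subW (fun _ => id).
case: WG => q qE qpos.
pose g' : {malg F[KK']} := lext (fun x : KK => << (kemb x.1, x.2) >>) g.
have g'E : lext bm g' = G.
  rewrite /g' (lext_comp _ _ (lext_is_linear _)); apply: eq_lext => x _.
  exact: etrans (lextU bm 1 (kemb x.1, x.2)) (scale1r _).
have [e He] := growth Hs f_dim.
have Hy := HA_yy Hs.
have E : g' - q = 0.
  apply: (bmon_indep lamD (@vdegD n) (@V_torsion_free n) deg0 (conem_pointed Hs)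
    (vpts_uniq f s) (mem_vpts Hs) (lam_bound Hs) (ltn0Sn n) (@dd_gt0 n s) Hy Mb' degb'
    b'_span b'_indep He).
  by rewrite (raddfB (lext bm)) /= g'E qE subrr.
apply/malgP => x; rewrite mcoeff0; apply/eqP; apply: contraT => gx.
have : (kemb x.1, x.2) \in msupp q.
  move/eqP: E; rewrite subr_eq0 => /eqP<-; rewrite -mcoeff_neq0.
  have hinj : injective (fun x : KK => (kemb x.1, x.2)).
    by move=> [k j] [k' j'] [/(can_inj kembK) -> ->].
  by have -> : g'@_(kemb x.1, x.2) = g@_x by exact: (mcoeff_lextU g x hinj).
by move=> /qpos; rewrite /= kemb0.
Qed.

End MonomialBasis.

(** * Extracting independent families modulo a subspace *)

Section FreeFamilies.
Variables (F : fieldType) (V : lmodType F) (I : eqType) (x : I -> V).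
Variable W : set V.
Hypothesis subW : submodp W.

Lemma sp_id v : sp W v -> W v. Proof. by apply. Qed.

Lemma free_mod_extract (s : seq I) : exists t, [/\ {subset t <= s}, free_mod x W t &
  forall i, i \in s -> sp (W `|` fam x t) (x i)].
Proof.
elim/last_ind: s => [|s i [t [ts tf tsp]]].
  by exists [::]; split=> // t1 j t2; case: t1.
have [it|nit] := pselect (sp (W `|` fam x t) (x i)).
  exists t; split=> //; first by move=> j /ts; rewrite mem_rcons inE orbC => ->.
  by move=> j; rewrite mem_rcons inE => /orP[/eqP->//|/tsp].
exists (rcons t i); split.
- by move=> j; rewrite !mem_rcons !inE => /orP[->//|/ts->]; rewrite orbT.
- move=> t1 j t2; case/lastP: t2 => [|t2 i'].
    by rewrite cats1 => /rcons_inj[<- <-].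
  by rewrite -rcons_cons -rcons_cat => /rcons_inj[E _]; exact: tf E.
move=> j; rewrite mem_rcons inE => /orP[/eqP->|/tsp].
  by apply: sp_sub; right; exists i => //=; rewrite mem_rcons inE eqxx.
apply: sp_mono => v [Wv|[k kt <-]]; [by left|right; exists k => //].
by rewrite /= mem_rcons inE (kt : k \in t) orbT.
Qed.

Lemma free_mod_uniq (t : seq I) : free_mod x W t -> uniq t.
Proof.
elim/last_ind: t => // t i IH tf; rewrite rcons_uniq IH ?andbT; last first.
  by move=> t1 j t2 E; apply: (tf t1 j (rcons t2 i)); rewrite E -rcons_cons rcons_cat.
apply/negP => it; apply: (tf t i [::]); first by rewrite cats1.
by apply: sp_sub; right; exists i.
Qed.

Lemma free_mod_indep (t : seq I) (c : I -> F) : free_mod x W t ->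
  W (\sum_(i <- t) c i *: x i) -> forall i, i \in t -> c i = 0.
Proof.
elim/last_ind: t => // t i IH tf; rewrite -cats1 big_cat big_seq1 /= => Wt.
have tf' : free_mod x W t.
  by move=> t1 j t2 E; apply: (tf t1 j (rcons t2 i)); rewrite E -rcons_cons rcons_cat.
have ci : c i = 0.
  apply/eqP; apply: contraT => ci; case: (tf t i [::]); first by rewrite cats1.
  rewrite -[x i](scalerK ci); apply: spZ.
  rewrite -[c i *: x i](addKr (\sum_(j <- t) c j *: x j)) addrC; apply: spB.
    by apply: sp_sub; left.
  rewrite big_seq; apply: sp_sum => j jt; apply: spZ; apply: sp_sub; right.
  by exists j.
move=> j; rewrite cats1 mem_rcons inE => /orP[/eqP->//|jt]; apply: IH => //.
by move: Wt; rewrite ci scale0r addr0.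
Qed.

Lemma indep_free_mod (t : seq I) : uniq t ->
  (forall c : I -> F, W (\sum_(i <- t) c i *: x i) -> forall i, i \in t -> c i = 0) ->
  free_mod x W t.
Proof.
move=> ut Hc t1 j t2 E H; move: ut; rewrite E cat_uniq => /and3P[u1 /hasPn h u2].
have jt1 : j \notin t1 by apply: h; rewrite inE eqxx.
have [c /sp_id Wc] := sp_famP u1 H.
pose d i := if i \in t1 then - c i else (i == j)%:R.
have : d j = 0.
  apply: Hc; last by rewrite E mem_cat inE eqxx orbT.
  rewrite E big_cat big_cons /= {2}/d (negPf jt1) eqxx scale1r.
  have -> : \sum_(i <- t2) d i *: x i = 0.
    rewrite big_seq big1 // => i it2; rewrite /d ifN; last by apply: h; rewrite inE it2 orbT.
    case: eqP => [ij|_]; last by rewrite scale0r.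
    by move: u2; rewrite /= -ij it2.
  rewrite addr0 addrC big_seq (eq_bigr (fun i => - (c i *: x i))) => [|i it].
    by rewrite sumrN -big_seq.
  by rewrite /d it scaleNr.
by rewrite /d (negPf jt1) eqxx => /eqP; rewrite oner_eq0.
Qed.

End FreeFamilies.

Lemma bounded_set_seq (T : choiceType) (B : set T) r :
  (forall t : seq T, uniq t -> (forall x, x \in t -> B x) -> (size t <= r)%N) ->
  exists2 t : seq T, uniq t & forall x, B x <-> x \in t.
Proof.
move=> H; pose Q m := `[< exists t, [/\ uniq t, forall x, x \in t -> B x & size t = m] >].
have Q0 : exists m, Q m by exists 0%N; apply/asboolP; exists [::].
have Qr m : Q m -> (m <= r)%N by move=> /asboolP[t [ut tB <-]]; exact: H.
case: (ex_maxnP Q0 Qr) => m /asboolP[t [ut tB tm]] mx; exists t => // x; split; last exact: tB.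
move=> Bx; apply: contraT => nx; have := mx m.+1; rewrite ltnn; apply.
apply/asboolP; exists (x :: t); split; rewrite /= ?nx ?tm //.
by move=> y; rewrite inE => /orP[/eqP->|/tB].
Qed.

Lemma sum_seq_ord (F : fieldType) (V : lmodType F) (T : eqType) (t : seq T)
    (c : 'I_(size t) -> F) (x : T -> V) : uniq t ->
  exists c' : T -> F, (forall j, c' (tnth (in_tuple t) j) = c j) /\
    \sum_j c j *: x (tnth (in_tuple t) j) = \sum_(i <- t) c' i *: x i.
Proof.
move=> ut; pose c' i := if insub (index i t) is Some j then c j else 0.
have c'E j : c' (tnth (in_tuple t) j) = c j.
  have E : index (tnth (in_tuple t) j) t = j.
    by rewrite (tnth_nth (tnth (in_tuple t) j)) index_uniq.
  rewrite /c'; case: insubP => [k _ kE|]; last by rewrite E ltn_ord.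
  by congr c; apply: val_inj; rewrite kE E.
exists c'; split=> //; rewrite [RHS]big_tnth; apply: eq_bigr => j _.
by rewrite -[in LHS]c'E.
Qed.

Lemma mcoeff_comb (F : fieldType) (K : choiceType) (t : seq K) (c : K -> F) x :
  uniq t -> x \in t -> (\sum_(y <- t) c y *: (<< y >> : {malg F[K]}))@_x = c x.
Proof.
move=> ut xt; rewrite raddf_sum /= (bigD1_seq x) //= mcoeffZ mcoeffUU mulr1 big1 ?addr0 //.
by move=> y /negPf yx; rewrite mcoeffZ mcoeffU yx mulr0.
Qed.

Lemma comb_eq0 (F : fieldType) (K : choiceType) (t : seq K) (c : K -> F) x :
  uniq t -> \sum_(y <- t) c y *: (<< y >> : {malg F[K]}) = 0 -> x \in t -> c x = 0.
Proof. by move=> ut E xt; rewrite -(mcoeff_comb c ut xt) E mcoeff0. Qed.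

(** * Monomial bases, and lattice points counted by weight *)

Section BasisCounting.
Variables (R : realType) (F : finFieldType) (n : nat) (f : {malg F['rV[int]_n]}).
Local Notation l := (msupp f : seq _).
Local Notation D := (Delta R f).
Variable s : seq ('rV[int]_n * int).
Hypothesis Hs : forall (u : 'rV[R]_n) k, hceil l u k <-> sat s u k.
Hypothesis f_weight : forall mu, mu \in msupp f -> wDelta R f mu = 1.
Local Notation lam := (@lam n s).
Local Notation Dw := (@wden n s).
Local Notation M := (conem lam).
Local Notation V := ('rV[int]_n * int)%type.
Local Notation yy := (@gens F n f s).
Local Notation K := (conept (exps R f)).
Local Notation Rb := (Rbar R f).
Local Notation If := (gen_ideal (Dfbar R f)).
Local Notation wz := (@wz R F n f s).
Local Notation vw := (@vw R F n f s).

(** The lattice points of t Delta, found by forgetting heights in the cone up to height [Dw * t];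
    [undup] merges the points that differ only in height. *)
Definition cpts (t : nat) : seq K := undup (pmap insub (map fst (vpts f s (Dw * t)))).

Lemma cpts_uniq t : uniq (cpts t). Proof. exact: undup_uniq. Qed.

Lemma mem_cpts t (mu : K) : (mu \in cpts t) = (wz (val mu) <= (Dw * t)%N%:Z).
Proof.
rewrite mem_undup mem_pmap; apply/mapP/idP => [[m /mapP[v vv ->]]|H].
  have E : v.1 = val mu -> wz (val mu) <= (Dw * t)%N%:Z.
    move: vv; rewrite (mem_vpts Hs) => /andP[Mv dv] <-.
    exact: le_trans (conem_wz Hs Mv) dv.
  by case: insubP => // m' _ vE [mm]; apply: E; rewrite mm.
exists (val mu); last by rewrite valK.
by apply/mapP; exists (vw mu) => //; rewrite (mem_vpts Hs) (M_vw Hs).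
Qed.

(** By [high_deg] monomials of large weight lie in the ideal, so a basis can be extracted from the
    finitely many others. *)
Lemma exists_basis (Fbar : closedFieldType) (iota : {rmorphism F -> Fbar}) :
  integralRange iota -> laurent_nondegenerate R iota f ->
  exists (r : nat) (b : 'I_r -> K),
    (forall g : Rb, exists c : 'I_r -> F, If (g - \sum_j c j *: cX (b j))) /\
    (forall c : 'I_r -> F, If (\sum_j c j *: cX (b j)) -> forall j, c j = 0).
Proof.
move=> alg nd; have [E0 HE0] := high_deg Hs alg nd; have If_s := If_sub R f.
have [t [_ tf tsp]] := free_mod_extract (fun mu : K => cX mu : Rb) If (cpts E0).
have ut := free_mod_uniq tf.
have span (mu : K) : sp (If `|` fam (fun mu : K => cX mu : Rb) t) (cX mu).
  have [mE|mE] := boolP (mu \in cpts E0); first exact: tsp.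
  apply: sp_sub; left; rewrite -(prj_vw s mu); apply: (prj_U Hs f_weight); apply: HE0.
    exact: M_vw Hs _.
  move: mE; rewrite mem_cpts -ltNge; apply: le_lt_trans.
  by rewrite lez_nat leq_pmull // Dw_gt0.
exists (size t), (tnth (in_tuple t)); split=> [g|c H].
  have Hg : sp (If `|` fam (fun mu : K => cX mu : Rb) t) g.
    by rewrite (calg_sumE g); apply: sp_sum => mu _; apply: spZ; exact: span.
  have [c /(sp_id If_s) Hc] := sp_famP ut Hg.
  exists (fun j => c (tnth (in_tuple t) j)); move: Hc.
  by rewrite [X in If (_ - X)](big_tnth _ _ t).
have [c' [c'E cE]] := sum_seq_ord c (fun mu : K => cX mu : Rb) ut.
have H' : If (\sum_(mu <- t) c' mu *: cX mu) by rewrite -cE.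
by move=> j; rewrite -c'E; apply: (free_mod_indep tf H'); exact: mem_tnth.
Qed.

Hypothesis f_dim : has_dim D n.
Variables (r : nat) (b : 'I_r -> K).
Hypothesis b_span : forall g : Rb, exists c : 'I_r -> F, If (g - \sum_j c j *: cX (b j)).
Hypothesis b_indep : forall c : 'I_r -> F, If (\sum_j c j *: cX (b j)) -> forall j, c j = 0.
Local Notation tmon := (@tmon R F n f r b).
Local Notation tdeg := (@tmon_deg R F n f s r b).
Local Notation db := (@db R F n f s r b).
Local Notation KK := ({ffun 'I_n -> nat} * 'I_r)%type.

Lemma tmon_supp (x : KK) (mu : K) : mu \in msupp (tmon x) -> wz (val mu) = (tdeg x)%:Z.
Proof.
have -> : tmon x = @prj R F n f s (bmon yy (fun j => vw (b j)) (kemb x.1, x.2)).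
  apply: esym; apply: etrans (prj_bmon Hs f_weight b _) _.
  by rewrite kemb0 eqxx kembK; case: (x).
move=> /msupp_lext[v vb]; rewrite /prjm; case: insubP => [m _ mE|_]; last by rewrite msupp0.
case: eqP => [vE|_]; last by rewrite msupp0.
rewrite msuppX => /eqP->; rewrite mE -vE.
have Hy := HA_yy Hs.
have [_] := HA_bmon (@lamD n s) (@vdegD n) Hy (Mb' Hs b) (degb' Hs b) vb.
rewrite /vdeg => ->; congr Posz; rewrite /bdeg /tmon_deg; congr (_ + _)%N.
rewrite /wt big_ord_recl kemb0 muln0 add0n big_distrr; apply: eq_bigr => i _.
by rewrite ffunE liftK /gdeg liftK.
Qed.

Definition tlist (t : nat) : seq KK := [seq (k, j) | k <- kap (fun=> 1%N) t, j <- enum 'I_r].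

Lemma mem_tlist t x : (x \in tlist t) = (\sum_i x.1 i <= t)%N.
Proof.
have E k : wt (fun=> 1%N) k = \sum_(i < n) k i by apply: eq_bigr => i _; rewrite mul1n.
apply/allpairsP/idP => [[y [+ _ ->]]|H]; first by rewrite mem_kap // E.
by exists x; split; [rewrite mem_kap // E|rewrite mem_enum|case: x H].
Qed.

Lemma tlist_uniq t : uniq (tlist t).
Proof. by apply: allpairs_uniq; [exact: uniq_kap|exact: enum_uniq|move=> [? ?] [? ?] _ _ [-> ->]]. Qed.

Lemma size_tlist t : size (tlist t) = (kC (fun _ : 'I_n => 1%N) t * r)%N.
Proof. by rewrite size_allpairs size_enum_ord. Qed.

Lemma set0_sub : submodp ([set 0] : set Rb).
Proof. by split=> // c v w -> ->; rewrite scaler0 addr0. Qed.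

Lemma count_upper t : (size (cpts t) <= kC (fun _ : 'I_n => 1%N) t * r)%N.
Proof.
rewrite -size_tlist; apply: (@free_mod_size F Rb _ _ tmon (fun mu : K => cX mu : Rb) [set 0]).
  apply: (indep_free_mod set0_sub); first exact: cpts_uniq.
  move=> c H mu mt; exact: (comb_eq0 (cpts_uniq t) H mt).
move=> mu mt.
have : sp [set tmon x | x in [set x | tdeg x = `|wz (val mu)|%N]] (cX mu : Rb) by exact: tmon_span.
apply: sp_mono => _ [x xE <-].
right; exists x => //; rewrite /= mem_tlist; move: mt; rewrite mem_cpts => mt.
have : (tdeg x <= Dw * t)%N.
  by rewrite (xE : tdeg x = _) -lez_nat gez0_abs //; apply: (wz_ge0 Hs); exact: coneptP.
rewrite /tmon_deg => H; rewrite -(leq_pmul2l (Dw_gt0 s)).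
by apply: leq_trans H; exact: leq_addr.
Qed.

Lemma count_lower : exists c : nat, forall t,
  (kC (fun _ : 'I_n => 1%N) t * r <= size (cpts (t + c)))%N.
Proof.
exists (\sum_j db j)%N => t; rewrite -size_tlist.
apply: (@free_mod_size F Rb _ _ (fun mu : K => cX mu : Rb) tmon [set 0]).
  apply: (indep_free_mod set0_sub); first exact: tlist_uniq.
  move=> c H x xt; pose g : {malg F[KK]} := \sum_(y <- tlist t) c y *: << y >>.
  have g0 : g = 0.
    apply: (tmon_inj Hs f_weight f_dim b_span b_indep).
    apply: etrans (linear_comb (lext_is_linear _) _ _ _ _) _.
    rewrite -[RHS]H; apply: eq_bigr => y _.
    exact: (congr1 (fun z : Rb => c y *: z) (etrans (lextU _ _ _) (scale1r _))).
  exact: (comb_eq0 (tlist_uniq t) g0 xt).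
move=> x; rewrite mem_tlist => xt.
rewrite (calg_sumE (tmon x)) [X in sp _ X]big_seq; apply: sp_sum => mu mx.
apply: spZ; apply: sp_sub; right; exists mu => //=; rewrite mem_cpts (tmon_supp mx) lez_nat.
rewrite /tmon_deg mulnDr leq_add ?leq_mul2l ?xt ?orbT //.
apply: (@leq_trans (\sum_j db j)%N); first by rewrite (bigD1 x.2) //= leq_addr.
by rewrite leq_pmull // Dw_gt0.
Qed.

(** Elements of [B] are independent modulo the ideal, whose quotient is spanned by [r] elements;
    hence [B] is finite and can be listed. *)
Lemma monomial_set_seq (B : set K) :
  direct_sum (lin_span (S := F) [set (<< mu >> : Rb) | mu in B]) If ->
  exists t : seq K, [/\ uniq t, forall mu, B mu <-> mu \in t,
    forall g : Rb, exists c : 'I_(size t) -> F,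
      If (g - \sum_j c j *: cX (tnth (in_tuple t) j)) &
    forall c : 'I_(size t) -> F, If (\sum_j c j *: cX (tnth (in_tuple t) j)) ->
      forall j, c j = 0].
Proof.
move=> [Bspan Bint]; have If_s := If_sub R f.
have Bind (t : seq K) (c : K -> F) : uniq t -> (forall mu, mu \in t -> B mu) ->
    If (\sum_(mu <- t) c mu *: cX mu) -> forall mu, mu \in t -> c mu = 0.
  move=> ut tB H mu mt.
  have g0 : \sum_(mu <- t) c mu *: (cX mu : Rb) = 0.
    apply: Bint => //; exists (size t), (fun j => cX (tnth (in_tuple t) j)),
      (fun j => c (tnth (in_tuple t) j)); split; last by rewrite (big_tnth _ _ t).
    by move=> j; exists (tnth (in_tuple t) j) => //; apply: tB; exact: mem_tnth.
  exact: (comb_eq0 ut g0 mt).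
have [t ut tB] : exists2 t : seq K, uniq t & forall mu, B mu <-> mu \in t.
  apply: (@bounded_set_seq _ _ r) => t ut tB.
  rewrite -(size_enum_ord r).
  apply: (@free_mod_size F Rb _ _ (fun j => cX (b j) : Rb) (fun mu : K => cX mu : Rb) If).
    by apply: (indep_free_mod If_s ut) => c; exact: Bind.
  move=> mu _; have [c Hc] := b_span (cX mu).
  rewrite -[cX mu](subrK (\sum_j c j *: cX (b j))); apply: spD; first by apply: sp_sub; left.
  apply: sp_sum => j _; apply: spZ; apply: sp_sub; right; exists j => //.
  by rewrite /= mem_enum.
exists t; split=> // [g|c H].
  have [_ [z [[m [y [c [yB ->]]]] Iz gE]]] := Bspan g.
  have : sp (If `|` fam (fun mu : K => cX mu : Rb) t) g.
    rewrite gE; apply: spD; last by apply: sp_sub; left.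
    apply: sp_sum => i _; apply: spZ; apply: sp_sub; right.
    by have [mu /tB mt <-] := yB i; exists mu.
  move=> /(sp_famP ut)[d /(sp_id If_s) Hd]; exists (fun j => d (tnth (in_tuple t) j)).
  by move: Hd; rewrite [X in If (_ - X)](big_tnth _ _ t).
have [c' [c'E cE]] := sum_seq_ord c (fun mu : K => cX mu : Rb) ut.
have H' : If (\sum_(mu <- t) c' mu *: cX mu) by rewrite -cE.
by move=> j; rewrite -c'E; apply: (Bind t c' ut _ H'); [move=> mu /tB|exact: mem_tnth].
Qed.

End BasisCounting.

(** * The Koszul complex of a regular sequence *)

Section KoszulAcyclic.
Variables (M : comPzRingType) (n : nat) (g : 'I_n -> M).
Implicit Types (I J : {set 'I_n}) (w u eta : {set 'I_n} -> M) (m i : nat).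

(** The Koszul differential in all degrees at once, on functions of arbitrary subsets; the induction
    then needs no dependent degree. *)
Definition fd w I : M :=
  \sum_(l in I) (-1) ^+ #|[set k in I | (k < l)%N]| * g l * w (I :\ l).

Definition ideal_lt m : set M :=
  [set a | exists h : 'I_n -> M, a = \sum_(l < n | (l < m)%N) g l * h l].

Definition regular_seq := forall (m : 'I_n) a, ideal_lt m (g m * a) -> ideal_lt m a.

Definition below m : {set 'I_n} := [set k : 'I_n | (k < m)%N]%SET.

Lemma fdD w u I : fd (fun J => w J + u J) I = fd w I + fd u I.
Proof. by rewrite -big_split; apply: eq_bigr => l _; rewrite mulrDr. Qed.

Lemma fdZ a w I : fd (fun J => a * w J) I = a * fd w I.
Proof. by rewrite mulr_sumr; apply: eq_bigr => l _; rewrite mulrCA. Qed.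

Lemma eq_fd w u I : (forall l, l \in I -> w (I :\ l) = u (I :\ l)) -> fd w I = fd u I.
Proof. by move=> H; apply: eq_bigr => l lI; rewrite H. Qed.

Lemma fd_add (x : 'I_n) w J : J \subset below x ->
  fd w (x |: J) = fd (fun K => w (x |: K)) J + (-1) ^+ #|J| * g x * w J.
Proof.
move=> /fintype.subsetP Jx; have xJ : x \notin J.
  by apply/negP => /Jx; rewrite inE ltnn.
rewrite /fd big_setU1 //= addrC; congr (_ + _).
  apply: eq_bigr => l lJ; have lx : (l < x)%N by have := Jx l lJ; rewrite inE.
  congr (_ * _ * _).
    congr (_ ^+ _); apply: eq_card => k; rewrite !inE andb_orl.
    by case: eqP => //= ->; rewrite ltnNge ltnW //= andFb.
  congr (w _); apply/setP => k; rewrite !inE.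
  by case: (eqVneq k x) => [->|_] //=; rewrite andbT; case: eqP lx => // <-; rewrite ltnn.
congr (_ ^+ _ * _ * _); last by rewrite setU1K.
apply: eq_card => k; rewrite !inE; case: (eqVneq k x) => [->|_] /=.
  by rewrite ltnn (negPf xJ).
by case kJ: (k \in J) => //=; have := Jx k kJ; rewrite inE.
Qed.

(** A set [below m :\ l] determines [l], so the coefficients can be prescribed one by one; the sign
    put into the form cancels the sign of [fd]. *)
Lemma ideal_lt_fd m a : ideal_lt m a -> exists eta, fd eta (below m) = a.
Proof.
move=> [h ->]; pose sg (l : 'I_n) : M := (-1) ^+ #|[set k in below m | (k < l)%N]|.
exists (fun I => \sum_(l in below m | below m :\ l == I) sg l * h l).
rewrite /fd [LHS](eq_bigl (fun l : 'I_n => (l < m)%N)); last by move=> l; rewrite inE.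
apply: eq_bigr => l lm; rewrite (big_pred1 l) => [|k]; last first.
  rewrite !inE; apply/andP/eqP => [[km /eqP/setP E]|->]; last by rewrite lm.
  by have := E k; rewrite !inE eqxx /= km andbT => /esym/negbFE/eqP.
rewrite -/(sg l) mulrCA !mulrA -expr2 -exprM mulnC exprM sqrrN expr1n expr1n mul1r.
by [].
Qed.

Lemma fd_ideal m w : ideal_lt m (fd w (below m)).
Proof.
exists (fun l : 'I_n => (-1) ^+ #|[set k in below m | (k < l)%N]| * w (below m :\ l)).
rewrite /fd; apply: eq_big => [l|l _]; first by rewrite inE.
by rewrite mulrAC mulrC mulrA.
Qed.

Lemma coboundaryP i (w : Omega M n i) :
  coboundary g i w <-> exists eta, forall I : subset_of_card n i, w I = fd eta (val I).
Proof.
case: i w => [|i] w; split.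
- move=> ->; exists (fun=> 0) => I; rewrite ffunE /fd big1 // => l _.
  by rewrite mulr0.
- move=> [eta He]; apply/ffunP => I; rewrite He ffunE; have /eqP/cards0_eq -> := valP I.
  by rewrite /fd big_set0.
- by move=> [eta _ <-]; exists (Omega_coef eta) => I; rewrite ffunE.
move=> [eta He]; exists [ffun I : subset_of_card n i => eta (val I)] => //.
apply/ffunP => I; rewrite He /Omega_d ffunE; apply: eq_bigr => l lI.
have cI : #|val I :\ l| == i by have := valP I; rewrite /= (cardsD1 l) lI.
pose J : subset_of_card n i := exist (fun I : {set 'I_n} => #|I| == i) _ cI.
have := @Omega_coefE M n i [ffun I : subset_of_card n i => eta (val I)] J.
by rewrite ffunE /= => ->.
Qed.

Hypothesis g_reg : regular_seq.

(* The forms on the first m+1 variables split into those without the largest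
   one and those divisible by it. *)
Lemma koszul_exact m i w : (m <= n)%N -> (i < m)%N ->
  (forall J, J \subset below m -> #|J| = i.+1 -> fd w J = 0) ->
  exists eta, forall I, I \subset below m -> #|I| = i -> w I = fd eta I.
Proof.
elim: m i w => // m IH i w mn; rewrite ltnS => im Hw.
pose x : 'I_n := Ordinal mn; have bx : below x = below m by [].
have sub J : J \subset below m -> J \subset below m.+1.
  by move=> /fintype.subsetP H; apply/fintype.subsetP => k /H; rewrite !inE => /ltnW.
have subx J : J \subset below m -> x |: J \subset below m.+1.
  by move=> /sub HJ; rewrite finset.subUset HJ andbT finset.sub1set inE /= ltnSn.
have xN J : J \subset below m -> x \notin J.
  by move=> /fintype.subsetP H; apply/negP => /H; rewrite inE /= ltnn.
have cardx J : J \subset below m -> #|x |: J| = #|J|.+1 by move=> /xN xJ; rewrite cardsU1 xJ.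
have split_ I : I \subset below m.+1 -> x \in I ->
    [/\ I :\ x \subset below m, #|I| = #|I :\ x|.+1 & I = x |: (I :\ x)].
  move=> /fintype.subsetP H xI; rewrite finset.setD1K // (cardsD1 x I) xI; split=> //.
  apply/fintype.subsetP => k; rewrite !inE => /andP[kx /H]; rewrite inE ltnS leq_eqVlt.
  by rewrite -[k == x]/(k == m :> nat) in kx; rewrite (negPf kx).
have nsplit I : I \subset below m.+1 -> x \notin I -> I \subset below m.
  move=> /fintype.subsetP H xI; apply/fintype.subsetP => k kI.
  have := H k kI; rewrite !inE ltnS leq_eqVlt => /orP[/eqP kx|//].
  by move: xI; rewrite (_ : x = k) ?kI //; apply: val_inj.
have cb : #|below m| = m.
  rewrite -sum1_card (eq_bigl (fun k : 'I_n => (k < m)%N)); last by move=> k; rewrite inE.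
  by rewrite -(big_ord_widen _ (fun=> 1%N) (ltnW mn)) sum1_card card_ord.
have [eta Heta] : exists eta, forall I, I \subset below m -> #|I| = i -> w I = fd eta I.
  (* The part of [w] without [x]. In top degree i = m the cocycle condition on all m + 1 variables
     puts [g x * w (below m)] in the ideal of the first m elements, and regularity removes [g x]; in
     lower degree the induction hypothesis applies. *)
  move: im; rewrite leq_eqVlt => /orP[/eqP im|im].
    have := Hw _ (subx _ (fintype.subxx (below m))) _; rewrite cardx // cb im => /(_ erefl).
    rewrite fd_add // cb -mulrA => E.
    have [eta E'] : exists eta, fd eta (below m) = w (below m).
      apply: ideal_lt_fd; apply: (g_reg (m := x)).
      have -> : g x * w (below m) =
          fd (fun K => (- (-1) ^+ m) * w (x |: K)) (below m).
        rewrite fdZ mulNr; move/eqP: E; rewrite addr_eq0 => /eqP->.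
        by rewrite mulrN opprK signrMK.
      exact: fd_ideal.
    exists eta => I IB Ic.
    by have -> : I = below m by apply/eqP; rewrite eqEcard IB cb Ic leqnn.
  apply: IH => // [|J JB Jc]; first exact: ltnW.
  by apply: Hw => //; exact: sub.
case: i im Hw Heta => [|i] im Hw Heta.
  exists (fun=> 0) => I _ /cards0_eq ->; rewrite Heta ?finset.sub0set ?cards0 //.
  by rewrite /fd !big_set0.
(* The part of [w] divisible by [x], corrected by [eta]: the cocycle condition for [w] on [x |: J]
   says precisely that the corrected form is closed. *)
have [||J JB Jc|zeta Hz] := IH i (fun K => w (x |: K) + (-1) ^+ i.+1 * g x * eta K).
- exact: ltnW.
- exact: im.
- rewrite fdD fdZ -Heta //; have := Hw _ (subx _ JB); rewrite cardx // Jc => /(_ erefl).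
  by rewrite fd_add // Jc.
exists (fun K : {set 'I_n} => if x \in K then zeta (K :\ x) else eta K) => I IB Ic.
have [xI|xI] := boolP (x \in I).
  have [I1 I2 I3] := split_ I IB xI; have Ic' : #|I :\ x| = i by move: I2; rewrite Ic => -[].
  have HI := Hz _ I1 Ic'; rewrite I3 fd_add // (negPf (xN _ I1)) Ic'.
  rewrite (@eq_fd _ zeta) => [|l lI]; last first.
    by rewrite setU11 setU1K //; apply: contra (xN _ I1); rewrite inE => /andP[].
  by rewrite -HI exprS mulN1r !mulNr addrNK.
have I1 := nsplit I IB xI; rewrite Heta //; apply: eq_fd => l lI.
by rewrite ifN // inE negb_and xI orbT.
Qed.

Lemma acyclic_regular i : i <> n -> acyclic_at g i.
Proof.
move=> /eqP; rewrite neq_ltn => /orP[lt|gt]; apply/seteqP; split.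
- move=> w /= w0; have [|||eta He] := @koszul_exact n i (Omega_coef w) => //.
    move=> J _ Jc; have cJ : #|J| == i.+1 by rewrite Jc.
    have := congr1 (fun u : Omega M n i.+1 => u (exist _ J cJ)) w0.
    by rewrite /Omega_d !ffunE.
  have top I : I \subset below n by apply/fintype.subsetP => k _; rewrite inE.
  have wE (I : subset_of_card n i) : w I = fd eta (val I).
    by rewrite -Omega_coefE He //; exact/eqP/(valP I).
  by apply/coboundaryP; exists eta.
- case: i lt => [|i] lt w /=; last by move=> [eta _ <-]; exact: Omega_dd.
  move=> ->; apply/ffunP => I; rewrite /cocycle /Omega_d !ffunE big1 // => l _.
  by rewrite /Omega_coef; case: insub => [J|]; rewrite ?ffunE mulr0.
- have noI (I : subset_of_card n i) : False.
    have := valP I => /eqP E; have := max_card (mem (val I)).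
    by rewrite card_ord E leqNgt gt.
  case: i gt noI => // i gt noI w _; exists 0 => //.
  by apply/ffunP => I; case: (noI I).
- have noI (I : subset_of_card n i.+1) : False.
    have := valP I => /eqP E; have := max_card (mem (val I)).
    by rewrite card_ord E leqNgt ltnS ltnW.
  by move=> w _; apply/ffunP => I; case: (noI I).
Qed.

Lemma cocycle_top (w : Omega M n n) : cocycle g n w.
Proof.
apply/ffunP => I; have := valP I => /eqP E; have := max_card (mem (val I)).
by rewrite card_ord E ltnn.
Qed.

Definition top_form (a : M) : Omega M n n := [ffun=> a].

Fact top_set_subproof : #|[set: 'I_n]%SET| == n. Proof. by rewrite cardsT card_ord. Qed.

Definition top_set : subset_of_card n n := exist (fun I : {set 'I_n} => #|I| == n) [set: 'I_n]%SET top_set_subproof.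

Lemma top_coefE (w : Omega M n n) (I : subset_of_card n n) : w I = top_coef w.
Proof.
rewrite /top_coef -(Omega_coefE w I); congr Omega_coef; apply/eqP.
by rewrite eqEcard finset.subsetT cardsT card_ord (eqP (valP I)) /=.
Qed.

Lemma top_formK a : top_coef (top_form a) = a.
Proof. by rewrite /top_coef (Omega_coefE (top_form a) top_set) ffunE. Qed.

Lemma top_coef_sum (J : finType) (w : J -> Omega M n n) :
  top_coef (\sum_j w j) = \sum_j top_coef (w j).
Proof.
pose T := top_set.
by rewrite -(top_coefE _ T) sum_ffunE; apply: eq_bigr => j _; rewrite top_coefE.
Qed.

Lemma top_coefB (v w : Omega M n n) : top_coef (v - w) = top_coef v - top_coef w.
Proof.
pose T := top_set.
by rewrite -!(top_coefE _ T) !ffunE.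
Qed.

Lemma coboundary_top (w : Omega M n n) : coboundary g n w <-> gen_ideal g (top_coef w).
Proof.
have bn : below n = [set: 'I_n]%SET by apply/setP => k; rewrite !inE ltn_ord.
have gI a : gen_ideal g a <-> ideal_lt n a.
  by split=> -[h ->]; exists h; apply: eq_bigl => l; rewrite ltn_ord.
rewrite gI coboundaryP; split=> [[eta He]|/ideal_lt_fd[eta He]].
  by rewrite -(top_coefE w top_set) He /= -bn; exact: fd_ideal.
exists eta => I; rewrite top_coefE -He bn; congr (fd eta _); apply/eqP.
by rewrite eq_sym eqEcard finset.subsetT cardsT card_ord (eqP (valP I)) /=.
Qed.

End KoszulAcyclic.

Lemma seq_argmin (R : realDomainType) (T : eqType) (t : seq T) (u : T -> R) y : y \in t ->
  exists2 x, x \in t & forall z, z \in t -> u x <= u z.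
Proof.
elim: t y => // a t IH y _; case: t IH => [|b t] IH.
  by exists a; rewrite ?inE // => z; rewrite inE => /eqP->.
have [x xt Hx] := IH b (mem_head _ _); have [ax|xa] := leP (u a) (u x).
  exists a; first exact: mem_head.
  by move=> z; rewrite inE => /orP[/eqP->//|/Hx]; exact: le_trans.
exists x; first by rewrite inE xt orbT.
by move=> z; rewrite inE => /orP[/eqP->|/Hx//]; exact: ltW.
Qed.

Lemma mcoeff_slice (F : fieldType) (K1 K2 : choiceType) (g : {malg F[(K1 * K2)%type]}) z1 z2 :
  (lext (fun y => if y.1 == z1 then << y.2 >> else 0 : {malg F[K2]}) g)@_z2 = g@_(z1, z2).
Proof.
pattern g; apply: malg_ind => [|c g1 g2 H1 H2|[t1 t2] _].
- by rewrite linear0 !mcoeff0.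
- by rewrite lext_is_linear !mcoeffD !mcoeffZ H1 H2.
rewrite lextU scale1r mcoeffU xpair_eqE /=.
by case: (t1 == z1); rewrite ?mcoeffU ?mcoeff0.
Qed.

Lemma mcoeff_bigsum (F : fieldType) (K : choiceType) (J : finType) (G : J -> {malg F[K]}) k :
  (\sum_i G i)@_k = \sum_i (G i)@_k.
Proof. exact: raddf_sum. Qed.

(** * Perturbing the derivatives by terms of higher weight in t *)

Section Perturbation.
Variables (R : realType) (F : fieldType) (K1 K2 : monoid0Type) (u1 : K1 -> R) (u2 : K2 -> R).
Hypothesis u2_ge0 : forall x, 0 <= u2 x.
Hypothesis u1D : forall x y z, zmul x y = Some z -> u1 z = u1 x + u1 y.
Hypothesis u2D : forall x y z, zmul x y = Some z -> u2 z = u2 x + u2 y.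
Local Notation KM := (K1 * K2)%type.
Local Notation Q := (calg F KM).
Local Notation A := (calg F K2).

Lemma u1_one : u1 zone = 0.
Proof. by have /eqP := u1D (zmul1 zone); rewrite -subr_eq subrr => /eqP. Qed.

Lemma u2_one : u2 zone = 0.
Proof. by have /eqP := u2D (zmul1 zone); rewrite -subr_eq subrr => /eqP. Qed.

Definition Fil (v w : R) (g : Q) := forall p, p \in msupp g -> v <= u1 p.1 /\ u1 p.1 + u2 p.2 = w.

Lemma pair_zmulP (p q : KM) z : zmul p q = Some z ->
  zmul p.1 q.1 = Some z.1 /\ zmul p.2 q.2 = Some z.2.
Proof.
rewrite {1}/zmul /= /pair_zmul; case: (zmul p.1 q.1) => // a; case: (zmul p.2 q.2) => // c.
by move=> [<-].
Qed.

Lemma Fil_mul v w v' w' g h : Fil v w g -> Fil v' w' h -> Fil (v + v') (w + w') (g * h).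
Proof.
move=> Hg Hh z /msupp_mul[p [q [/Hg[p1 p2] /Hh[q1 q2] /pair_zmulP[z1 z2]]]].
by rewrite (u1D z1) (u2D z2); split; [exact: lerD|rewrite addrACA p2 q2].
Qed.

Lemma Fil_lin v w c g h : Fil v w g -> Fil v w h -> Fil v w (c *: g + h).
Proof.
move=> Hg Hh p /(fsubsetP (msuppD_le _ _)); rewrite inE => /orP[|/Hh//].
by move=> /(fsubsetP (msuppZ_le _ _))/Hg.
Qed.

Lemma FilD v w g h : Fil v w g -> Fil v w h -> Fil v w (g + h).
Proof. by move=> Hg Hh; rewrite -[g]scale1r; exact: Fil_lin. Qed.

Lemma Fil_mono v v' w g : v' <= v -> Fil v w g -> Fil v' w g.
Proof. by move=> vv Hg p /Hg[p1 p2]; split=> //; exact: le_trans p1. Qed.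

Lemma Fil_X p v w : v <= u1 p.1 -> u1 p.1 + u2 p.2 = w -> Fil v w (cX p).
Proof. by move=> h1 h2 q; rewrite msuppX => /eqP->. Qed.

Definition iext : A -> Q := lext (fun mu => cX (zone : K1, mu)).

Lemma iext_lin : linear iext. Proof. exact: lext_is_linear. Qed.

Lemma iextX mu : iext (cX mu) = cX (zone, mu).
Proof. by rewrite /iext lextU scale1r. Qed.

Lemma cX_pairM (x y : K1) (mu nu : K2) : cX (x, mu) * cX (y, nu) =
  (if zmul x y is Some a then if zmul mu nu is Some c then cX (a, c) else 0 else 0) :> Q.
Proof.
rewrite cXM [zmul (x, mu) _]/zmul /= /pair_zmul /=.
by case: (zmul x y) => // a; case: (zmul mu nu).
Qed.

Lemma iextM (g h : A) : iext (g * h) = iext g * iext h.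
Proof.
rewrite (calg_sumE g) (calg_sumE h) mulr_suml !(linear_comb iext_lin).
rewrite mulr_suml; pose T (a : K2) := \sum_(c <- msupp h) (g@_a * h@_c) *: (iext (cX a * cX c)).
transitivity (\sum_(a <- msupp g) T a).
  have Lsum (J : Type) (s : seq J) (G : J -> A) :
      iext (\sum_(j <- s) G j) = \sum_(j <- s) iext (G j).
    exact: lext_sum.
  rewrite Lsum; apply: eq_bigr => a _; rewrite mulr_sumr Lsum; apply: eq_bigr => c _.
  rewrite -scalerAl -scalerAr scalerA -[X in iext X]addr0 iext_lin.
  by rewrite (_ : iext 0 = 0) ?addr0 //; exact: linear0.
apply: eq_bigr => a _; rewrite /T mulr_sumr; apply: eq_bigr => c _.
rewrite -scalerAl -scalerAr scalerA; congr (_ *: _); rewrite !iextX cX_pairM zmul1 cXM.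
case: (zmul a c) => [d|]; first exact: iextX.
exact: linear0.
Qed.

Lemma iext1 : iext 1 = 1.
Proof. exact: iextX. Qed.

Definition gshift (x : K1) : A -> Q := lext (fun mu => cX (x, mu)).

Lemma gshiftE x g : cX (x, zone) * iext g = gshift x g.
Proof.
rewrite [in LHS](calg_sumE g) (linear_comb iext_lin) mulr_sumr /gshift /lext.
apply: eq_bigr => mu _; rewrite -scalerAr iextX cX_pairM zmulC zmul1 zmul1.
by [].
Qed.

Variables (n r : nat) (D : 'I_n -> A) (E DG : 'I_n -> Q) (delta : R) (b : 'I_r -> K2).
Hypothesis delta_gt0 : 0 < delta.
Hypothesis D_wt : forall l mu, mu \in msupp (D l) -> u2 mu = 1.
Hypothesis E_fil : forall l, Fil delta 1 (E l).
Hypothesis DGE : forall l, DG l = iext (D l) + E l.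
Local Notation KK := ({ffun 'I_n -> nat} * 'I_r)%type.
Definition tdegR (x : KK) : R := (\sum_i x.1 i)%:R + u2 (b x.2).
Definition bas (x : KK) : A := (\prod_i D i ^+ x.1 i) * cX (b x.2).
Hypothesis bas_inj : forall g : {malg F[KK]}, lext bas g = 0 -> g = 0.
Hypothesis bas_span : forall mu : K2,
  sp [set bas x | x in [set x | tdegR x = u2 mu]] (cX mu : A).

Definition congF w (g h : Q) := [/\ Fil 0 w g, Fil 0 w h & Fil delta w (g - h)].

Lemma congF_mul w w' g h g' h' : congF w g h -> congF w' g' h' -> congF (w + w') (g * g') (h * h').
Proof.
move=> [g0 h0 gh] [g'0 h'0 gh']; split.
- by have := Fil_mul g0 g'0; rewrite addr0.
- by have := Fil_mul h0 h'0; rewrite addr0.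
have -> : g * g' - h * h' = (g - h) * g' + h * (g' - h').
  by rewrite mulrBl mulrBr addrA subrK.
apply: FilD; first by rewrite -(addr0 delta); exact: Fil_mul.
by rewrite -(add0r delta); exact: Fil_mul.
Qed.

Lemma Fil0 v w : Fil v w 0. Proof. by move=> p; rewrite msupp0. Qed.

Lemma congF_refl w g : Fil 0 w g -> congF w g g.
Proof. by move=> Hg; split=> //; rewrite subrr; exact: Fil0. Qed.

Lemma congF_DG l : congF 1 (DG l) (iext (D l)).
Proof.
have H0 : Fil 0 1 (iext (D l)).
  move=> p /msupp_lext[mu /D_wt mE]; rewrite msuppX => /eqP-> /=.
  by rewrite mE u1_one add0r.
split=> //; rewrite DGE; last by rewrite addrC addKr; exact: E_fil.
by apply: FilD => //; apply: Fil_mono (@E_fil l); exact: ltW.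
Qed.

Lemma congF_one : congF 0 1 1.
Proof.
by apply: congF_refl; apply: Fil_X; rewrite /= ?u1_one ?u2_one ?addr0.
Qed.

Lemma congF_exp l m : congF m%:R (DG l ^+ m) (iext (D l) ^+ m).
Proof.
elim: m => [|m IH]; first by rewrite !expr0; exact: congF_one.
rewrite !exprS -natr1 addrC; apply: congF_mul => //; exact: congF_DG.
Qed.

Lemma congF_prod (k : {ffun 'I_n -> nat}) :
  congF (\sum_i k i)%:R (\prod_i DG i ^+ k i) (\prod_i iext (D i) ^+ k i).
Proof.
rewrite natr_sum; elim/big_rec3: _ => [|i g h w _ H]; first exact: congF_one.
by apply: congF_mul => //; exact: congF_exp.
Qed.

Local Notation KT := (K1 * KK)%type.

Definition Th (y : KT) : Q := cX (y.1, zone) * (\prod_i DG i ^+ y.2.1 i * cX (zone, b y.2.2)).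

Lemma iext_bas x : iext (bas x) = \prod_i iext (D i) ^+ x.1 i * cX (zone, b x.2).
Proof.
rewrite /bas iextM iextX; congr (_ * _).
have iexp g m : iext (g ^+ m) = iext g ^+ m.
  by elim: m => [|m IH]; rewrite ?expr0 ?iext1 // !exprS iextM IH.
by rewrite (big_morph iext iextM iext1); apply: eq_bigr => i _; exact: iexp.
Qed.

Lemma Th_diff y : Fil (u1 y.1 + delta) (u1 y.1 + tdegR y.2) (Th y - gshift y.1 (bas y.2)).
Proof.
rewrite -gshiftE iext_bas /Th -mulrBr.
have [_ _ H] : congF (tdegR y.2) (\prod_i DG i ^+ y.2.1 i * cX (zone, b y.2.2))
    (\prod_i iext (D i) ^+ y.2.1 i * cX (zone, b y.2.2)).
  apply: congF_mul; first exact: congF_prod.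
  by apply: congF_refl; apply: Fil_X; rewrite /= u1_one ?add0r.
by apply: Fil_mul H; apply: Fil_X; rewrite /= ?u2_one ?addr0.
Qed.

(** Replacing a product of unperturbed elements by its perturbed version costs terms of the same
    total weight and of t-weight larger by [delta], so their x-weight drops by [delta]. As x-weights
    are nonnegative, this stops. *)
Lemma Th_spanX p : sp (range Th) (cX p : Q).
Proof.
have [N] : exists N : nat, u2 p.2 < delta *+ N.
  exists (Num.bound (u2 p.2 / delta)); rewrite -mulr_natr mulrC -ltr_pdivrMr //.
  by apply: archi_boundP; rewrite divr_ge0 // ltW.
elim: N p => [|N IH] [x mu] /= H; first by have := u2_ge0 mu; rewrite leNgt H.
have -> : cX (x, mu) = gshift x (cX mu) :> Q by rewrite /gshift lextU scale1r.
have : sp [set bas x | x in [set x | tdegR x = u2 mu]] (cX mu : A) by exact: bas_span.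
apply: sp_lin; first exact: lext_is_linear.
move=> _ [y yE <-]; have Hd := @Th_diff (x, y); rewrite /= in Hd.
rewrite -[gshift x (bas y)](subKr (Th (x, y))); apply: spB.
  by apply: sp_sub; exists (x, y).
rewrite (calg_sumE (_ - _)) [X in sp _ X]big_seq; apply: sp_sum => p /Hd[p1 p2].
apply: spZ; apply: IH; move: H p1 p2; rewrite (yE : tdegR y = _) mulrS; lra.
Qed.

Lemma Th_span g : exists c : {malg F[KT]}, g = lext Th c.
Proof.
have : sp (range Th) g.
  by rewrite (calg_sumE g); apply: sp_sum => p _; apply: spZ; exact: Th_spanX.
move=> /(_ [set g | exists c : {malg F[KT]}, g = lext Th c]); apply.
  split; first by exists 0; exact: esym (linear0 _).
  move=> c _ _ [g1 ->] [g2 ->]; exists (c *: g1 + g2); exact: esym (lext_is_linear _ _ _ _).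
by move=> _ [y _ <-]; exists << y >>; rewrite lextU scale1r.
Qed.

(** Take a term of least t-weight and read off the coefficient of its t-monomial. Perturbations land
    in strictly larger t-weight, so what remains is a relation among the unperturbed [bas x]. *)
Lemma Th_inj (g : {malg F[KT]}) : lext Th g = 0 -> g = 0.
Proof.
move=> g0; apply/malgP => y; rewrite mcoeff0; apply/eqP; apply: contraT => gy.
have {gy}yg : y \in msupp g by rewrite -mcoeff_neq0.
have [z zg zmin] := seq_argmin (fun y : KT => u1 y.1) yg.
pose ex : Q -> A := lext (fun p => if p.1 == z.1 then cX p.2 else 0).
have ex_lin : linear ex by exact: lext_is_linear.
pose sl : {malg F[KT]} -> {malg F[KK]} := lext (fun y => if y.1 == z.1 then << y.2 >> else 0).
have exTh t : t \in msupp g -> ex (Th t) = if t.1 == z.1 then bas t.2 else 0.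
  move=> tg; have -> : Th t = (Th t - gshift t.1 (bas t.2)) + gshift t.1 (bas t.2) by rewrite subrK.
  rewrite [ex _](lextD _) [X in X + _](_ : _ = 0) ?add0r; last first.
    rewrite /lext big_seq big1 // => p /(Th_diff (y := t))[p1 _].
    case: eqP => [pz|_]; last by rewrite scaler0.
    by exfalso; have := zmin t tg; move: p1 delta_gt0; rewrite pz; lra.
  apply: etrans (lext_comp (fun mu => cX (t.1, mu) : Q) (bas t.2) ex_lin) _.
  case: eqP => [tz|tz].
    rewrite -[RHS]lext_id; apply: eq_lext => mu _; rewrite /= /ex lextU scale1r /= tz eqxx.
    by [].
  rewrite /lext big1 // => mu _; rewrite /= /ex lextU scale1r /=.
  by case: eqP => // _; rewrite scaler0.
have sl0 : sl g = 0.
  apply: bas_inj; rewrite /sl (lext_comp _ _ (lext_is_linear _)).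
  have : ex (lext Th g) = 0 by rewrite g0; exact: linear0.
  rewrite (lext_comp _ _ ex_lin) => <-; apply: eq_lext => t tg.
  rewrite /= (exTh _ tg); case: eqP => _; first by rewrite lextU scale1r.
  exact: linear0.
have : (sl g)@_z.2 = g@_z.
  by rewrite (mcoeff_slice g z.1 z.2); case: (z).
rewrite sl0 mcoeff0 => /esym/eqP; rewrite mcoeff_eq0 zg.
by [].
Qed.

Definition kpos m (k : {ffun 'I_n -> nat}) := [exists i : 'I_n, (i < m)%N && (0 < k i)%N].

Definition kshift l (y : KT) : KT := (y.1, (kadd (kone l) y.2.1, y.2.2)).

Lemma DG_Th l y : DG l * Th y = Th (kshift l y).
Proof.
rewrite /Th /= mulrCA; congr (_ * _); rewrite mulrA; congr (_ * _).
rewrite [in RHS](eq_bigr (fun i => DG i ^+ (i == l) * DG i ^+ y.2.1 i)); last first.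
  by move=> i _; rewrite !ffunE exprD.
rewrite big_split /=; congr (_ * _).
rewrite (bigD1 l) //= eqxx expr1 big1 ?mulr1 // => i /negPf->.
exact: expr0.
Qed.

(** In the basis [Th], multiplication by [DG l] merely raises the exponent [l], so these ideals are
    spanned by basis elements. *)
Lemma ideal_Th m (c : {malg F[KT]}) :
  ideal_lt DG m (lext Th c) <-> forall y, y \in msupp c -> kpos m y.2.1.
Proof.
split=> [[h hE]|H].
  have /choice[c' hc] : forall l, exists c' : {malg F[KT]}, h l = lext Th c'.
    by move=> l; exact: Th_span.
  pose c2 : {malg F[KT]} := \sum_(l < n | (l < m)%N) lext (fun y => << kshift l y >>) (c' l).
  have E2 : c - c2 = 0.
    apply: Th_inj; rewrite (raddfB (lext Th)) /= hE /c2 lext_sum; apply/eqP; rewrite subr_eq0.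
    apply/eqP; apply: eq_bigr => l _; rewrite hc (lext_comp _ _ (lext_is_linear _)).
    rewrite /lext mulr_sumr; apply: eq_bigr => y _.
    rewrite -scalerAr DG_Th; congr (_ *: _); apply: esym; exact: etrans (lextU _ _ _) (scale1r _).
  move=> y; move/eqP: E2; rewrite subr_eq0 => /eqP->.
  have : forall z, z \in msupp c2 -> kpos m z.2.1.
    rewrite /c2; elim/big_rec: _ => [z|l g lm Hg z]; first by rewrite msupp0.
    move=> /(fsubsetP (msuppD_le _ _)); rewrite inE => /orP[|/Hg//].
    move=> /msupp_lext[t _]; rewrite msuppU oner_eq0 inE => /eqP->; apply/existsP; exists l.
    by rewrite lm /= !ffunE eqxx.
  exact.
have sub : submodp (ideal_lt DG m : set Q).
  split; first by exists (fun=> 0); rewrite big1 // => l _; rewrite mulr0.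
  move=> a _ _ [h1 ->] [h2 ->]; exists (fun l => a *: h1 l + h2 l).
  rewrite scaler_sumr -big_split; apply: eq_bigr => l _; exact: esym (algLr _ _ _ _).
have : sp (ideal_lt DG m) (lext Th c).
  rewrite /lext [X in sp _ X]big_seq; apply: sp_sum => y /H/existsP[i /andP[im ki]].
  apply: spZ; apply: sp_sub.
  pose k' : {ffun 'I_n -> nat} := [ffun j => (y.2.1 j - (j == i))%N].
  exists (fun l => if l == i then Th (y.1, (k', y.2.2)) else 0).
  rewrite (bigD1 i) //= eqxx [X in _ = _ + X]big1 ?addr0 => [|l /andP[_ /negPf->]]; last exact: mulr0.
  have kE : kadd (kone i) k' = y.2.1.
    apply/ffunP => l; rewrite !ffunE; case: eqP => [->|_]; last by rewrite subn0.
    by rewrite subnKC.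
  apply: esym; apply: etrans (DG_Th i (y.1, (k', y.2.2))) _.
  by rewrite /kshift /= kE; case: (y) => ? [].
by apply.
Qed.

(** Raising the exponent [m] does not affect whether an exponent below [m] is positive. *)
Lemma DG_regular : regular_seq DG.
Proof.
move=> m a; have [c ->] := Th_span a.
have -> : DG m * lext Th c =
    lext Th (lext (fun y : KT => << kshift m y >>) c : {malg F[KT]}).
  rewrite (lext_comp _ _ (lext_is_linear _)) /lext mulr_sumr; apply: eq_bigr => y _.
  rewrite -scalerAr DG_Th; congr (_ *: _); apply: esym; exact: etrans (lextU _ _ _) (scale1r _).
move=> /ideal_Th H; apply/ideal_Th => y yc.
have h_inj : injective (kshift m).
  move=> [x [k j]] [x' [k' j']] [-> /ffunP EE ->]; congr (_, (_, _)); apply/ffunP => i.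
  by have := EE i; rewrite !ffunE => /addnI.
have : kshift m y \in msupp (lext (fun y => << kshift m y >>) c : {malg F[KT]}).
  by rewrite -mcoeff_neq0 mcoeff_lextU // mcoeff_neq0.
move=> /H/existsP[i /andP[im]]; rewrite /kshift /= !ffunE => ki; apply/existsP; exists i.
by move: ki; rewrite im /=; case: eqP => [E'|_] //; move: im; rewrite E' ltnn.
Qed.

Definition bi_scaleE (a : calg F K1) (m : biAlg F K1 K2) : a *: m = bi_emb K2 a * m := erefl.

Lemma bi_embX a : bi_emb K2 a = lext (fun x => cX (x, zone) : Q) a.
Proof. by rewrite /lext /bi_emb; apply: eq_bigr => x _; exact: malgUZ. Qed.

Lemma kpos_n k : kpos n k = (k != [ffun=> 0%N]).
Proof.
apply/existsP/idP => [[i /andP[_ ki]]|k0].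
  by apply: contraTN ki => /eqP->; rewrite ffunE.
apply: contrapT => no; move/eqP: k0; apply; apply/ffunP => i; rewrite ffunE.
by apply/eqP; rewrite -leqn0 leqNgt; apply/negP => ki; apply: no; exists i; rewrite ltn_ord.
Qed.

Lemma Th0 x j : Th (x, ([ffun=> 0%N], j)) = cX (x, zone) * cX (zone, b j).
Proof.
by rewrite /Th /= big1 ?mul1r // => i _; rewrite ffunE expr0.
Qed.

Definition bX j : biAlg F K1 K2 := cX (zone, b j).

Lemma comb_Th (c : 'I_r -> calg F K1) : \sum_j c j *: bX j =
  lext Th (\sum_j lext (fun x => << (x, ([ffun=> 0%N], j)) >>) (c j)) :> Q.
Proof.
rewrite lext_sum; apply: eq_bigr => j _; rewrite bi_scaleE bi_embX.
rewrite (lext_comp _ _ (lext_is_linear _)) /lext mulr_suml; apply: eq_bigr => x _.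
apply: etrans (esym (scalerAl (c j)@_x (cX (x, zone) : Q) (cX (zone, b j)))) _.
apply: (congr1 (fun z : Q => (c j)@_x *: z)); apply: esym.
exact: etrans (etrans (lextU Th 1 (x, ([ffun=> 0%N], j))) (scale1r _)) (Th0 x j).
Qed.

Lemma gen_idealE (a : Q) : gen_ideal DG a <-> ideal_lt DG n a.
Proof. by split=> -[h ->]; exists h; apply: eq_bigl => l; rewrite ltn_ord. Qed.

Lemma mcoeff_slices (c : 'I_r -> {malg F[K1]}) x j :
  (\sum_i lext (fun x => << (x, ([ffun=> 0%N], i)) >> : {malg F[KT]}) (c i))@_(x, ([ffun=> 0%N], j))
  = (c j)@_x.
Proof.
have H i (g : {malg F[K1]}) : (lext (fun x => << (x, ([ffun=> 0%N], i)) >> : {malg F[KT]}) g)@_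
    (x, ([ffun=> 0%N], j)) = if i == j then g@_x else 0.
  pattern g; apply: malg_ind => [|a g1 g2 H1 H2|y _].
  - by rewrite linear0 !mcoeff0 if_same.
  - by rewrite lext_is_linear !mcoeffD !mcoeffZ H1 H2; case: ifP; rewrite // mulr0 addr0.
  rewrite lextU scale1r !mcoeffU !xpair_eqE eqxx /=.
  by case: (i == j); rewrite ?andbT ?andbF.
rewrite mcoeff_bigsum (eq_bigr (fun i => if i == j then (c i)@_x else 0)).
  by rewrite -big_mkcond big_pred1_eq.
by move=> i _; exact: H.
Qed.

Lemma bX_indep (c : 'I_r -> calg F K1) :
  gen_ideal DG (\sum_j c j *: bX j : Q) -> forall j, c j = 0.
Proof.
rewrite gen_idealE comb_Th => /ideal_Th H j; apply/malgP => x; rewrite mcoeff0.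
apply/eqP; apply: contraT => cx; have := H (x, ([ffun=> 0%N], j)).
rewrite kpos_n /= eqxx => /(_ _)/negP; case => //; rewrite -mcoeff_neq0.
by rewrite (mcoeff_slices c x j).
Qed.

(** The coordinates with zero exponent in all [DG i] give the coefficients; the others lie in the
    ideal by [ideal_Th]. *)
Lemma bX_span (a : biAlg F K1 K2) : exists c : 'I_r -> calg F K1,
  gen_ideal DG (a - \sum_j c j *: bX j : Q).
Proof.
have [g gE] := Th_span a.
pose c j : calg F K1 := lext (fun y : KT =>
  if (y.2.1 == [ffun=> 0%N]) && (y.2.2 == j) then << y.1 >> else 0) g.
exists c; rewrite gen_idealE comb_Th [X in ideal_lt _ _ (X - _)]gE.
rewrite -[X in ideal_lt _ _ X](raddfB (lext Th)) /=; apply/ideal_Th => y.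
rewrite kpos_n -mcoeff_neq0; apply: contraNneq => y0; rewrite mcoeffB subr_eq0; apply/eqP.
have -> : \sum_j lext (fun x => << (x, ([ffun=> 0%N], j)) >>) (c j) =
    lext (fun y : KT => if y.2.1 == [ffun=> 0%N] then << y >> else 0) g :> {malg F[KT]}.
  rewrite /c; move: g {gE c}=> g.
  pattern g; apply: malg_ind => [|a1 g1 g2 H1 H2|t _].
  - by rewrite linear0 big1 // => j _; rewrite !linear0.
  - rewrite lext_is_linear -H1 -H2 scaler_sumr -big_split; apply: eq_bigr => j _.
    by rewrite !lext_is_linear.
  rewrite lextU scale1r (bigD1 t.2.2) //= [X in _ + X]big1 ?addr0 => [|j jt].
    rewrite lextU scale1r eqxx andbT; case: eqP => [E'|_]; last by rewrite linear0.
    by rewrite lextU scale1r -E'; case: (t) => ? [].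
  by rewrite lextU scale1r [t.2.2 == j]eq_sym (negPf jt) andbF linear0.
move: g {gE c} => g; pattern g; apply: malg_ind => [|a1 g1 g2 H1 H2|t _].
- by rewrite linear0 mcoeff0.
- by rewrite lext_is_linear !mcoeffD !mcoeffZ H1 H2.
rewrite lextU scale1r; case: eqP => // t0; rewrite mcoeff0 mcoeffU.
by case: eqP => // ty; case: t0; rewrite ty.
Qed.

End Perturbation.

(** * Asymptotic comparison, lattice points in boxes, and the volume *)

Section Asymptotics.
Variable R : realType.

Lemma bernoulli_ge (u : R) m : 0 <= u <= 1 -> 1 - m%:R * u <= (1 - u) ^+ m.
Proof.
move=> /andP[u0 u1]; elim: m => [|m IH]; first by rewrite mul0r subr0 expr0.
have v0 : 0 <= 1 - u by rewrite subr_ge0.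
rewrite exprS; apply: le_trans (ler_wpM2l v0 IH).
have m0 : 0 <= m%:R * u * u by rewrite !mulr_ge0 // ler0n.
have -> : (1 - u) * (1 - m%:R * u) = 1 - m.+1%:R * u + m%:R * u * u by rewrite -natr1; ring.
by rewrite lerDl.
Qed.

Lemma pow_ratio_le n c T0 (x y : R) : 0 <= x ->
  (forall t : nat, (T0 <= t)%N -> x * t%:R ^+ n <= y * (t + c)%:R ^+ n) -> x <= y.
Proof.
move=> x0 H; rewrite leNgt; apply/negP => yx.
(* Past [B], x n c / s < x - y. With s = t + c, Bernoulli bounds (t / s)^n below by 1 - n c / s,
   which contradicts the hypothesis. *)
pose B := x * n%:R * c%:R / (x - y).
have xy0 : 0 < x - y by rewrite subr_gt0.
have B0 : 0 <= B by rewrite divr_ge0 ?mulr_ge0 // ?ler0n // ltW.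
pose t := (T0 + Num.bound B).+1.
have tB : B < t%:R.
  apply: lt_le_trans (archi_boundP B0) _; rewrite ler_nat /t.
  by apply: leqW; exact: leq_addl.
have tT : (T0 <= t)%N by rewrite /t; apply: leqW; exact: leq_addr.
have := H t tT; set s := ((t + c)%:R : R).
have s0 : 0 < s by rewrite ltr0n addn_gt0.
have sn : s != 0 by rewrite gt_eqF.
have ts : t%:R = s * (1 - c%:R / s) :> R.
  by rewrite mulrBr mulr1 mulrCA divff // mulr1 /s natrD addrK.
rewrite ts exprMn mulrCA [y * _]mulrC ler_pM2l ?exprn_gt0 //.
have u1 : 0 <= c%:R / s <= 1.
  rewrite divr_ge0 ?ler0n ?(ltW s0) //= ler_pdivrMr // mul1r /s ler_nat; exact: leq_addl.
move=> xy; have := ler_wpM2l x0 (bernoulli_ge n u1) => /le_trans/(_ xy).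
rewrite mulrBr mulr1 lerBlDr -lerBlDl leNgt => /negP; apply.
have : B < s by apply: lt_le_trans tB _; rewrite /s ler_nat; exact: leq_addr.
rewrite /B ltr_pdivrMr // => h.
rewrite -(ltr_pM2r s0) (_ : x * (n%:R * (c%:R / s)) * s = x * n%:R * c%:R); last first.
  by rewrite -!mulrA mulVf // mulr1.
by rewrite [(x - y) * s]mulrC.
Qed.

Lemma prod_perturb (T : Type) (s : seq T) (len : T -> R) e : (forall i, 0 <= len i) -> 0 < e ->
  exists2 e0, 0 < e0 & forall e', 0 <= e' <= e0 ->
    \prod_(i <- s) (len i + e') <= \prod_(i <- s) len i + e.
Proof.
move=> len0; elim: s e => [|a s IH] e e_gt0.
  by exists 1 => // e' _; rewrite !big_nil lerDl ltW.
set Q := \prod_(i <- s) len i; have Q0 : 0 <= Q by exact: prodr_ge0.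
pose d := e / 2 / (len a + 1).
have l1 : 0 < len a + 1 by rewrite ltr_wpDl.
have e2 : 0 < e / 2 by rewrite divr_gt0.
have d0 : 0 < d by rewrite divr_gt0.
have [e1 e1_gt0 He1] := IH d d0.
have Q1 : 0 < Q + 1 by rewrite ltr_wpDl.
exists (Num.min (Num.min e1 1) (e / 2 / (Q + 1))).
  by rewrite !lt_min e1_gt0 ltr01 divr_gt0.
move=> e'; rewrite !le_min => /andP[e'0 /andP[/andP[e'1 e'2] e'3]].
rewrite !big_cons -/Q; have He := He1 e'; rewrite e'0 e'1 in He; have {}He := He isT.
have la : 0 <= len a + e' by rewrite addr_ge0.
apply: le_trans (ler_wpM2l la He) _; rewrite -/Q.
have h1 : e' * (Q + 1) <= e / 2 by move: e'3; rewrite ler_pdivlMr.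
have h2 : (len a + e') * d <= e / 2.
  apply: (@le_trans _ _ ((len a + 1) * d)); first by rewrite ler_wpM2r ?lerD2l // ltW.
  by rewrite /d mulrC divfK // gt_eqF.
have h3 : e' * Q <= e / 2 by apply: le_trans h1; rewrite mulrDr mulr1 lerDl.
have -> : (len a + e') * (Q + d) = len a * Q + (e' * Q + (len a + e') * d) by ring.
rewrite lerD2l [leRHS](_ : _ = e / 2 + e / 2); last by field.
exact: lerD.
Qed.

End Asymptotics.

Section SimplexCount.
Variable n : nat.
Local Notation one1 := (fun _ : 'I_n => 1%N).

Lemma kC_bin t : kC one1 t = 'C(n + t, n).
Proof.
rewrite -card_partial_ord_partitions cardE /kC.
pose h (u : n.-tuple 'I_t.+1) : {ffun 'I_n -> nat} := [ffun i => tnth u i : nat].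
rewrite -(size_map h); apply/perm_size/uniq_perm.
- exact: uniq_kap.
- rewrite map_inj_uniq ?enum_uniq // => u u' /ffunP E; apply: eq_from_tnth => i.
  by apply: val_inj; have := E i; rewrite !ffunE.
have wtE k : wt one1 k = (\sum_i k i)%N by apply: eq_bigr => i _; rewrite mul1n.
move=> k; rewrite mem_kap // wtE; apply/idP/mapP => [kt|[u]].
  have kb i : (k i < t.+1)%N by rewrite ltnS; apply: leq_trans kt; rewrite (bigD1 i) //= leq_addr.
  exists [tuple Ordinal (kb i) | i < n]; last by apply/ffunP => i; rewrite ffunE tnth_mktuple.
  rewrite mem_enum inE big_tuple; under eq_bigr do rewrite tnth_mktuple.
  by [].
rewrite mem_enum inE big_tuple => ut ->.
by under eq_bigr do rewrite ffunE.
Qed.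

Lemma kC_fact_le t : (kC one1 t * n`! <= (t + n) ^ n)%N.
Proof.
rewrite kC_bin bin_ffact ffact_prod addnC -[X in (_ ^ X)%N]card_ord -prod_nat_const.
by apply: leq_prod => i _; exact: leq_subr.
Qed.

Lemma kC_fact_ge t : (t ^ n <= kC one1 t * n`!)%N.
Proof.
rewrite kC_bin bin_ffact ffact_prod -[X in (_ ^ X)%N]card_ord -prod_nat_const.
by apply: leq_prod => i _; have := ltn_ord i; lia.
Qed.

End SimplexCount.

Lemma box_count (R : realType) (n : nat) (s : seq 'rV[int]_n) (A B : 'I_n -> R) :
  uniq s -> (forall mu, mu \in s -> forall i, A i <= (mu 0 i)%:~R <= B i) ->
  (size s)%:R <= \prod_i (Num.max 0 (B i - A i) + 1).
Proof.
move=> us H; case: s us H => [|mu0 s] us H.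
  by apply: prodr_ge0 => i _; rewrite addr_ge0 // le_max lexx.
set S := mu0 :: s.
pose lo i := Num.ceil (A i); pose hi i := Num.floor (B i).
pose m i := `|(hi i - lo i)%R|.+1%N.
have lohi mu i : mu \in S -> lo i <= mu 0 i <= hi i.
  by move=> /H/(_ i)/andP[h1 h2]; rewrite /lo /hi ceil_le_int_tmp h1 floor_ge_int_tmp h2.
pose h (mu : 'rV[int]_n) : {dffun forall i : 'I_n, 'I_(m i)} := [ffun i => inord `|(mu 0 i - lo i)%R|%N].
have h_inj : {in S &, injective h}.
  move=> mu nu muS nuS /ffunP E; apply/rowP => i.
  have /(congr1 val) := E i; rewrite !ffunE /=.
  have /andP[m1 m2] := lohi mu i muS; have /andP[n1 n2] := lohi nu i nuS.
  have b1 : (`|(mu 0 i - lo i)%R| < `|(hi i - lo i)%R|.+1)%N by move: m1 m2; lia.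
  have b2 : (`|(nu 0 i - lo i)%R| < `|(hi i - lo i)%R|.+1)%N by move: n1 n2; lia.
  rewrite (inordK b1) (inordK b2).
  by move=> /(congr1 Posz); rewrite !gez0_abs ?subr_ge0 // => /addIr.
have le : (size S <= \prod_i m i)%N.
  have -> : (\prod_i m i)%N = #|{dffun forall i : 'I_n, 'I_(m i)}|.
    rewrite card_dep_ffun foldrE big_map big_enum /=.
    by apply: eq_bigr => i _; rewrite card_ord.
  rewrite cardT -(size_map h); apply: uniq_leq_size; first by rewrite map_inj_in_uniq.
  by move=> x _; rewrite mem_enum.
apply: (@le_trans _ _ (\prod_i m i)%N%:R); first by rewrite ler_nat.
rewrite natr_prod; apply: ler_prod => i _; rewrite ler0n /=.
have /andP[m1 m2] := lohi mu0 i (mem_head _ _).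
have lh : lo i <= hi i by exact: le_trans m1 m2.
rewrite /m -natr1 lerD2r le_max; apply/orP; right.
have -> : `|(hi i - lo i)%R|%N%:R = (hi i)%:~R - (lo i)%:~R :> R.
  by rewrite -intrB -[in RHS](gez0_abs (_ : 0 <= hi i - lo i)) // subr_ge0.
apply: lerB; first exact: floor_le.
by have /andP[] := ceil_itv (A i).
Qed.

Section ContinuousFunctions.
Variables (R : realType) (T : topologicalType).

Lemma continuous_lincomb (I : Type) (r : seq I) (c : I -> R) (d : R) (g : I -> T -> R) :
  (forall i, continuous (g i)) -> continuous (fun x => \sum_(i <- r) c i * g i x + d).
Proof.
move=> gc x; apply: cvgD; last exact: cvg_cst.
elim: r => [|j r IH].
  have -> : (fun x => \sum_(i <- [::]) c i * g i x) = cst 0 by apply/funext => y; rewrite big_nil.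
  by rewrite big_nil; exact: cvg_cst.
have -> : (fun x => \sum_(i <- j :: r) c i * g i x) =
    (fun x => c j * g j x) \+ (fun x => \sum_(i <- r) c i * g i x).
  by apply/funext => y; rewrite big_cons.
rewrite big_cons; apply: cvgD; last exact: IH.
by apply: cvgM; [exact: cvg_cst|exact: gc].
Qed.

Lemma continuous_near_itv (g : T -> R) x a b : continuous g -> a < g x < b ->
  \forall y \near x, a < g y < b.
Proof.
move=> gc /andP[h1 h2].
have n1 : \forall y \near x, a < g y by apply: (cvgr_gt (g x)) h1; exact: gc.
have n2 : \forall y \near x, g y < b by apply: (cvgr_lt (g x)) h2; exact: gc.
by near=> y; apply/andP; split; near: y.
Unshelve. all: by end_near.
Qed.

End ContinuousFunctions.

Section Volume.
Variables (R : realType) (F : finFieldType) (n : nat) (f : {malg F['rV[int]_n]}).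
Local Notation l := (msupp f : seq _).
Local Notation D := (Delta R f).
Variable s : seq ('rV[int]_n * int).
Hypothesis Hs : forall (u : 'rV[R]_n) k, hceil l u k <-> sat s u k.
Local Notation Dw := (@wden n s).
Local Notation EP := (@expsP R F n f).
Local Notation K := (conept (exps R f)).
Local Notation wz := (@wz R F n f s).
Local Notation cpts := (@cpts R F n f s).

Lemma Delta_sat x : D x <-> sat s x 1.
Proof.
split=> [/(hull0_hceil Hs EP (fset_uniq _))/Hs//|].
by move=> /(sat_hullP Hs EP (fset_uniq _))[_ [y Dy ->]]; rewrite scale1r.
Qed.

Lemma sat_le (u : 'rV[R]_n) k k' : k <= k' -> sat s u k -> sat s u k'.
Proof. by move=> kk /Hs[c [c0 uE ck]]; apply/Hs; exists c; split=> //; exact: le_trans ck kk. Qed.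

Lemma satZ (c : R) x : 0 <= c -> D x -> sat s (c *: x) c.
Proof. by move=> c0 Dx; apply/(sat_hullP Hs EP (fset_uniq _)); split=> //; exists x. Qed.

Lemma satD (u v : 'rV[R]_n) k k' : sat s u k -> sat s v k' -> sat s (u + v) (k + k').
Proof. by move=> Hu Hv a as_; rewrite fevD addr_ge0 ?Hu ?Hv. Qed.

Lemma sat0 : sat s (0 : 'rV[R]_n) 0. Proof. by move=> a _; rewrite fev0. Qed.

Lemma cpts_sat t (mu : K) : (mu \in cpts t) <-> sat s (toR R mu) t%:R.
Proof.
have DR := DwR_gt0 R s; have E : (Dw * t)%N%:R / Dw%:R = t%:R :> R.
  by rewrite natrM mulrC mulKf // gt_eqF.
rewrite (mem_cpts Hs); split=> [H|H].
  have := cone_conem Hs (coneptP mu) H => /(conemP R) /=.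
  by rewrite -[_%:~R]/((Dw * t)%N%:R) E.
have M : conem (@lam n s) (val mu, (Dw * t)%N%:Z).
  by apply/(conemP R) => /=; rewrite -[_%:~R]/((Dw * t)%N%:R) E.
exact: (conem_wz Hs M).
Qed.

Lemma fev_continuous a : continuous (fun x : 'rV[R]_n => fev a x 1).
Proof.
have H := @continuous_lincomb R 'rV[R]_n 'I_n (index_enum _) (fun i => toR R a.1 0 i)
  (a.2%:~R * 1) (fun i x => x 0 i) (fun i => @coord_continuous R 1 n 0 i).
exact: H.
Qed.

Lemma Delta_compact : compact D.
Proof.
pose Kr : R := \sum_(a <- l) \sum_i `|toR R a 0 i|.
apply: (@subclosed_compact _ D [set v : 'rV[R]_n | forall i, `[- Kr, Kr]%classic (v ord0 i)]).
- have -> : D = \bigcap_(a in [set` s]) (fun x : 'rV[R]_n => fev a x 1) @^-1` [set y | 0 <= y].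
    apply/seteqP; split=> x H; first by move/Delta_sat: H => H a as_; exact: H.
    by apply/Delta_sat => a as_; exact: (H a as_).
  apply: closed_bigI => a _; apply: preimage_closed; last exact: closed_ge.
  by move=> x _; exact: fev_continuous.
- exact: (@rV_compact R n (fun=> `[- Kr, Kr]%classic) (fun=> @segment_compact R _ _)).
move=> x /(hull0_hceil Hs EP (fset_uniq _))[c [c0 -> c1]] i /=.
rewrite in_itv /= -ler_norml summxE; apply: le_trans (ler_norm_sum _ _ _) _.
apply: (@le_trans _ _ (\sum_(a <- l) c a * Kr)).
  rewrite !big_seq; apply: ler_sum => a al; rewrite mxE normrM ger0_norm // ler_wpM2l //.
  rewrite /Kr (big_rem a) //= (bigD1 i) //= -addrA lerDl addr_ge0 ?sumr_ge0 // => b _.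
  by apply: sumr_ge0.
have K0 : 0 <= Kr by apply: sumr_ge0 => a _; apply: sumr_ge0.
by rewrite -mulr_suml ler_piMl.
Qed.

Section Upper.
Hypothesis f_dim : has_dim D n.

(** The unit cube is bounded and n exponents form a basis, so the coordinates of its points in that
    basis are bounded. *)
Lemma cube_coords : exists (h : 'I_n -> 'rV[int]_n) (K' : nat),
  (forall i, h i \in l) /\
  forall y : 'rV[R]_n, (forall i, 0 <= y 0 i <= 1) -> exists c : 'I_n -> R,
    y = \sum_i c i *: toR R (h i) /\ forall i, `|c i| <= K'%:R.
Proof.
have [h [hl hi]] := indep_exps Hs f_dim.
pose H : 'M[R]_n := \matrix_(i, j) toR R (h i) 0 j.
have HE (v : 'rV[R]_n) : v *m H = \sum_i v 0 i *: toR R (h i).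
  apply/rowP => j; rewrite mxE summxE; apply: eq_bigr => i _.
  by rewrite !mxE.
have uH : H \in unitmx.
  rewrite -row_free_unit; apply: inj_row_free => v; rewrite HE => /hi v0.
  by apply/rowP => i; rewrite v0 mxE.
pose S : R := \sum_i \sum_j `|invmx H j i|.
have S0 : 0 <= S by apply: sumr_ge0 => i _; apply: sumr_ge0.
exists h, (Num.bound S); split=> // y y01; exists (fun i => (y *m invmx H) 0 i); split.
  by rewrite -HE mulmxKV.
move=> i; apply: le_trans (ltW (archi_boundP S0)); rewrite mxE.
apply: le_trans (ler_norm_sum _ _ _) _; rewrite /S [leRHS](bigD1 i) //=; apply: ler_wpDr.
  by apply: sumr_ge0 => j _; apply: sumr_ge0.
apply: ler_sum => j _; rewrite normrM; have /andP[y0 y1] := y01 j.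
by rewrite ger0_norm // ler_piMl.
Qed.

(** Cubes of side 1/t cover the polytope. Rounding down [t *: x] may leave the cone, so the rounded
    point is shifted by [P0 = K' \sum_i h i]: its error then has coefficients [K' - c i] in
    [0, 2 K'], and it lies in (t + C) Delta with C = 2 K' n. *)
Lemma volume_upper : exists C : nat, forall t : nat, (0 < t)%N ->
  (volume D <= ((size (cpts (t + C)))%:R * (t%:R^-1) ^+ n)%:E)%E.
Proof.
have [h [K' [hl Hc]]] := cube_coords; exists (\sum_(i < n) 2 * K')%N => t t0.
set C := (\sum_(i < n) 2 * K')%N; have tR : 0 < t%:R :> R by rewrite ltr0n.
have tn : t%:R != 0 :> R by rewrite gt_eqF.
pose P0 : 'rV[int]_n := \sum_i h i *+ K'.
pose L := cpts (t + C).
pose lo (mu : K) : 'rV[R]_n := t%:R^-1 *: (toR R mu - toR R P0).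
pose hi (mu : K) : 'rV[R]_n := t%:R^-1 *: (toR R mu - toR R P0 + const_mx 1).
pose B (k : nat) := if onth L k is Some mu then Some (lo mu, hi mu) else None.
have Bcov : D `<=` \bigcup_k set_box (B k).
  move=> x Dx; pose fl : 'rV[int]_n := \row_i Num.floor (t%:R * x 0 i).
  have [|c [cE cK]] := Hc (t%:R *: x - toR R fl).
    move=> i; rewrite !mxE; have /andP[h1 h2] := floor_itv (t%:R * x 0 i).
    by rewrite subr_ge0 h1 /= lerBlDl; move: h2; rewrite intrD => /ltW.
  pose nu := fl + P0.
  have nuE : toR R nu = t%:R *: x + \sum_i (K'%:R - c i) *: toR R (h i).
    have P0E : toR R P0 = \sum_i K'%:R *: toR R (h i).
      rewrite /P0 (big_morph (toR R) (@toRD R n) (@toR0 R n)); apply: eq_bigr => i _.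
      by apply/rowP => j; rewrite !mxE mulmxnE rmorphMn /= mulr_natl.
    under eq_bigr do rewrite scalerBl; rewrite sumrB -P0E -cE /nu toRD opprB.
    move: (toR R fl) (toR R P0) (t%:R *: x) => u v w.
    by rewrite [RHS]addrCA [w + _]addrC subrK addrC.
  have nus : sat s (toR R nu) (t + C)%:R.
    rewrite nuE natrD; apply: satD; first by apply: satZ => //; exact: ltW.
    have hD i : D (toR R (h i)) by apply: conv_hull_sub; right; apply/EP; exists (h i).
    have ck i : 0 <= K'%:R - c i <= (2 * K')%N%:R.
      have := cK i; rewrite ler_norml natrM => /andP[c1 c2]; apply/andP; split; lra.
    rewrite /C natr_sum; elim/big_rec2: _ => [|i k v _ Hv]; first exact: sat0.
    apply: satD => //; have /andP[k1 k2] := ck i; apply: sat_le k2 _; exact: satZ.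
  have nuC : in_cone0 (exps R f) nu by apply/asboolP; exact: (sat_cone Hs EP (fset_uniq _) nus).
  pose mu : K := Sub nu nuC.
  have muL : mu \in L by apply/cpts_sat.
  exists (index mu L) => //; rewrite /B onthE (nth_map mu) ?index_mem // nth_index //=.
  move=> i; rewrite !mxE; have /andP[h1 h2] := floor_itv (t%:R * x 0 i).
  rewrite intrD addrK; apply/andP; split.
    by rewrite mulrC ler_pdivrMr // [x 0 i * _]mulrC.
  rewrite mulrC ler_pdivlMr // [x 0 i * _]mulrC.
  by move: h2; rewrite intrD => /ltW.
apply: le_trans (ereal_inf_lbound _) _; first by exists B.
have volB k : volume_box (B k) = if (k < size L)%N then t%:R^-1 ^+ n else 0.
  rewrite /B; case: ltnP => kL; last by rewrite onthE nth_default ?size_map.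
  have [mu _] : exists mu, mu \in L by case: (L) kL => // mu L' _; exists mu; exact: mem_head.
  rewrite onthE (nth_map mu) //= -[X in _ ^+ X]card_ord -prodr_const; apply: eq_bigr => i _.
  have -> : hi (nth mu L k) 0 i - lo (nth mu L k) 0 i = t%:R^-1.
    by rewrite !mxE -mulrBr [(_ + 1) - _]addrC addKr mulr1.
  by rewrite max_r // invr_ge0 ltW.
have vol0 k : (0%:E <= (volume_box (B k))%:E)%E.
  by rewrite lee_fin volB; case: ifP => // _; rewrite exprn_ge0 // invr_ge0 ltW.
rewrite (@nneseries_split _ _ 0 (size L)) // add0n [X in (_ + X)%E]eseries0 ?adde0; last first.
  by move=> k kL _; rewrite volB ltnNge kL.
rewrite sumEFin lee_fin (eq_big_nat _ _ (F2 := fun=> t%:R^-1 ^+ n)).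
  by rewrite sumr_const_nat subn0 mulr_natl.
by move=> k /andP[_ kL]; rewrite volB kL.
Qed.

End Upper.

(** Enlarging the boxes to open ones, at a total cost of at most [eta], leaves by compactness a
    finite cover, and the lattice points are counted box by box. Finiteness yields one [T0] valid
    for all these boxes. *)
Lemma volume_lower (eta : R) (B : nat -> option ('rV[R]_n * 'rV[R]_n)) :
  0 < eta -> D `<=` \bigcup_k set_box (B k) ->
  exists (S : R) (T0 : nat), 0 <= S /\
    (S%:E <= \sum_(0 <= k <oo) (volume_box (B k))%:E + eta%:E)%E /\
    forall t, (T0 <= t)%N -> (size (cpts t))%:R <= S * t%:R ^+ n.
Proof.
move=> eta0 Bcov.
pose len k i : R := if B k is Some ab then Num.max 0 (ab.2 0 i - ab.1 0 i) else 0.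
have len0 k i : 0 <= len k i by rewrite /len; case: (B k) => // ab; rewrite le_max lexx.
have /choice[ep Hep] : forall k, exists e0 : R, 0 < e0 /\ forall e', 0 <= e' <= e0 ->
    \prod_i (len k i + e') <= \prod_i len k i + eta / (2 ^ k.+1)%:R.
  move=> k; have e2 : 0 < eta / (2 ^ k.+1)%:R by rewrite divr_gt0 // ltr0n expn_gt0.
  by have [e0 e00 He] := prod_perturb (index_enum 'I_n) (len0 k) e2; exists e0.
(* Two thirds of [ep k] widen the box at its two ends; the last third, multiplied by [t], absorbs
   the 1 added to each side in [box_count]. *)
pose ep3 k := ep k / 3; have ep30 k : 0 < ep3 k by rewrite divr_gt0 //; have [] := Hep k.
pose U k : set 'rV[R]_n := if B k is Some ab then
  [set x | forall i, ab.1 0 i - ep3 k < x 0 i < ab.2 0 i + ep3 k] else set0.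
have Uo k : open (U k).
  rewrite /U; case: (B k) => [ab|]; last exact: open0.
  rewrite openE => x Hx.
  apply: (@filter_forall _ _ (fun i => [set y : 'rV[R]_n |
    ab.1 0 i - ep3 k < y 0 i < ab.2 0 i + ep3 k]) (nbhs x)) => i.
  exact: (continuous_near_itv (@coord_continuous R 1 n 0 i) (Hx i)).
have Ucov : D `<=` cover setT U.
  move=> x /Bcov[k _ Hk]; exists k => //; move: Hk; rewrite /U; case: (B k) => // ab Hx i.
  have /andP[h1 h2] := Hx i; apply/andP; split.
    by apply: lt_le_trans h1; rewrite ltrBlDr ltrDl.
  by apply: le_lt_trans h2 _; rewrite ltrDl.
have Dc : @cover_compact 'rV[R]_n D by rewrite -compact_cover; exact: Delta_compact.
have [fs _ Hfs] := Dc _ setT U (fun k _ => Uo k) Ucov.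
pose N := (\sum_(k <- fs) k).+1%N.
have cN x : D x -> exists2 k, (k < N)%N & U k x.
  move=> /Hfs[k kfs Ux]; exists k => //; rewrite ltnS.
  by rewrite (big_rem k) //= leq_addr.
pose v k := volume_box (B k) + eta / (2 ^ k.+1)%:R.
have v0 k : 0 <= volume_box (B k).
  by rewrite /volume_box; case: (B k) => // ab; apply: prodr_ge0 => i _; rewrite le_max lexx.
have e0 k : 0 <= eta / (2 ^ k.+1)%:R by rewrite divr_ge0 ?ler0n // ltW.
have /choice[Tk HTk] : forall k, exists T : nat, (ep3 k)^-1 < T%:R.
  by move=> k; exists (Num.bound (ep3 k)^-1); apply: archi_boundP; rewrite invr_ge0 ltW.
exists (\sum_(0 <= k < N) v k), (\sum_(0 <= k < N) Tk k).+1; split; [|split].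
- by apply: sumr_ge0 => k _; rewrite addr_ge0.
- have vE k : (0%:E <= (volume_box (B k))%:E)%E by rewrite lee_fin.
  apply: le_trans (epsilon_trick xpredT vE (ltW eta0)).
  apply: le_trans (nneseries_lim_ge N _); last by move=> k _ _; rewrite -EFinD lee_fin addr_ge0.
  by rewrite -sumEFin; apply: lee_sum => k _.
move=> t tT; have t0 : 0 < t%:R :> R by rewrite ltr0n; case: (t) tT.
have tn : t%:R != 0 :> R by rewrite gt_eqF.
pose Lk k := [seq mu <- cpts t | `[< U k (t%:R^-1 *: toR R (val mu)) >]].
have cnt : (size (cpts t) <= \sum_(0 <= k < N) size (Lk k))%N.
  have -> : (\sum_(0 <= k < N) size (Lk k))%N = size (flatten [seq Lk k | k <- index_iota 0 N]).
    by rewrite size_flatten sumnE big_map big_map.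
  apply: uniq_leq_size; first exact: cpts_uniq.
  move=> mu mt; have [k kN Uk] : exists2 k, (k < N)%N & U k (t%:R^-1 *: toR R (val mu)).
    apply: cN; have /(sat_hullP Hs EP (fset_uniq _))[_ [y Dy ->]] := proj1 (cpts_sat _ _) mt.
    by rewrite scalerA mulVf // scale1r.
  apply/flatten_mapP; exists k; first by rewrite mem_index_iota.
  by rewrite mem_filter mt andbT; apply/asboolP.
apply: (@le_trans _ _ (\sum_(0 <= k < N) size (Lk k))%N%:R); first by rewrite ler_nat.
rewrite natr_sum mulr_suml !big_nat; apply: ler_sum => k /andP[_ kN].
have tk : t%:R^-1 <= ep3 k.
  rewrite -[leRHS]invrK lef_pV2 ?posrE ?invr_gt0 //; apply: ltW; apply: lt_le_trans (HTk k) _.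
  rewrite ler_nat; apply: leq_trans (ltnW tT).
  rewrite big_mkord (bigD1 (Ordinal kN)) //=; exact: leq_addr.
case Bk : (B k) => [ab|]; last first.
  have -> : Lk k = [::].
    by apply/eqP; rewrite -[_ == _]negbK -has_filter; apply/hasPn => mu _; apply/asboolP; rewrite /U Bk.
  by rewrite mulr_ge0 ?exprn_ge0 ?ler0n // addr_ge0.
pose A i := t%:R * (ab.1 0 i - ep3 k); pose A' i := t%:R * (ab.2 0 i + ep3 k).
have := @box_count R n (map val (Lk k)) A A'; rewrite size_map.
move=> /(_ _ _)/le_trans; apply.
- by rewrite map_inj_uniq ?filter_uniq ?cpts_uniq //; exact: val_inj.
- move=> mu /mapP[nu]; rewrite mem_filter => /andP[/asboolP + _] ->; rewrite /U Bk => Hx i.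
  have /andP[] := Hx i; rewrite !mxE => h1 h2; apply/andP; split; apply: ltW.
    by rewrite /A mulrC -ltr_pdivlMr // mulrC.
  by rewrite /A' mulrC -ltr_pdivrMr // mulrC.
apply: (@le_trans _ _ (\prod_i (t%:R * (len k i + ep k)))).
  apply: ler_prod => i _; rewrite addr_ge0 ?le_max ?lexx //=.
  have l3 : ep k = ep3 k + ep3 k + ep3 k by rewrite /ep3; field.
  rewrite l3 !mulrDr !addrA lerD //; last first.
    by rewrite -(ler_pM2l t0) divff // in tk.
  rewrite ge_max; apply/andP; split.
    by rewrite !addr_ge0 // mulr_ge0 // ltW.
  have : ab.2 0 i - ab.1 0 i <= len k i by rewrite /len Bk le_max lexx orbT.
  by rewrite -(ler_pM2l t0) /A /A' !mulrDr !mulrN; lra.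
rewrite big_split prodr_const card_ord /= mulrC ler_wpM2r ?exprn_ge0 ?ler0n //.
have [ep0 He] := Hep k; apply: le_trans (He (ep k) _) _; first by rewrite lexx ltW.
by rewrite /v lerD2r /volume_box Bk; apply: ler_prod => i _; rewrite len0 /len Bk lexx.
Qed.

(** Since [kC] grows as t^n / n!, the counts squeeze [r / n!] between a bound for every cover by
    boxes and the covers by cubes; the shifts in t disappear by [pow_ratio_le]. *)
Lemma volume_rank (r : nat) : has_dim D n ->
  (forall t, (size (cpts t) <= kC (fun _ : 'I_n => 1%N) t * r)%N) ->
  (exists c : nat, forall t, (kC (fun _ : 'I_n => 1%N) t * r <= size (cpts (t + c)))%N) ->
  (r%:R%:E = (n`!)%:R%:E * volume D)%E.
Proof.
move=> f_dim up [c lowc]; have nf : 0 < n`!%:R :> R by rewrite ltr0n fact_gt0.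
have nfn : n`!%:R != 0 :> R by rewrite gt_eqF.
have lower : ((r%:R / n`!%:R)%:E <= volume D)%E.
  apply: le_ereal_inf_tmp => _ [B Bcov <-]; apply/lee_addgt0Pr => eta eta0.
  have [S [T0 [S0 [SE HS]]]] := volume_lower eta0 Bcov; apply: le_trans SE; rewrite lee_fin.
  rewrite ler_pdivrMr //; apply: (@pow_ratio_le R n c T0); first exact: ler0n.
  move=> t tT; rewrite mulrAC; have := HS (t + c)%N (leq_trans tT (leq_addr _ _)).
  rewrite -(ler_pM2r nf); apply: le_trans.
  rewrite -natrX -!natrM ler_nat; apply: (@leq_trans (r * (kC (fun _ : 'I_n => 1%N) t * n`!))).
    by rewrite leq_mul2l kC_fact_ge orbT.
  by rewrite mulnA leq_mul2r [(r * _)%N]mulnC lowc orbT.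
have [C HC] := volume_upper f_dim.
have vfin : volume D \is a fin_num.
  have := HC 1%N isT; move: lower; case: (volume D) => //=.
have vE : volume D = (fine (volume D))%:E by rewrite fineK.
apply/eqP; rewrite eq_le; apply/andP; split.
  by move: lower; rewrite vE -EFinM !lee_fin ler_pdivrMr // mulrC.
rewrite vE -EFinM lee_fin; apply: (@pow_ratio_le R n (C + n) 1).
  rewrite mulr_ge0 ?ler0n //; move: lower; rewrite {1}vE lee_fin; apply: le_trans.
  by rewrite divr_ge0 ?ler0n.
move=> t t1; have := HC t t1; rewrite {1}vE lee_fin exprVn ler_pdivlMr ?exprn_gt0 ?ltr0n // => H.
rewrite -mulrA; apply: le_trans (ler_wpM2l (ltW nf) H) _.
rewrite -natrX -!natrM ler_nat mulnC.
apply: (@leq_trans (kC (fun _ : 'I_n => 1%N) (t + C) * r * n`!)); first by rewrite leq_mul2r up orbT.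
by rewrite mulnAC mulnC leq_mul2l addnA kC_fact_le orbT.
Qed.

End Volume.

Section HullWeight.
Variables (R : realType) (n : nat) (A : set 'rV[R]_n).

Lemma weight_hull_ge0 v : 0 <= weight (hull0 A) v.
Proof.
rewrite /weight; set S := [set c | _].
have [->|/set0P ne] := eqVneq S set0; first by rewrite inf0.
by apply: lb_le_inf => // k [].
Qed.

Lemma weight_hull0 : weight (hull0 A) 0 = 0.
Proof.
apply/eqP; rewrite eq_le weight_hull_ge0 andbT; apply: ge_inf; first by exists 0 => k [].
by split=> //; exists 0; [exact: hull0_0|rewrite scale0r].
Qed.

Definition cwt (x : conept A) : R := weight (hull0 A) (toR R x).

Lemma cwtD (x y z : conept A) : zmul x y = Some z -> cwt z = cwt x + cwt y.
Proof.
move=> E; have [cof|/conept_mulN E'] := pselect (cofacial (hull0 A) (toR R x) (toR R y)); last first.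
  by move: E; rewrite -[zmul x y]/(conept_mul x y) E'.
have [k kE kv] := conept_mulP cof; have E2 : Some z = Some k by rewrite -E -kE.
case: E2 => ->; rewrite /cwt (toR_val kv) cofacial_weight //; last exact: weight_hull0.
- by case: (x) => ? /= /asboolP.
- by case: (y) => ? /= /asboolP.
Qed.

End HullWeight.

(** * The family G as a perturbation of f *)

Section FamilyBasis.
Variables (R : realType) (F : finFieldType) (n s : nat) (f : {malg F['rV[int]_n]}).
Variable P : {malg F[('rV[int]_s * 'rV[int]_n)%type]}.
Hypothesis f_weight : forall mu, mu \in msupp f -> wDelta R f mu = 1.
Hypothesis P_weight : forall k, k \in msupp P ->
  cone (Delta R f) (toR R k.2) /\ wDelta R f k.2 < 1.
Local Notation K1 := (conept (gexps R f P)).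
Local Notation K2 := (conept (exps R f)).
Local Notation Q := (calg F (K1 * K2)%type).
Local Notation KG := ('rV[int]_s * 'rV[int]_n)%type.
Local Notation u1 := (@cwt R s (gexps R f P)).
Local Notation u2 := (@cwt R n (exps R f)).
Local Notation iext := (@iext F K1 K2).

Definition gmon (k : KG) : Q :=
  if W R f P k == 1 then
    match (insub k.1 : option K1), (insub k.2 : option K2) with
    | Some ga, Some mu => cX (ga, mu)
    | _, _ => 0
    end
  else 0.

Lemma G1E : G1 R f P = lext gmon (Gpoly f P) :> Q.
Proof.
rewrite /G1 /lext big_mkcond; apply: eq_bigr => k _; rewrite /gmon.
case: (W R f P k == 1); last exact: esym (scaler0 _ _).
case: (insub k.1) => [ga|]; last exact: esym (scaler0 _ _).
case: (insub k.2) => [mu|]; last exact: esym (scaler0 _ _).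
exact: malgUZ.
Qed.

Lemma in_exps a : a \in msupp f -> in_cone0 (exps R f) a.
Proof.
move=> af; apply/asboolP; exists 1, (toR R a); split; rewrite ?scale1r //.
by apply: conv_hull_sub; right; exists a.
Qed.

Lemma G1_split : G1 R f P = iext (fbar R f) + lext gmon P :> Q.
Proof.
rewrite G1E /Gpoly lextD; congr (_ + _); rewrite lext_sum /fbar.
rewrite [RHS](lext_sum (fun mu => cX (zone, mu) : Q)).
rewrite [LHS]big_seq [RHS]big_seq; apply: eq_bigr => a af; rewrite lextU /gmon.
have -> : W R f P (0, a) == 1.
  by rewrite /W /= f_weight // /wGamma toR0 weight_hull0 add0r.
rewrite /= (insubT _ (conept0_subproof (gexps R f P))) (insubT _ (in_exps af)) /iext lextU.
by congr (_ *: cX (_, _)); apply: val_inj.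
Qed.

Local Notation xd l := (@xdx F n (K1 * K2)%type (fun k => val k.2) l).

Lemma xdx_iext l g : xd l (iext g) = iext (xdx val l g).
Proof.
have L1 : linear (fun g => xd l (iext g)) by move=> c g1 g2; rewrite iext_lin xdx_lin.
have L2 : linear (fun g => iext (xdx val l g)) by move=> c g1 g2; rewrite xdx_lin iext_lin.
rewrite -[g in LHS]lext_id -[g in RHS]lext_id (lext_comp _ _ L1) (lext_comp _ _ L2).
apply: eq_lext => mu _ /=; rewrite -[<< mu >>]/(cX mu : calg F K2) iextX !xdxE !lextU !scale1r.
have Z (c : F) x : iext (c *: x) = c *: iext x by exact: lextZ.
by rewrite /= Z iextX.
Qed.

Lemma msupp_xdx (K : choiceType) (e : K -> 'rV[int]_n) l (g : {malg F[K]}) k :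
  k \in msupp (xdx e l g) -> k \in msupp g.
Proof.
rewrite xdxE => /msupp_lext[k' k'g] /(fsubsetP (msuppZ_le _ _)).
by rewrite msuppU oner_eq0 inE => /eqP->.
Qed.

Lemma Dfbar_wt l (mu : K2) : mu \in msupp (Dfbar R f l) -> u2 mu = 1.
Proof.
move=> /msupp_xdx; rewrite /fbar.
pose Q0 (g : calg F K2) := forall mu : K2, mu \in msupp g -> u2 mu = 1.
suff : Q0 (fbar R f) by apply.
rewrite /fbar big_seq; elim/big_rec: _ => [nu|a g af Hg nu]; first by rewrite msupp0.
move=> /(fsubsetP (msuppD_le _ _)); rewrite inE => /orP[|/Hg//].
rewrite (insubT _ (in_exps af)) => /(fsubsetP msuppU_le); rewrite inE => /eqP->.
exact: f_weight.
Qed.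

(** The support of [P] is finite and its x-weights are below 1, so a positive gap exists; with an
    empty support any positive number serves. *)
Lemma delta_ex : exists2 delta : R, 0 < delta &
  forall k, k \in msupp P -> delta <= 1 - wDelta R f k.2.
Proof.
have [[k0 k0P]|no] := pselect (exists k, k \in msupp P); last first.
  by exists 1 => // k kP; case: no; exists k.
have [k kP kmin] := seq_argmin (fun k : KG => 1 - wDelta R f k.2) k0P.
by exists (1 - wDelta R f k.2) => //; rewrite subr_gt0; have [_] := P_weight kP.
Qed.

Definition Epart l : Q := xd l (lext gmon P).

Lemma DG1_split l : DG1 R f P l = iext (Dfbar R f l) + Epart l :> Q.
Proof.
rewrite /DG1 G1_split /Epart /Dfbar -xdx_iext.
have L : linear (xd l : Q -> Q) by exact: xdx_lin.
by have := L 1 (iext (fbar R f)) (lext gmon P); rewrite !scale1r.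
Qed.

(** A term of total weight 1 has t-weight exactly 1 minus its x-weight. *)
Lemma Epart_fil delta l : (forall k, k \in msupp P -> delta <= 1 - wDelta R f k.2) ->
  Fil u1 u2 delta 1 (Epart l).
Proof.
move=> Hd p /msupp_xdx/msupp_lext[k kP]; rewrite /gmon.
case: eqP => [W1|_]; last by rewrite msupp0.
case: insubP => [ga _ gaE|_]; last by rewrite msupp0.
case: insubP => [mu _ muE|_]; last by rewrite msupp0.
rewrite msuppX => /eqP-> /=; move: W1; rewrite /W /wGamma /cwt gaE muE => W1.
split=> //; apply: le_trans (Hd k kP) _; rewrite -W1.
by rewrite addrK.
Qed.

Variable sq : seq ('rV[int]_n * int).
Hypothesis Hs : forall (u : 'rV[R]_n) k, hceil (msupp f : seq _) u k <-> sat sq u k.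
Hypothesis f_dim : has_dim (Delta R f) n.
Variables (r : nat) (b : 'I_r -> K2).
Local Notation If := (gen_ideal (Dfbar R f)).
Hypothesis b_span : forall g : Rbar R f, exists c : 'I_r -> F, If (g - \sum_j c j *: cX (b j)).
Hypothesis b_indep : forall c : 'I_r -> F, If (\sum_j c j *: cX (b j)) -> forall j, c j = 0.

Lemma tmon_spanR (mu : K2) :
  sp [set tmon b x | x in [set x | tdegR u2 b x = u2 mu]] (cX mu : calg F K2).
Proof.
have : sp [set tmon b x | x in [set x | @tmon_deg R F n f sq r b x = `|wz R f sq (val mu)|%N]]
  (cX mu : Rbar R f) by exact: tmon_span.
apply: sp_mono => _ [x xE <-]; exists x => //.
have D0 : (wden sq)%:R != 0 :> R by rewrite gt_eqF // DwR_gt0.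
have wu (nu : K2) : `|wz R f sq (val nu)|%N%:R = u2 nu * (wden sq)%:R.
  rewrite /cwt -(wzE Hs (coneptP nu)) -[in RHS](gez0_abs (wz_ge0 Hs (coneptP nu))).
  by [].
apply: (mulIf D0); rewrite /tdegR mulrDl -!wu -(xE : tmon_deg _ _ _ = _) /tmon_deg natrD natrM.
by rewrite [in RHS]mulrC.
Qed.

(** Kept general in the monomial basis [b], for it is used twice: with the basis that proves
    freeness, and with the prescribed set [B]. *)
Lemma family_basis :
  [/\ regular_seq (DG1 R f P : 'I_n -> Mbar R f P),
      forall c : 'I_r -> Sbar R f P,
        gen_ideal (DG1 R f P) (\sum_j c j *: (<< (zone, b j) >> : Mbar R f P)) ->
        forall j, c j = 0 &
      forall a : Mbar R f P, exists c : 'I_r -> Sbar R f P,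
        gen_ideal (DG1 R f P) (a - \sum_j c j *: (<< (zone, b j) >> : Mbar R f P))].
Proof.
have [delta d0 Hd] := delta_ex.
have u2_0 x : 0 <= u2 x by exact: weight_hull_ge0.
have Ef l := @Epart_fil delta l Hd.
have Hinj : forall g, lext (bas (Dfbar R f) b) g = 0 -> g = 0.
  by move=> g; exact: (tmon_inj Hs f_weight f_dim b_span b_indep).
split.
- exact: (DG_regular u2_0 (@cwtD _ _ _) (@cwtD _ _ _) d0 Dfbar_wt Ef DG1_split Hinj tmon_spanR).
- exact: (bX_indep u2_0 (@cwtD _ _ _) (@cwtD _ _ _) d0 Dfbar_wt Ef DG1_split Hinj tmon_spanR).
exact: (bX_span u2_0 (@cwtD _ _ _) (@cwtD _ _ _) d0 Dfbar_wt Ef DG1_split Hinj tmon_spanR).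
Qed.

End FamilyBasis.

Lemma collect_comb (S : pzRingType) (V : lmodType S) m k (e : 'I_k -> V) (sg : 'I_m -> 'I_k)
    (c : 'I_m -> S) :
  \sum_i c i *: e (sg i) = \sum_j (\sum_(i | sg i == j) c i) *: e j.
Proof.
rewrite (partition_big sg xpredT) //=; apply: eq_bigr => j _.
by rewrite scaler_suml; apply: eq_bigr => i /eqP->.
Qed.

Theorem theorem3p1 (R : realType) (F : finFieldType)
    (Fbar : closedFieldType) (iota : {rmorphism F -> Fbar})
    (Fbar_algebraic : integralRange iota)
    (n s : nat)
    (f : {malg F['rV[int]_n]})
    (P : {malg F[('rV[int]_s * 'rV[int]_n)%type]})
    (Delta_dim : has_dim (Delta R f) n)
    (f_nondegenerate : laurent_nondegenerate R iota f)
    (f_weight : forall mu, mu \in msupp f -> wDelta R f mu = 1)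
    (P_weight : forall k, k \in msupp P ->
       cone (Delta R f) (toR R k.2) /\ wDelta R f k.2 < 1) :
  let If : set (Rbar R f) := gen_ideal (Dfbar R f) in
  let DG := DG1 R f P in
  let IG : set (Mbar R f P) := gen_ideal DG in
  [/\ forall i, i <> n -> acyclic_at DG i,
      subquotient_iso (S := Sbar R f P) (@top_coef (Mbar R f P) n)
        (cocycle DG n) (coboundary DG n) IG,
      exists r : nat,
        [/\ free_subquotient (S := Sbar R f P)
              (cocycle DG n) (coboundary DG n) r,
            free_subquotient (S := F) [set: Rbar R f] If r
          & (r%:R%:E = (n`!)%:R%:E * volume (Delta R f))%E]
    & forall B : set (conept (exps R f)),
        direct_sum (lin_span (S := F) [set (<< mu >> : Rbar R f) | mu in B])
                   If ->
        let BM := [set (<< (zone, mu) >> : Mbar R f P) | mu in B] in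
        lin_free (S := Sbar R f P) BM /\
        direct_sum (lin_span (S := Sbar R f P) BM) IG].
Proof.
move=> If DG IG; have [sq Hs] := @weyl R n (msupp f : seq _) (fset_uniq _).
have [r [b [b_span b_indep]]] := exists_basis Hs f_weight Fbar_algebraic f_nondegenerate.
have [reg indep span] := family_basis f_weight P_weight Hs Delta_dim b_span b_indep.
have coefZ (a : Sbar R f P) (v : Omega (Mbar R f P) n n) : top_coef (a *: v) = a *: top_coef v.
  by rewrite -!(top_coefE _ (top_set n)) ffunE.
have coefD (v w : Omega (Mbar R f P) n n) : top_coef (v + w) = top_coef v + top_coef w.
  by rewrite -!(top_coefE _ (top_set n)) ffunE.
have [IG0 IGD IGN IGZ] : [/\ IG 0, forall u v, IG u -> IG v -> IG (u + v),
    forall u, IG u -> IG (- u) & forall (a : Sbar R f P) u, IG u -> IG (a *: u)].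
  split.
  - by exists (fun=> 0); rewrite big1 // => l _; rewrite mulr0.
  - move=> _ _ [h1 ->] [h2 ->]; exists (fun l => h1 l + h2 l).
    by rewrite -big_split; apply: eq_bigr => l _; rewrite mulrDr.
  - move=> _ [h ->]; exists (fun l => - h l).
    by rewrite -sumrN; apply: eq_bigr => l _; rewrite mulrN.
  - move=> a _ [h ->]; exists (fun l => a *: h l).
    by rewrite scaler_sumr; apply: eq_bigr => l _; rewrite scalerAr.
split.
- exact: acyclic_regular reg.
- split.
  + by move=> a v w; rewrite coefD coefZ.
  + by move=> v _; exact: coboundary_top.
  + move=> u; exists (top_form n u); first exact: cocycle_top.
    by rewrite top_formK subrr.
- exists r; split.
  + exists (fun j => top_form n (<< (zone, b j) >> : Mbar R f P)); split.
      by move=> j; exact: cocycle_top.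
    move=> v _; have key c : coboundary DG n (v - \sum_j c j *: top_form n (<< (zone, b j) >> : Mbar R f P))
        <-> IG (top_coef v - \sum_j c j *: (<< (zone, b j) >> : Mbar R f P)).
      rewrite coboundary_top top_coefB top_coef_sum.
      by under eq_bigr do rewrite coefZ top_formK.
    have [c Hc] := span (top_coef v); exists c; split; first exact/key.
    move=> c' /key Hc'; apply/funext => j; apply/eqP; rewrite -subr_eq0; apply/eqP.
    apply: (indep (fun j => c j - c' j)).
    under eq_bigr do rewrite scalerBl; rewrite sumrB.
    by have := IGD _ _ Hc' (IGN _ Hc); rewrite opprB addrC addrA subrK.
  + exists (fun j => cX (b j)); split=> // v _; have [c Hc] := b_span v; exists c; split=> // c' Hc'.
    have [_ IfL] := If_sub R f; apply/funext => j; apply/eqP; rewrite -subr_eq0; apply/eqP.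
    apply: (b_indep (fun j => c j - c' j)).
    under eq_bigr do rewrite scalerBl; rewrite sumrB.
    by have := IfL (-1) _ _ Hc Hc'; rewrite scaleN1r opprB addrA subrK.
  + apply: (volume_rank Hs Delta_dim); first exact: (count_upper Hs f_weight b_span).
    exact: (count_lower Hs f_weight Delta_dim b_span b_indep).
(* [B] is finite and is itself a monomial basis of the quotient, so its lift to [Mbar] is covered by
   [family_basis]. *)
move=> B HB BM; have [t [ut tB t_span t_indep]] := monomial_set_seq b_span HB.
have [_ indepB spanB] := family_basis f_weight P_weight Hs Delta_dim t_span t_indep.
pose e (j : 'I_(size t)) : Mbar R f P := << (zone, tnth (in_tuple t) j) >>.
have eBM j : BM (e j) by exists (tnth (in_tuple t) j) => //; apply/tB; exact: mem_tnth.
have BMe m (x : 'I_m -> Mbar R f P) : (forall i, BM (x i)) ->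
    exists sg : 'I_m -> 'I_(size t), forall i, x i = e (sg i).
  move=> xB; suff /choice[sg H] : forall i, exists j, x i = e j by exists sg.
  move=> i; have [mu /tB mt <-] := xB i; have /tnthP[j jE] : mu \in in_tuple t by [].
  by exists j; rewrite /e -jE.
have collect m := @collect_comb (Sbar R f P) (Mbar R f P) m _ e.
split.
  move=> m x c x_inj xB; have [sg sgE] := BMe m x xB => x0 i.
  have sg_inj : injective sg by move=> i1 i2 E; apply: x_inj; rewrite !sgE E.
  have : IG (\sum_j (\sum_(i | sg i == j) c i) *: e j).
    rewrite -collect; under eq_bigr do rewrite -sgE; by rewrite x0.
  move=> /indepB/(_ (sg i)); rewrite (big_pred1 i) // => i'.
  by rewrite inj_eq.
split=> [v|v [m [x [c [xB ->]]]] vI].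
  have [c Hc] := spanB v; exists (\sum_j c j *: e j), (v - \sum_j c j *: e j); split.
  - by exists (size t), e, c; split; [exact: eBM|exact: erefl].
  - exact: Hc.
  - exact: esym (subrKC _ _).
have [sg sgE] := BMe m x xB; move: vI; under eq_bigr do rewrite sgE; rewrite collect => vI.
by rewrite big1 // => j _; rewrite (indepB _ vI j) scale0r.
Qed.
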